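(* Fix $\lambda>0$, $p>2$ and, for $\ell>0$, let $\mathcal{G}_\ell$ be the $\mathcal{T}$-graph with a terminal edge of length $\ell$. Consider the positive solutions $u\in H^1(\mathcal{G}_\ell)$ of $-u''+\lambda u=|u|^{p-2}u$ on $\mathcal{G}_\ell$ (with Neumann–Kirchhoff conditions). Then: 1. For each $\ell>0$, there exists a unique positive solution of type $\mathcal{A}$. 2. For each $\ell>0$, there are no positive solutions of type $\mathcal{B}$. 3. Set $\ell^*:=\frac{\pi}{\sqrt{\lambda(p-2)}}>0$. If $\ell\in(n\ell^*,(n+1)\ell^*]$ with $n\in\{0,1,2,\dots\}$, then there exist exactly $4n+2$ positive solutions of type $\mathcal{C}$.
   Context: The $\mathcal{T}$-graph $\mathcal{G}_\ell$ ($\ell>0$) is the metric graph made of two half-lines $e_1,e_2$, identified with $I_1=I_2=[0,\infty)$, and a terminal edge $e_3$, identified with $I_3=[0,\ell]$, all glued at the vertex $\mathbf{0}$ (coordinate $0$ on each edge); the other end of $e_3$ (coordinate $\ell$) is the vertex $\boldsymbol{\ell}$. A function on $\mathcal{G}_\ell$ is a triple $u=(u_1,u_2,u_3)$, $u_i:I_i\to\mathbb{R}$; $u\in H^1(\mathcal{G}_\ell)$ means $u_i\in H^1(I_i)$ and $u_1(0)=u_2(0)=u_3(0)$. A positive solution of $-u''+\lambda u=|u|^{p-2}u$ on $\mathcal{G}_\ell$ is $u\in H^1(\mathcal{G}_\ell)$, $u>0$, satisfying $-u_i''+\lambda u_i=|u_i|^{p-2}u_i$ on each $I_i$ and the Neumann–Kirchhoff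 conditions $u_1'(0)+u_2'(0)+u_3'(0)=0$, $u_3'(\ell)=0$. Let $\varphi^\lambda\in H^1(\mathbb{R})$ be the real line soliton: the unique positive even solution, decreasing on $[0,\infty)$, of $-\varphi''+\lambda\varphi=|\varphi|^{p-2}\varphi$ in $\mathbb{R}$. On each half-line every positive solution is a portion of a translate of $\varphi^\lambda$. Types: type $\mathcal{A}$: $u_1=u_2$ and these are strictly decreasing on $[0,\infty)$; type $\mathcal{B}$: $u_1=u_2$ and these are not monotone, attaining the maximum of $\varphi^\lambda$ in the interior of the half-lines; type $\mathcal{C}$: after identifying $e_1\cup e_2$ with $\mathbb{R}$, $(u_1,u_2)$ is a translate of $\varphi^\lambda$, i.e. $u_1(x)=\varphi^\lambda(x+y)$ and $u_2(x)=\varphi^\lambda(x-y)$ for $x\ge 0$ and some $y\in\mathbb{R}$. *)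

(* Defs.v *)
From mathcomp Require Export all_boot all_order all_algebra.
From mathcomp Require Export all_classical all_reals all_analysis.

Set Implicit Arguments.
Unset Strict Implicit.
Unset Printing Implicit Defensive.

Export Order.TTheory GRing.Theory Num.Theory.
Export numFieldNormedType.Exports.

Local Open Scope classical_set_scope.
Local Open Scope ring_scope.

Definition diff_quot {R : realType} (f : R -> R) (x y : R) : R :=
  (f y - f x) / (y - x).

(* The limit runs over the points of I only, so this is the one-sided
   derivative at an endpoint of an interval I. *)
Definition derivable_in {R : realType} (I : set R) (f : R -> R) (x : R) : Prop :=
  cvg (diff_quot f x y @[y --> within I x^']).

Definition derive_in {R : realType} (I : set R) (f : R -> R) (x : R) : R :=
  lim (diff_quot f x y @[y --> within I x^']).

Definition test_function {R : realType} (I : set R) (phi : R -> R) : Prop :=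
  (forall (n : nat) (x : R), derivable (derive1n n phi) x 1) /\
  (exists K : set R, compact K /\ K `<=` interior I /\
    forall x, ~ K x -> phi x = 0).

Definition L2 {R : realType} (I : set R) (f : R -> R) : Prop :=
  (f \_ I) \in Lfun (@lebesgue_measure R) 2%:E.

Definition weak_derivative {R : realType} (I : set R) (f g : R -> R) : Prop :=
  forall phi, test_function I phi ->
    \int[@lebesgue_measure R]_(x in I) (f x * derive1 phi x) =
    - \int[@lebesgue_measure R]_(x in I) (g x * phi x).

(* An element of H^1(I), I an interval, is identified with its continuous
   representative. *)
Definition H1 {R : realType} (I : set R) (f : R -> R) : Prop :=
  {within I, continuous f} /\ L2 I f /\
  (exists g : R -> R, L2 I g /\ weak_derivative I f g).

Definition solves {R : realType} (lam p : R) (I : set R) (f : R -> R) : Prop :=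
  forall x, I x ->
    derivable_in I f x /\ derivable_in I (derive_in I f) x /\
    - derive_in I (derive_in I f) x + lam * f x
      = `|f x| `^ (p - 2) * f x.

Definition is_soliton {R : realType} (lam p : R) (f : R -> R) : Prop :=
  H1 setT f /\ solves lam p setT f /\
  (forall x, 0 < f x) /\
  (forall x, f (- x) = f x) /\
  (forall x y, 0 <= x -> x < y -> f y < f x).

(* [get] is a choice operator: it satisfies [is_soliton] as soon as some function
   does. *)
Definition soliton {R : realType} (lam p : R) : R -> R :=
  get [set f | is_soliton lam p f].

Inductive edge := e1 | e2 | e3.

Definition edge_set {R : realType} (l : R) (e : edge) : set R :=
  match e with
  | e1 | e2 => [set x | 0 <= x]
  | e3 => [set x | 0 <= x <= l]
  end.

Definition triple (R : realType) := edge -> R -> R.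

(* A function on the graph is represented by the triple of the extensions by
   zero of its components, so that equality of triples is equality of
   functions on the graph. *)
Definition graph_function {R : realType} (l : R) (u : triple R) : Prop :=
  forall e x, ~ edge_set l e x -> u e x = 0.

Definition H1_graph {R : realType} (l : R) (u : triple R) : Prop :=
  graph_function l u /\
  (forall e, H1 (edge_set l e) (u e)) /\
  u e1 0 = u e2 0 /\ u e2 0 = u e3 0.

Definition neumann_kirchhoff {R : realType} (l : R) (u : triple R) : Prop :=
  derive_in (edge_set l e1) (u e1) 0 + derive_in (edge_set l e2) (u e2) 0
    + derive_in (edge_set l e3) (u e3) 0 = 0 /\
  derive_in (edge_set l e3) (u e3) l = 0.

Definition positive_solution {R : realType} (lam p l : R) (u : triple R) : Prop :=
  H1_graph l u /\
  (forall e x, edge_set l e x -> 0 < u e x) /\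
  (forall e, solves lam p (edge_set l e) (u e)) /\
  neumann_kirchhoff l u.

Definition type_A {R : realType} (u : triple R) : Prop :=
  u e1 = u e2 /\ (forall x y, 0 <= x -> x < y -> u e1 y < u e1 x).

Definition monotone_half_line {R : realType} (f : R -> R) : Prop :=
  (forall x y, 0 <= x -> x <= y -> f x <= f y) \/
  (forall x y, 0 <= x -> x <= y -> f y <= f x).

Definition type_B {R : realType} (lam p : R) (u : triple R) : Prop :=
  u e1 = u e2 /\ ~ monotone_half_line (u e1) /\
  (exists x, 0 < x /\ exists z, u e1 x = soliton lam p z /\
    forall w, soliton lam p w <= soliton lam p z).

Definition type_C {R : realType} (lam p : R) (u : triple R) : Prop :=
  exists y : R, forall x, 0 <= x ->
    u e1 x = soliton lam p (x + y) /\ u e2 x = soliton lam p (x - y).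

Definition ell_star {R : realType} (lam p : R) : R :=
  pi / Num.sqrt (lam * (p - 2)).

(* Main.v *)
(* Write the equation as [u'' = - gap1 u], where [gap1] is the derivative of the well
   [gap] with bottom at the constant solution [ctr], and let [amp u] be the signed square
   root of [gap u], [level] its inverse. In the coordinates [amp u = r cos b],
   [u' / sqrt 2 = - r sin b] orbits are arcs of circles, run through in the time
   [\int level' (r cos b) / sqrt 2 db].

   On a half-line square integrability forces the energy of the soliton, so [u e1] and
   [u e2] are portions of translates of it and everything is decided on [e3].
   Type C: [u e3] has slope [0] at both ends, so it is the constant [ctr] or [l] is a number
   [k] of half-periods of the orbit through [level s]. Half-periods increase strictly with
   [|s|] from [k ell_star] to infinity, since [level'] minus its linear part at [0] is strictly
   monotone on both sides of [0] (the linear part cancels over a half-period). This leaves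
   [2 n + 1] values of [u e3 0], each attained by the soliton at two points [y], [- y].
   Type A: the Kirchhoff condition makes [u e3] rise from [level s] with squared radius
   [4 rad ^ 2 - 3 s ^ 2], and [l] must be the time [tau s] at which it reaches its maximum;
   [tau] decreases strictly from infinity to [0].
   Type B: [u e3] starts downwards with an energy that leaves it no critical point below
   its initial value, so its slope cannot vanish at [l]. *)

Require Import Defs.
From mathcomp Require Import measurable_realfun.
From mathcomp Require Import ring lra.

Set Implicit Arguments.
Unset Strict Implicit.
Unset Printing Implicit Defensive.

Local Open Scope classical_set_scope.
Local Open Scope ring_scope.

(** Written in [u], the time between two turning points is an integral that is singular at both
    ends. In the polar angle it becomes, for type C, the integral of a continuous density between
    fixed angles, and [s] enters through the argument of [level'] alone, so that times are compared
    pointwise. Three facts on [level'] carry the comparisons: it decreases; [s * level' s] increases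
    for [s >= 0]; [level' s + tilt * s] has a strict minimum at 0. Each comes down to the sign of a
    function of [u] that vanishes at [ctr], found by differentiating until the sign can be read off.
    [ell_star] is the half-period of the equation linearized at [ctr], whose frequency is
    [sqrt (gap2 ctr) = sqrt (lam * (p - 2))]. A nonconstant orbit is strictly slower, which is why
    the intervals of [l] are open on the left. For [tau] the final angle moves with [s] too, and the
    radius is largest at [s = 0]: it increases with [s] before 0 and decreases after. The two signs
    of [s] therefore need separate arguments. *)

(** * Derivatives and consequences of the mean value theorem *)

Section calculus.
Context {R : realType}.
Implicit Types (f g : R -> R) (x a b c : R).

Lemma is_derive_addf f g x a b : is_derive x 1 f a -> is_derive x 1 g b ->
  is_derive x 1 (fun y => f y + g y) (a + b).
Proof. by move=> fa gb; exact: is_deriveD. Qed.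

Lemma is_derive_subf f g x a b : is_derive x 1 f a -> is_derive x 1 g b ->
  is_derive x 1 (fun y => f y - g y) (a - b).
Proof. by move=> fa gb; exact: is_deriveB. Qed.

Lemma is_derive_oppf f x a : is_derive x 1 f a ->
  is_derive x 1 (fun y => - f y) (- a).
Proof. by move=> fa; exact: is_deriveN. Qed.

Lemma is_derive_mulf f g x a b : is_derive x 1 f a -> is_derive x 1 g b ->
  is_derive x 1 (fun y => f y * g y) (a * g x + f x * b).
Proof.
move=> fa gb; apply: (is_derive_eq (is_deriveM fa gb)).
by rewrite /GRing.scale/= addrC (mulrC a).
Qed.

Lemma is_derive_expf f n x a : is_derive x 1 f a ->
  is_derive x 1 (fun y => f y ^+ n) (n%:R * f x ^+ n.-1 * a).
Proof.
by move=> fa; rewrite -exprfctE; exact: is_deriveX.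
Qed.

Lemma is_derive_invf f x a : f x != 0 -> is_derive x 1 f a ->
  is_derive x 1 (fun y => (f y)^-1) (- a / f x ^+ 2).
Proof.
move=> fx0 fa; apply: (is_derive_eq (is_deriveV fx0 fa)).
by rewrite /GRing.scale/= !mulNr mulrC.
Qed.

Lemma is_derive_compf f g x a b : is_derive (g x) 1 f a -> is_derive x 1 g b ->
  is_derive x 1 (fun y => f (g y)) (a * b).
Proof.
move=> fa gb; apply: (is_derive_eq (@is_derive1_comp R f g x a b fa gb)).
by rewrite /GRing.scale/=.
Qed.

Lemma is_derive_continuous f x a : is_derive x 1 f a -> {for x, continuous f}.
Proof.
by move=> [df _]; apply/differentiable_continuous; rewrite -derivable1_diffP.
Qed.

Lemma derive_ge0_le f df a b : a <= b ->
  (forall x, a < x < b -> is_derive x 1 f (df x)) ->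
  {within `[a, b], continuous f} ->
  (forall x, a < x < b -> 0 <= df x) -> f a <= f b.
Proof.
rewrite le_eqVlt => /predU1P[->//|ab] fdf cf df0.
have fdf' x : x \in `]a, b[ -> is_derive x 1 f (df x) by rewrite in_itv; exact: fdf.
have [c cab] := MVT ab fdf' cf; rewrite in_itv/= in cab.
by rewrite -subr_ge0 => ->; rewrite mulr_ge0 ?df0// subr_ge0 ltW.
Qed.

Lemma derive_gt0_lt f df a b : a < b ->
  (forall x, a < x < b -> is_derive x 1 f (df x)) ->
  {within `[a, b], continuous f} ->
  (forall x, a < x < b -> 0 < df x) -> f a < f b.
Proof.
move=> ab fdf cf df0.
have fdf' x : x \in `]a, b[ -> is_derive x 1 f (df x) by rewrite in_itv; exact: fdf.
have [c cab] := MVT ab fdf' cf; rewrite in_itv/= in cab.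
by rewrite -subr_gt0 => ->; rewrite mulr_gt0 ?df0// subr_gt0.
Qed.

Lemma derive_within f df a b : (forall x, a <= x <= b -> is_derive x 1 f (df x)) ->
  {within `[a, b], continuous f}.
Proof.
move=> fdf; apply: derivable_within_continuous => x.
by rewrite in_itv => /fdf[].
Qed.

Lemma derive_gt0_lt_cc f df a b : a < b ->
  (forall x, a <= x <= b -> is_derive x 1 f (df x)) ->
  (forall x, a < x < b -> 0 < df x) -> f a < f b.
Proof.
move=> ab fdf; apply: (@derive_gt0_lt f df) => //; last exact: derive_within fdf.
by move=> x /andP[ax xb]; apply: fdf; rewrite !ltW.
Qed.

Lemma derive_ge0_le_cc f df a b : a <= b ->
  (forall x, a <= x <= b -> is_derive x 1 f (df x)) ->
  (forall x, a < x < b -> 0 <= df x) -> f a <= f b.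
Proof.
move=> ab fdf; apply: (@derive_ge0_le f df) => //; last exact: derive_within fdf.
by move=> x /andP[ax xb]; apply: fdf; rewrite !ltW.
Qed.

Lemma derive_lt0_gt_cc f df a b : a < b ->
  (forall x, a <= x <= b -> is_derive x 1 f (df x)) ->
  (forall x, a < x < b -> df x < 0) -> f b < f a.
Proof.
move=> ab fdf df0; rewrite -ltrN2.
apply: (@derive_gt0_lt_cc (fun x => - f x) (fun x => - df x)) => // x xab.
  exact/is_derive_oppf/fdf.
by rewrite oppr_gt0 df0.
Qed.

Lemma is_derive_cstf x c : is_derive x 1 (fun=> c) 0.
Proof. exact: is_derive_cst. Qed.

Lemma is_derive_idf x : is_derive x 1 (fun y => y) 1.
Proof. exact: is_derive_id. Qed.

Lemma is_derive_val f x a b : is_derive x 1 f a -> a = b -> is_derive x 1 f b.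
Proof. by move=> fa <-. Qed.

(** By the mean value theorem the difference quotient at [c] is a value of [d] at an intermediate
    point, and this tends to [d c]. It serves to differentiate [amp] at [ctr], where the chain rule
    for the square root fails. *)
Lemma is_derive_limit f d c : (\forall x \near c, x != c -> is_derive x 1 f (d x)) ->
  {for c, continuous f} -> {for c, continuous d} -> is_derive c 1 f (d c).
Proof.
move=> fd cf cd.
pose h z := if z == c then d c else (f z - f c) / (z - c).
apply/is_derive1_caratheodory; exists h; split; last by rewrite /h eqxx.
  move=> z; rewrite /h; case: eqVneq => [->|zc]; first by rewrite !subrr mulr0.
  by rewrite divfK// subr_eq0.
have hc : h c = d c by rewrite /h eqxx.
rewrite /prop_for /continuous_at hc; apply/cvgrPdist_lt => e e0.
have /cvgrPdist_lt/(_ e e0) de := cd.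
have [r /= r0 rP] : \forall x \near c, `|d c - d x| < e /\
    (x != c -> is_derive x 1 f (d x)) by apply: filter_app2 de fd; near=> x.
exists r => //= z; rewrite /h; case: eqVneq => [-> _|zc czr].
  by rewrite subrr normr0.
have /andP[z1 z2] : - r < c - z < r by rewrite -ltr_norml.
have zr x : c < x <= z \/ z <= x < c -> ball c r x.
  move=> cxz; rewrite /ball/= ltr_norml; case: cxz => /andP[? ?].
    by apply/andP; split; lra.
  by apply/andP; split; lra.
have cfr x : ball c r x -> {for x, continuous f}.
  move=> xr; have [->//|xc] := eqVneq x c.
  by apply: is_derive_continuous; exact: (rP _ xr).2.
have [lt|gt|eq] := ltgtP c z; last by rewrite eq eqxx in zc.
- have [||x /[!in_itv]/= /andP[cx xz] ->] := @MVT _ f d c z lt.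
  + move=> x /[!in_itv]/= /andP[cx xz]; apply: (rP x _).2; last by rewrite gt_eqF.
    by apply: zr; left; rewrite cx ltW.
  + apply/continuous_in_subspaceT => x /[!inE]/=; rewrite in_itv/= => /andP[cx xz].
    apply: cfr; move: cx; rewrite le_eqVlt => /predU1P[<-|cx]; first exact: ballxx.
    by apply: zr; left; rewrite cx.
  rewrite mulfK ?subr_eq0//; apply: (rP x _).1.
  by apply: zr; left; rewrite cx ltW.
- have [||x /[!in_itv]/= /andP[zx xc] e1] := @MVT _ f d z c gt.
  + move=> x /[!in_itv]/= /andP[zx xc]; apply: (rP x _).2; last by rewrite lt_eqF.
    by apply: zr; right; rewrite xc ltW.
  + apply/continuous_in_subspaceT => x /[!inE]/=; rewrite in_itv/= => /andP[zx xc].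
    apply: cfr; move: xc; rewrite le_eqVlt => /predU1P[->|xc]; first exact: ballxx.
    by apply: zr; right; rewrite zx.
  rewrite -(opprB (f c)) e1 -(opprB c z) invrN mulrNN mulfK ?subr_eq0 1?eq_sym//.
  apply: (rP x _).1.
  by apply: zr; right; rewrite xc ltW.
Unshelve. all: by end_near. Qed.

End calculus.

Ltac der1 := first
  [ notypeclasses refine (is_derive_cstf _ _) | notypeclasses refine (is_derive_idf _)
  | eassumption
  | match goal with
    | |- is_derive _ _ (fun y => _ + - _) _ => notypeclasses refine (is_derive_subf _ _)
    | |- is_derive _ _ (fun y => _ + _) _ => notypeclasses refine (is_derive_addf _ _)
    | |- is_derive _ _ (fun y => - _) _ => notypeclasses refine (is_derive_oppf _)
    | |- is_derive _ _ (fun y => _ * _) _ => notypeclasses refine (is_derive_mulf _ _)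
    | |- is_derive _ _ (fun y => _ ^+ _) _ => notypeclasses refine (is_derive_expf _ _)
    | |- is_derive _ _ (fun y => (_)^-1) _ => notypeclasses refine (is_derive_invf _ _)
    end ].
Ltac der := notypeclasses refine (is_derive_eq _ _); [repeat der1 .. | ].

(** * Sign study of the potential well *)

Section potential.
Variables (R : realType) (lam p : R).
Hypotheses (lam0 : 0 < lam) (p2 : 2 < p).
Implicit Types u v x y : R.

(** All powers are reduced to this one, [u ^ p] being written [u ^+ 2 * pw u]: the identities below
    are then rational in [u] and [pw u], within reach of [field]. *)
Definition pw u := u `^ (p - 2).
Definition ctr : R := lam `^ (p - 2)^-1.
Definition pot u := lam * u ^+ 2 / 2 - u ^+ 2 * pw u / p.
Definition depth := pot ctr.
Definition gap u := depth - pot u.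
Definition gap1 u := u * (pw u - lam).
Definition gap2 u := (p - 1) * pw u - lam.
Definition gap3 u := (p - 1) * (p - 2) * pw u / u.

Let p_neq0 : p != 0. Proof. by rewrite gt_eqF//; have := p2; lra. Qed.
Let p1_neq0 : p - 1 != 0. Proof. by rewrite gt_eqF//; have := p2; lra. Qed.
Let p2_neq0 : p - 2 != 0. Proof. by rewrite gt_eqF//; have := p2; lra. Qed.
Let p2_gt0 : 0 < p - 2. Proof. by have := p2; lra. Qed.
Let lam_neq0 : lam != 0. Proof. by rewrite gt_eqF. Qed.

Lemma pw_gt0 u : 0 < u -> 0 < pw u.
Proof. exact: powR_gt0. Qed.

Lemma pw_lt u v : 0 < u -> u < v -> pw u < pw v.
Proof.
move=> u0 uv; apply: gt0_ltr_powR => //; rewrite ?nnegrE ?ltW//.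
exact: lt_trans uv.
Qed.

Lemma ctr_gt0 : 0 < ctr.
Proof. exact: powR_gt0. Qed.

Lemma pw_ctr : pw ctr = lam.
Proof. by rewrite /pw /ctr -powRrM mulVf// powRr1// ltW. Qed.

Lemma is_derive_pw u : 0 < u -> is_derive u 1 pw ((p - 2) * (pw u / u)).
Proof.
move=> u0; apply: is_derive_eq; first exact: is_derive1_powR.
by rewrite powRB ?powRr1 ?ltW// (gt_eqF u0) implybT.
Qed.

Lemma is_derive_pot u : 0 < u -> is_derive u 1 pot (- gap1 u).
Proof.
move=> u0; have du := is_derive_pw u0; have := lt0r_neq0 u0 => un0.
rewrite /pot; der; rewrite /gap1/=; field; exact/andP.
Qed.

Lemma is_derive_gap u : 0 < u -> is_derive u 1 gap (gap1 u).
Proof.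
move=> u0; have du := is_derive_pot u0.
by rewrite /gap; der; rewrite sub0r opprK.
Qed.

Lemma is_derive_gap1 u : 0 < u -> is_derive u 1 gap1 (gap2 u).
Proof.
move=> u0; have du := is_derive_pw u0; have := lt0r_neq0 u0 => un0.
by rewrite /gap1; der; rewrite /gap2/=; field.
Qed.

Lemma is_derive_gap2 u : 0 < u -> is_derive u 1 gap2 (gap3 u).
Proof.
move=> u0; have du := is_derive_pw u0; have := lt0r_neq0 u0 => un0.
by rewrite /gap2; der; rewrite /gap3/=; field.
Qed.

Lemma gap3_gt0 u : 0 < u -> 0 < gap3 u.
Proof. by move=> u0; rewrite /gap3 divr_gt0// !mulr_gt0 ?pw_gt0//; have := p2; lra. Qed.

Lemma gap_ctr : gap ctr = 0. Proof. by rewrite /gap subrr. Qed.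

Lemma gap1_ctr : gap1 ctr = 0. Proof. by rewrite /gap1 pw_ctr subrr mulr0. Qed.

Lemma gap1_gt0 u : ctr < u -> 0 < gap1 u.
Proof.
move=> cu; rewrite mulr_gt0 ?(lt_trans ctr_gt0 cu)// subr_gt0 -pw_ctr.
by rewrite pw_lt ?ctr_gt0.
Qed.

Lemma gap1_lt0 u : 0 < u -> u < ctr -> gap1 u < 0.
Proof. by move=> u0 uc; rewrite /gap1 pmulr_rlt0// subr_lt0 -pw_ctr pw_lt. Qed.

Lemma sign_right (h dh : R -> R) u : ctr < u ->
  (forall x, 0 < x -> is_derive x 1 h (dh x)) -> h ctr = 0 ->
  (forall x, ctr < x -> 0 < dh x) -> 0 < h u.
Proof.
move=> cu hdh h0 dh0; rewrite -[ltLHS]h0; apply: (derive_gt0_lt_cc cu (df := dh)) => x /andP[cx xu].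
  exact/hdh/(lt_le_trans ctr_gt0).
exact: dh0.
Qed.

Lemma sign_left (h dh : R -> R) u : 0 < u -> u < ctr ->
  (forall x, 0 < x -> is_derive x 1 h (dh x)) -> h ctr = 0 ->
  (forall x, u < x -> x < ctr -> 0 < dh x) -> h u < 0.
Proof.
move=> u0 uc hdh h0 dh0; rewrite -[ltRHS]h0;
  apply: (derive_gt0_lt_cc uc (df := dh)) => x /andP[cx xu].
  exact/hdh/(lt_le_trans u0).
exact: dh0.
Qed.

Lemma gap_gt0 u : 0 < u -> u != ctr -> 0 < gap u.
Proof.
move=> u0; rewrite neq_lt => /orP[uc|cu].
  rewrite -oppr_lt0; apply: (@sign_left (fun x => - gap x) (fun x => - gap1 x) u u0 uc).
  - by move=> x x0; exact/is_derive_oppf/is_derive_gap.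
  - by rewrite gap_ctr oppr0.
  - by move=> x ux xc; rewrite oppr_gt0 gap1_lt0// (lt_trans u0).
apply: (sign_right cu (h := gap) (dh := gap1));
  [exact: is_derive_gap|exact: gap_ctr|exact: gap1_gt0].
Qed.

(** The derivative of [1 / amp'] is [defect / (amp * gap1 ^+ 2)]. The products [gap1 * gap2] cancel
    in the derivative of [defect], leaving [- 2 * gap * gap3], whose sign is known; hence the sign
    of [defect] itself. *)
Definition defect u := gap1 u ^+ 2 - 2 * (gap u * gap2 u).

Lemma is_derive_defect u : 0 < u -> is_derive u 1 defect (- (2 * (gap u * gap3 u))).
Proof.
move=> u0; have [? ? ?] := And3 (is_derive_gap u0) (is_derive_gap1 u0) (is_derive_gap2 u0).
by rewrite /defect; der; rewrite /=; ring.
Qed.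

Let NG_derive x : 0 < x -> is_derive x 1 (fun x => - defect x) (2 * (gap x * gap3 x)).
Proof. by move=> x0; have dG := is_derive_defect x0; der; rewrite opprK. Qed.

Lemma defect_ctr : defect ctr = 0.
Proof. by rewrite /defect gap_ctr gap1_ctr mul0r mulr0 expr0n subr0. Qed.

Lemma defect_lt0 u : ctr < u -> defect u < 0.
Proof.
move=> cu; rewrite -oppr_gt0.
apply: (@sign_right (fun x => - defect x) (fun x => 2 * (gap x * gap3 x)) u cu NG_derive).
  by rewrite defect_ctr oppr0.
move=> x cx; have x0 := lt_trans ctr_gt0 cx.
by rewrite mulr_gt0// mulr_gt0 ?gap3_gt0 ?gap_gt0 ?gt_eqF.
Qed.

Lemma defect_gt0 u : 0 < u -> u < ctr -> 0 < defect u.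
Proof.
move=> u0 uc; rewrite -oppr_lt0.
apply: (@sign_left (fun x => - defect x) (fun x => 2 * (gap x * gap3 x)) u u0 uc NG_derive).
  by rewrite defect_ctr oppr0.
move=> x ux xc; have x0 := lt_trans u0 ux.
by rewrite mulr_gt0// mulr_gt0 ?gap3_gt0 ?gap_gt0 ?lt_eqF.
Qed.

(** This is [gap1 * gap2 / gap3 - gap], chosen so that [gap3 * L] is the derivative of
    [gap1 ^+ 2 - gap * gap2]. *)
Let L u := u ^+ 2 * (pw u - lam) * gap2 u / ((p - 1) * (p - 2) * pw u) - gap u.

Let is_derive_L u : 0 < u -> is_derive u 1 L
  (u * gap2 u * (2 * pw u + (p - 4) * lam) / ((p - 1) * (p - 2) * pw u)).
Proof.
move=> u0; have [? ? ?] := And3 (is_derive_gap u0) (is_derive_pw u0) (is_derive_gap2 u0).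
have w0 := lt0r_neq0 (pw_gt0 u0); have un0 := lt0r_neq0 u0.
rewrite /L; der; first by rewrite !mulf_neq0.
by rewrite /= /gap1 /gap2 /gap3; field; rewrite un0 w0 p1_neq0 p2_neq0.
Qed.

(** Two integrations from [ctr]: [L] increases because [lam < pw u] makes both [gap2] and
    [2 * pw u + (p - 4) * lam] positive, so [L > 0], and [gap3 * L] is the derivative of the
    difference. It yields the monotonicity of [s * level' s]. *)
Lemma gap1_sqr_gt u : ctr < u -> gap u * gap2 u < gap1 u ^+ 2.
Proof.
have wl x : ctr < x -> lam < pw x by move=> cx; rewrite -pw_ctr pw_lt ?ctr_gt0.
have L0 x : ctr < x -> 0 < L x.
  move=> cx; apply: (sign_right cx is_derive_L).
    by rewrite /L gap_ctr pw_ctr subrr mulr0 !mul0r subr0.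
  move=> y cy; have y0 := lt_trans ctr_gt0 cy; have := wl _ cy => wy.
  rewrite divr_gt0 ?mulr_gt0 ?pw_gt0// /gap2; have := lam0; have := p2; nra.
move=> cu; rewrite -subr_gt0.
pose H x := gap1 x ^+ 2 - gap x * gap2 x.
apply: (@sign_right H (fun x => gap3 x * L x) u cu).
- move=> x x0; have [? ? ?] := And3 (is_derive_gap x0) (is_derive_gap1 x0) (is_derive_gap2 x0).
  have w0 := lt0r_neq0 (pw_gt0 x0); have xn0 := lt0r_neq0 x0.
  by rewrite /H; der; rewrite /L /= /gap1 /gap3 /=; field; rewrite xn0 w0 p1_neq0 p2_neq0.
- by rewrite /H gap_ctr gap1_ctr mul0r expr0n subr0.
- by move=> x cx; rewrite mulr_gt0 ?L0// gap3_gt0// (lt_trans ctr_gt0 cx).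
Qed.

(** Equal to [gap3 ctr / gap2 ctr ^ 2], the one value for which the terms of order three at [ctr]
    cancel in [defect + cubic_coef / 3 * gap1 ^+ 3]. Without this cancellation the sum could not be
    positive on both sides of [ctr]. *)
Definition cubic_coef := (p - 1) / ((p - 2) * lam * ctr).

(** A chain of derivatives: that of [cubic_defect] is [gap3 * M], that of [M] is [gap1 * brk]. Both
    [cubic_defect] and [M] vanish at [ctr], so signs propagate from [brk] upwards. *)
Let M u := - (2 * gap u) +
  u ^+ 3 * (pw u - lam) ^+ 2 * gap2 u / ((p - 2) ^+ 2 * lam * ctr * pw u).

Let brk u := - 2 + u / (ctr * lam * (p - 2) ^+ 2) *
  ((p - 1) * (2 * p - 1) * pw u - 2 * (2 * p - 1) * lam + (5 - p) * lam ^+ 2 / pw u).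

Let is_derive_M u : 0 < u -> is_derive u 1 M (gap1 u * brk u).
Proof.
move=> u0; have [? ? ?] := And3 (is_derive_gap u0) (is_derive_pw u0) (is_derive_gap2 u0).
have w0 := lt0r_neq0 (pw_gt0 u0); have un0 := lt0r_neq0 u0.
have cn0 := lt0r_neq0 ctr_gt0.
rewrite /M; der; first by rewrite !mulf_neq0// expf_neq0.
by rewrite /brk /= /gap1 /gap2 /gap3 /=; field; rewrite un0 w0 cn0 lam_neq0 p2_neq0.
Qed.

Definition cubic_defect u := defect u + cubic_coef / 3 * gap1 u ^+ 3.

Let is_derive_cubic_defect u : 0 < u -> is_derive u 1 cubic_defect (gap3 u * M u).
Proof.
move=> u0; have [? ?] := conj (is_derive_defect u0) (is_derive_gap1 u0).
have w0 := lt0r_neq0 (pw_gt0 u0); have un0 := lt0r_neq0 u0.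
have cn0 := lt0r_neq0 ctr_gt0.
rewrite /cubic_defect; der.
rewrite /M /cubic_coef /= /gap1 /gap2 /gap3 /=; field.
by rewrite un0 w0 cn0 lam_neq0 p2_neq0.
Qed.

Let lt_pw u : ctr < u -> lam < pw u.
Proof. by move=> cu; rewrite -pw_ctr pw_lt ?ctr_gt0. Qed.

Let gt_pw u : 0 < u -> u < ctr -> pw u < lam.
Proof. by move=> u0 cu; rewrite -pw_ctr pw_lt. Qed.

(** Isolates [- 2 + 2 * (u / ctr)], which changes sign at [ctr]; the rest is to have the sign of
    [pw u - lam], which depends only on the factor [(p - 1) * (2 * p - 1) - (5 - p) * (lam / pw u)]
    being positive. *)
Let brkE u : 0 < u -> brk u = - 2 + u / ctr *
  (2 + (pw u - lam) * ((p - 1) * (2 * p - 1) - (5 - p) * (lam / pw u))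
       / (lam * (p - 2) ^+ 2)).
Proof.
move=> u0; have cn0 := lt0r_neq0 ctr_gt0; have wn0 := lt0r_neq0 (pw_gt0 u0).
by rewrite /brk; field; rewrite cn0 lam_neq0 wn0 p2_neq0.
Qed.

Let brk_gt0 u : ctr < u -> 0 < brk u.
Proof.
move=> cu; have u0 := lt_trans ctr_gt0 cu; rewrite brkE//.
have w1 : lam / pw u < 1 by rewrite ltr_pdivrMr ?pw_gt0// mul1r lt_pw.
have w0 : 0 < lam / pw u by rewrite divr_gt0 ?pw_gt0.
have u1 : 1 < u / ctr by rewrite ltr_pdivlMr ?ctr_gt0// mul1r.
set t := _ / (lam * _).
have : 0 < t.
  rewrite divr_gt0//; last by rewrite mulr_gt0// exprn_gt0.
  rewrite mulr_gt0// ?subr_gt0 ?lt_pw//.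
  by set z := lam / pw u in w1 w0 *; move: p2 => ?; nra.
by move: (u / ctr) u1 => v; nra.
Qed.

(** The hypothesis on [gap2] reads [lam / pw u < p - 1]. For [p <= 5] it bounds [(p - 1) * (2 * p -
    1) - (5 - p) * (lam / pw u)] below by [3 * (p - 1) * (p - 2)]; for [p > 5] that factor is
    plainly positive. *)
Let brk_lt0 u : 0 < u -> u < ctr -> 0 < gap2 u -> brk u < 0.
Proof.
move=> u0 uc f2; rewrite brkE//.
have w0 : 0 < lam / pw u by rewrite divr_gt0 ?pw_gt0.
have w1 : lam / pw u < p - 1 by rewrite ltr_pdivrMr ?pw_gt0// -subr_gt0.
have u1 : 0 < u / ctr < 1.
  by rewrite divr_gt0 ?ctr_gt0//= ltr_pdivrMr ?ctr_gt0// mul1r.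
set t := _ / (lam * _).
have : t < 0.
  rewrite /t pmulr_llt0 ?invr_gt0; last by rewrite mulr_gt0// exprn_gt0.
  rewrite nmulr_rlt0 ?subr_lt0 ?gt_pw//.
  set z := lam / pw u in w1 w0 *; move: p2 => ?.
  by have [?|?] := leP p 5; nra.
by move: (u / ctr) u1 => v /andP[]; nra.
Qed.

Let M_ctr : M ctr = 0.
Proof. by rewrite /M gap_ctr pw_ctr subrr expr0n/= !(mulr0, mul0r) oppr0 addr0. Qed.

Let M_gt0 u : ctr < u -> 0 < M u.
Proof.
move=> cu; apply: (sign_right cu is_derive_M M_ctr) => x cx.
by rewrite mulr_gt0 ?gap1_gt0 ?brk_gt0.
Qed.

Let M_lt0 u : 0 < u -> u < ctr -> M u < 0.
Proof.
(* Where [gap2 <= 0] both terms of [M] have the right sign. Otherwise [gap2], being increasing,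
   stays positive from [u] to [ctr], and [brk_lt0] applies all along. *)
move=> u0 uc; have [f2|f2] := ltP 0 (gap2 u); last first.
  rewrite /M mulrAC; set a := _ / _; have a0 : 0 <= a.
    apply: divr_ge0.
      by apply: mulr_ge0; [exact/ltW/exprn_gt0|exact: sqr_ge0].
    by apply: ltW; rewrite mulr_gt0 ?pw_gt0// mulr_gt0 ?ctr_gt0// mulr_gt0// exprn_gt0.
  have := gap_gt0 u0; rewrite lt_eqF// => /(_ isT) Fu.
  by have := mulr_ge0_le0 a0 f2; lra.
apply: (sign_left u0 uc is_derive_M M_ctr) => x ux xc.
have x0 := lt_trans u0 ux.
rewrite nmulr_rgt0 ?gap1_lt0// brk_lt0//.
apply: lt_trans f2 _; rewrite ltrD2r ltr_pM2l ?pw_lt//; have := p2; lra.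
Qed.

Lemma cubic_defect_ctr : cubic_defect ctr = 0.
Proof. by rewrite /cubic_defect defect_ctr gap1_ctr expr0n/= mulr0 addr0. Qed.

Lemma cubic_defect_gt0 u : 0 < u -> u != ctr -> 0 < cubic_defect u.
Proof.
move=> u0; rewrite neq_lt => /orP[uc|cu].
  rewrite -oppr_lt0.
  apply: (@sign_left (fun x => - cubic_defect x) (fun x => - (gap3 x * M x)) u u0 uc).
  - by move=> x x0; exact/is_derive_oppf/is_derive_cubic_defect.
  - by rewrite cubic_defect_ctr oppr0.
  - move=> x ux xc; have x0 := lt_trans u0 ux.
    by rewrite oppr_gt0 pmulr_rlt0 ?gap3_gt0 ?M_lt0.
apply: (sign_right cu is_derive_cubic_defect cubic_defect_ctr) => x cx.
by rewrite mulr_gt0 ?gap3_gt0 ?M_gt0// (lt_trans ctr_gt0 cx).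
Qed.

End potential.

(** * The signed square root of the gap and its inverse *)

Section action.
Variables (R : realType) (lam p : R).
Hypotheses (lam0 : 0 < lam) (p2 : 2 < p).
Implicit Types u v x y s t : R.

Local Notation ctr := (ctr lam p).
Local Notation pot := (pot lam p).
Local Notation depth := (depth lam p).
Local Notation gap := (gap lam p).
Local Notation gap1 := (gap1 lam p).
Local Notation gap2 := (gap2 lam p).
Local Notation gap3 := (gap3 p).
Local Notation defect := (defect lam p).
Local Notation cubic_defect := (cubic_defect lam p).
Local Notation cubic_coef := (cubic_coef lam p).

Let ctr0 : 0 < ctr. Proof. exact: ctr_gt0. Qed.

Lemma gap2_ctr : gap2 ctr = lam * (p - 2).
Proof. by rewrite /gap2 pw_ctr//; ring. Qed.

Let gap2_ctr_gt0 : 0 < gap2 ctr.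
Proof. by rewrite gap2_ctr mulr_gt0// subr_gt0. Qed.

Let gap2_lt u v : 0 < u -> u < v -> gap2 u < gap2 v.
Proof.
move=> u0 uv; apply: (derive_gt0_lt_cc uv (df := gap3)) => x /andP[ux xv].
  by apply: is_derive_gap2 => //; exact: lt_le_trans ux.
by apply: gap3_gt0 => //; exact: lt_trans ux.
Qed.

Let gap1_neq0 u : 0 < u -> u != ctr -> gap1 u != 0.
Proof.
move=> u0; rewrite neq_lt => /orP[uc|cu]; first by rewrite lt_eqF ?gap1_lt0.
by rewrite gt_eqF ?gap1_gt0.
Qed.

(** The quotient is [0 / 0] at [ctr], where its limit [gap2 ctr / 2] is put instead. [amp] is then
    recovered from the relation [2 * amp * amp' = gap1], which carries the sign of the root without
    a case distinction. *)
Definition sqr_amp' u := if u == ctr then gap2 ctr / 2 else gap1 u ^+ 2 / (4 * gap u).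
Definition amp' u := Num.sqrt (sqr_amp' u).
Definition amp u := gap1 u / (2 * amp' u).

Lemma sqr_amp'_gt0 u : 0 < u -> 0 < sqr_amp' u.
Proof.
move=> u0; rewrite /sqr_amp'; case: eqVneq => [_|uc]; first by rewrite divr_gt0.
by rewrite divr_gt0 ?exprn_even_gt0//= ?gap1_neq0// mulr_gt0 ?gap_gt0.
Qed.

Lemma amp'_gt0 u : 0 < u -> 0 < amp' u.
Proof. by move=> u0; rewrite sqrtr_gt0 sqr_amp'_gt0. Qed.

Lemma amp_sqr u : 0 < u -> amp u ^+ 2 = gap u.
Proof.
move=> u0; have D2u : amp' u ^+ 2 = sqr_amp' u by rewrite sqr_sqrtr ?ltW ?sqr_amp'_gt0.
rewrite /amp expr_div_n [(2 * _) ^+ 2]exprMn D2u.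
rewrite /sqr_amp'; case: eqVneq => [->|uc]; first by rewrite gap1_ctr// gap_ctr expr0n mul0r.
have f1 := gap1_neq0 u0 uc; have f : gap u != 0 by rewrite gt_eqF// gap_gt0.
by field; rewrite f f1.
Qed.

Lemma amp_amp' u : 0 < u -> 2 * (amp u * amp' u) = gap1 u.
Proof. by move=> u0; have d := lt0r_neq0 (amp'_gt0 u0); rewrite /amp; field. Qed.

Lemma amp_gt0 u : ctr < u -> 0 < amp u.
Proof.
move=> cu; have u0 := lt_trans ctr0 cu.
by rewrite /amp divr_gt0 ?gap1_gt0// mulr_gt0 ?amp'_gt0.
Qed.

Lemma amp_lt0 u : 0 < u -> u < ctr -> amp u < 0.
Proof.
by move=> u0 uc; rewrite /amp pmulr_llt0 ?gap1_lt0// invr_gt0 mulr_gt0 ?amp'_gt0.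
Qed.

Lemma amp_ctr : amp ctr = 0.
Proof. by rewrite /amp gap1_ctr// mul0r. Qed.

Let gap1_cont u : 0 < u -> {for u, continuous gap1}.
Proof. by move=> u0; exact: is_derive_continuous (is_derive_gap1 lam p u0). Qed.

Let gap2_cont u : 0 < u -> {for u, continuous gap2}.
Proof. by move=> u0; exact: is_derive_continuous (is_derive_gap2 lam p u0). Qed.

(* Both [gap2 ctr / 2] and [gap2 u / 2] are bounds of [sqr_amp' u], on opposite sides. *)
Let sqr_amp'_dist u : 0 < u -> `|sqr_amp' ctr - sqr_amp' u| <= `|gap2 ctr - gap2 u|.
Proof.
move=> u0; rewrite {1}/sqr_amp' eqxx /sqr_amp'; case: eqVneq => [_|uc];
  first by rewrite subrr normr0.
have f : 0 < gap u by rewrite gap_gt0.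
set q := _ / (4 * _); have q1 : gap2 u / 2 - q = - defect u / (4 * gap u).
  by rewrite /q /defect; field; rewrite gt_eqF.
pose K x := gap1 x ^+ 2 - 2 * gap2 ctr * gap x.
have dK x : 0 < x -> is_derive x 1 K (2 * (gap1 x * (gap2 x - gap2 ctr))).
  move=> x0; have [? ?] := conj (is_derive_gap lam p2 x0) (is_derive_gap1 lam p x0).
  by rewrite /K; der; rewrite /=; ring.
have K0 : K ctr = 0 by rewrite /K gap1_ctr// gap_ctr expr0n mulr0 subr0.
have q2 : gap2 ctr / 2 - q = - K u / (4 * gap u).
  by rewrite /q /K; field; rewrite gt_eqF.
have f4 : 0 < 4 * gap u by rewrite mulr_gt0.
move: (uc); rewrite neq_lt => /orP[lt|gt].
- have : 0 < gap2 ctr / 2 - q.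
    rewrite q2 divr_gt0// oppr_gt0; apply: (sign_left u0 lt dK K0) => x ux xc.
    have x0 := lt_trans u0 ux.
    by rewrite mulr_gt0// nmulr_rgt0 ?gap1_lt0// subr_lt0 gap2_lt.
  have : gap2 u / 2 - q < 0.
    by rewrite q1 pmulr_llt0 ?invr_gt0// oppr_lt0 defect_gt0.
  have := gap2_lt u0 lt; move=> h1 h2 h3.
  by rewrite !gtr0_norm ?subr_gt0//; lra.
- have : gap2 ctr / 2 - q < 0.
    rewrite q2 pmulr_llt0 ?invr_gt0// oppr_lt0.
    apply: (sign_right lam0 gt dK K0) => x cx.
    by rewrite mulr_gt0// mulr_gt0 ?gap1_gt0// subr_gt0 gap2_lt.
  have : 0 < gap2 u / 2 - q.
    by rewrite q1 divr_gt0// oppr_gt0 defect_lt0.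
  have := gap2_lt ctr0 gt; move=> h1 h2 h3.
  by rewrite !ltr0_norm ?subr_lt0//; lra.
Qed.

Lemma amp'_continuous u : 0 < u -> {for u, continuous amp'}.
Proof.
move=> u0; apply: (@continuous_comp _ _ _ sqr_amp' Num.sqrt); last exact: sqrt_continuous.
have [->|uc] := eqVneq u ctr.
  apply/cvgrPdist_le => e e0; have /cvgrPdist_le/(_ e e0) := gap2_cont ctr0.
  apply: filterS2 (lt_nbhsr ctr0) => x x0; exact: le_trans (sqr_amp'_dist x0).
have : {for u, continuous (fun x => gap1 x ^+ 2 / (4 * gap x))}.
  have [? ?] := conj (is_derive_gap lam p2 u0) (is_derive_gap1 lam p u0).
  have ? : 4 * gap u != 0 by rewrite gt_eqF// mulr_gt0// gap_gt0.
  apply: is_derive_continuous; repeat der1 => //.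
rewrite /prop_for /continuous_at; have -> : sqr_amp' u = gap1 u ^+ 2 / (4 * gap u).
  by rewrite /sqr_amp' (negbTE uc).
apply: cvg_trans; apply: near_eq_cvg.
have : \forall x \near u, x != ctr.
  by apply: open_nbhs_nbhs; split => //; exact: open_neq.
by apply: filterS => x xc; rewrite /sqr_amp' (negbTE xc).
Qed.

Lemma amp_continuous u : 0 < u -> {for u, continuous amp}.
Proof.
move=> u0; apply: cvgM; first exact: gap1_cont.
apply: cvgV; first by rewrite gt_eqF// mulr_gt0 ?amp'_gt0.
by apply: cvgM; [exact: cvg_cst|exact: amp'_continuous].
Qed.

(** Off [ctr], [amp] is locally [sqrt gap] or [- sqrt gap] and the chain rule applies; at [ctr] the
    derivative is the limit of the neighbouring ones. *)
Lemma is_derive_amp u : 0 < u -> is_derive u 1 amp (amp' u).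
Proof.
have off x : 0 < x -> x != ctr -> is_derive x 1 amp (amp' x).
  move=> x0 xc; have Fx : 0 < gap x by rewrite gap_gt0.
  have sq : is_derive x 1 (fun y => Num.sqrt (gap y)) (gap1 x / (2 * Num.sqrt (gap x))).
    have := is_derive_compf (is_derive1_sqrt Fx) (is_derive_gap lam p2 x0).
    by rewrite mulrC.
  have sF0 : 0 < Num.sqrt (gap x) by rewrite sqrtr_gt0.
  have dn0 := amp'_gt0 x0.
  move: (xc); rewrite neq_lt => /orP[lt|gt].
    have Sx y : 0 < y -> y < ctr -> amp y = - Num.sqrt (gap y).
      by move=> y0 yc; rewrite -amp_sqr// sqrtr_sqr ltr0_norm ?opprK ?amp_lt0.
    apply: (@near_eq_is_derive _ _ _ (fun y => - Num.sqrt (gap y))).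
      near=> y; rewrite Sx//; near: y; [exact: lt_nbhsr|exact: lt_nbhsl].
    apply: is_derive_val (is_derive_oppf sq) _.
    by rewrite -(amp_amp' x0) Sx//; field; rewrite gt_eqF.
  have Sx y : ctr < y -> amp y = Num.sqrt (gap y).
    by move=> cy; rewrite -amp_sqr ?(lt_trans ctr0)// sqrtr_sqr gtr0_norm ?amp_gt0.
  apply: (@near_eq_is_derive _ _ _ (fun y => Num.sqrt (gap y))).
    near=> y; rewrite Sx//; near: y; exact: lt_nbhsr.
  apply: is_derive_val sq _.
  by rewrite -(amp_amp' x0) Sx//; field; rewrite gt_eqF.
move=> u0; have [->|uc] := eqVneq u ctr; last exact: off.
apply: is_derive_limit; [|exact: amp_continuous|exact: amp'_continuous].
by apply: filterS (lt_nbhsr ctr0) => x x0 xc; exact: off.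
Unshelve. all: by end_near. Qed.

Lemma amp_lt u v : 0 < u -> u < v -> amp u < amp v.
Proof.
move=> u0 uv; apply: (derive_gt0_lt_cc uv (df := amp')) => x /andP[ux xv].
  by apply: is_derive_amp; exact: lt_le_trans ux.
by apply: amp'_gt0; exact: lt_trans ux.
Qed.

Lemma amp_inj u v : 0 < u -> 0 < v -> amp u = amp v -> u = v.
Proof.
move=> u0 v0 uv; have [lt|gt|//] := ltgtP u v.
  by have := amp_lt u0 lt; rewrite uv ltxx.
by have := amp_lt v0 gt; rewrite uv ltxx.
Qed.

Definition rad := Num.sqrt depth.

Lemma pot_gt0 u : 0 < u -> u <= ctr -> 0 < pot u.
Proof.
move=> u0 uc; have w : pw p u <= lam.
  move: uc; rewrite le_eqVlt => /predU1P[->|uc]; first by rewrite pw_ctr.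
  by rewrite -[leRHS](pw_ctr lam0 p2) ltW ?pw_lt.
have -> : pot u = u ^+ 2 * (lam / 2 - pw p u / p) by rewrite /pot; ring.
rewrite mulr_gt0 ?exprn_gt0// subr_gt0.
apply: (@le_lt_trans _ _ (lam / p)).
  by rewrite ler_pM2r// invr_gt0; have := p2; lra.
by rewrite ltr_pM2l// ltf_pV2 ?posrE//; have := p2; lra.
Qed.

Lemma pot_le u : 0 < u -> pot u <= lam * u ^+ 2 / 2.
Proof.
move=> u0; rewrite /pot gerBl; apply: divr_ge0; last by have := p2; lra.
by rewrite mulr_ge0 ?sqr_ge0 ?powR_ge0.
Qed.

Lemma depth_gt0 : 0 < depth.
Proof. exact: pot_gt0. Qed.

Lemma rad_gt0 : 0 < rad.
Proof. by rewrite sqrtr_gt0 depth_gt0. Qed.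

Lemma rad_sqr : rad ^+ 2 = depth.
Proof. by rewrite sqr_sqrtr// ltW ?depth_gt0. Qed.

(** Left of [ctr] the potential is positive, so [amp ^ 2 = depth - pot] stays below [rad ^ 2]. The
    value [- rad] is the limit at [u = 0]. *)
Lemma amp_gtNrad u : 0 < u -> - rad < amp u.
Proof.
move=> u0; have [cu|uc] := leP ctr u.
  apply: (@lt_le_trans _ _ 0); first by rewrite oppr_lt0 rad_gt0.
  by move: cu; rewrite le_eqVlt => /predU1P[<-|/amp_gt0/ltW//]; rewrite amp_ctr.
rewrite ltrNl -(@ltr_pXn2r _ 2)// ?nnegrE ?oppr_ge0 ?(ltW rad_gt0) ?(ltW (amp_lt0 _ _))//.
by rewrite sqrrN amp_sqr// rad_sqr /gap ltrBlDr ltrDl pot_gt0// ltW.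
Qed.

Let amp_ivt a b s : 0 < a -> a <= b -> amp a <= s -> s <= amp b -> exists2 u, 0 < u & amp u = s.
Proof.
move=> a0 ab sa sb; have [||u /[!in_itv]/= /andP[au _] <-] := @IVT _ amp a b s ab.
- apply/continuous_in_subspaceT => x /[!inE]/=; rewrite in_itv/= => /andP[ax _].
  by apply: amp_continuous; exact: lt_le_trans ax.
- by rewrite (min_idPl (le_trans sa sb)) (max_idPr (le_trans sa sb)) sa.
by exists u => //; exact: lt_le_trans au.
Qed.

Lemma amp_surj s : - rad < s -> exists2 u, 0 < u & amp u = s.
Proof.
move=> rs; have [s0|s0] := leP 0 s.
(* [v] is so large that [v ^ 2 >= 1] and [pw v / p - lam / 2 >= s ^ 2], whence [gap v >= s ^ 2]. *)
- pose a := p * (lam / 2 + s ^+ 2); pose v := Num.max 1 (a `^ (p - 2)^-1).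
  have a0 : lam < a.
    by rewrite /a; have := sqr_ge0 s; move: p2 lam0 => ? ? ?; nra.
  have v0 : 0 < v by rewrite /v lt_max ltr01.
  have wv : a <= pw p v.
    have {1}-> : a = pw p (a `^ (p - 2)^-1).
      rewrite /pw -powRrM mulVf ?powRr1//; first by rewrite ltW// (lt_trans lam0).
      by rewrite gt_eqF// subr_gt0.
    apply: ge0_ler_powR; rewrite ?nnegrE ?powR_ge0//; first by have := p2; lra.
    - exact: ltW.
    - by rewrite /v le_max lexx orbT.
  have cv : ctr < v.
    rewrite ltNge; apply/negP; rewrite le_eqVlt => /predU1P[vc|vc].
      by move: wv; rewrite vc pw_ctr// leNgt a0.
    by have := pw_lt p2 v0 vc; rewrite pw_ctr//; lra.
  apply: (amp_ivt ctr0 (ltW cv)); rewrite ?amp_ctr//.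
  rewrite -(@ler_pXn2r _ 2)// ?nnegrE ?(ltW (amp_gt0 cv))// amp_sqr//.
  have v1 : 1 <= v ^+ 2 by rewrite exprn_ege1// /v le_max lexx.
  have w1 : lam / 2 + s ^+ 2 <= pw p v / p.
    by rewrite ler_pdivlMr ?(lt_trans _ p2)// mulrC.
  have -> : gap v = depth + v ^+ 2 * (pw p v / p - lam / 2) by rewrite /gap /pot; ring.
  apply: (@le_trans _ _ (0 + 1 * s ^+ 2)); first by rewrite add0r mul1r.
  apply: lerD; first exact/ltW/depth_gt0.
  by apply: ler_pM; rewrite ?sqr_ge0// lerBrDl.
- pose e := depth - s ^+ 2.
  have e0 : 0 < e.
    rewrite /e subr_gt0 -rad_sqr -sqrrN ltr_pXn2r// ?nnegrE ?oppr_ge0 ?ltW ?rad_gt0//.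
    by rewrite ltrNl.
  (* The bound [v <= sqrt (2 * e / lam)] gives [pot v <= lam * v ^ 2 / 2 <= e], that is
     [gap v >= s ^ 2]; the bound [ctr / 2] keeps [v] left of [ctr]. *)
  pose v := Num.min (ctr / 2) (Num.sqrt (2 * e / lam)).
  have v0 : 0 < v by rewrite /v lt_min divr_gt0//= sqrtr_gt0 divr_gt0// mulr_gt0.
  have vc : v < ctr by rewrite /v gt_min ltr_pdivrMr// ltr_pMr// ltr1n.
  apply: (amp_ivt v0 (ltW vc)); rewrite ?amp_ctr ?(ltW s0)//.
  rewrite -lerN2 -(@ler_pXn2r _ 2)// ?nnegrE ?oppr_ge0 ?(ltW s0) ?(ltW (amp_lt0 v0 vc))//.
  rewrite !sqrrN amp_sqr// /gap lerBrDr -lerBrDl.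
  apply: le_trans (pot_le v0) _; rewrite -/e.
  have : v ^+ 2 <= 2 * e / lam.
    rewrite -[leRHS]sqr_sqrtr; last by rewrite divr_ge0 ?mulr_ge0// ltW.
    by rewrite ler_pXn2r ?nnegrE ?sqrtr_ge0 ?(ltW v0)// /v ge_min lexx orbT.
  by rewrite ler_pdivlMr// ler_pdivrMr//; lra.
Qed.

(* The default value [ctr] is taken on [s <= - rad] only; it keeps [level] positive. *)
Definition level s := xget ctr [set u | 0 < u /\ amp u = s].
Definition level' s := (amp' (level s))^-1.

Lemma level_gt0 s : 0 < level s.
Proof. by rewrite /level; case: xgetP => [u _ []|]. Qed.

Lemma levelK s : - rad < s -> amp (level s) = s.
Proof.
move=> /amp_surj[u u0 us].
have : exists u, [set u | 0 < u /\ amp u = s] u by exists u.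
by move=> /(xgetPex ctr)[].
Qed.

Lemma ampK u : 0 < u -> level (amp u) = u.
Proof. by move=> u0; apply: amp_inj; rewrite ?level_gt0// levelK// amp_gtNrad. Qed.

Lemma level_lt s t : - rad < s -> s < t -> level s < level t.
Proof.
move=> rs st; have rt := lt_trans rs st.
rewrite ltNge; apply/negP; rewrite le_eqVlt => /predU1P[e|/(amp_lt (level_gt0 _))].
  by move: st; rewrite -(levelK rs) -(levelK rt) e ltxx.
by rewrite !levelK// => /(lt_trans st); rewrite ltxx.
Qed.

Lemma level'_gt0 s : 0 < level' s.
Proof. by rewrite invr_gt0 amp'_gt0// level_gt0. Qed.

Lemma level0 : level 0 = ctr.
Proof. by rewrite -amp_ctr ampK. Qed.

Lemma level'0 : level' 0 = (Num.sqrt (lam * (p - 2) / 2))^-1.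
Proof. by rewrite /level' level0 /amp' /sqr_amp' eqxx gap2_ctr. Qed.

Lemma is_derive_level s : - rad < s -> is_derive s 1 level (level' s).
Proof.
move=> rs; rewrite -{1}(levelK rs); apply: (@is_derive_inverse _ amp).
- by near=> u; apply: ampK; near: u; exact: lt_nbhsr (level_gt0 s).
- near=> u; apply: amp_continuous; near: u; exact: lt_nbhsr (level_gt0 s).
- exact: is_derive_amp (level_gt0 s).
- by rewrite gt_eqF// amp'_gt0 ?level_gt0.
Unshelve. all: by end_near. Qed.

Lemma level'_continuous s : - rad < s -> {for s, continuous level'}.
Proof.
move=> rs; apply: cvgV; first by rewrite gt_eqF// amp'_gt0 ?level_gt0.
apply: continuous_comp; first exact: is_derive_continuous (is_derive_level rs).
exact: amp'_continuous (level_gt0 s).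
Qed.

Lemma gap1_level' s : - rad < s -> 2 * s = gap1 (level s) * level' s.
Proof.
move=> rs; rewrite -(amp_amp' (level_gt0 s)) levelK// mulrA mulfK//.
by rewrite gt_eqF// amp'_gt0 ?level_gt0.
Qed.

Let is_derive_invD u : 0 < u -> u != ctr ->
  is_derive u 1 (fun x => (amp' x)^-1) (defect u / (amp u * gap1 u ^+ 2)).
Proof.
move=> u0 uc; have f1 := gap1_neq0 u0 uc.
have d0 : amp' u != 0 by rewrite gt_eqF ?amp'_gt0.
have s0 : amp u != 0.
  by apply: contraNneq f1 => s0; rewrite -amp_amp'// s0 mul0r mulr0.
apply: (@near_eq_is_derive _ _ _ (fun x => 2 * amp x / gap1 x)).
  have : \forall x \near u, x != ctr.
    by apply: open_nbhs_nbhs; split => //; exact: open_neq.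
  move=> ne; near=> x.
  have x0 : 0 < x by near: x; exact: lt_nbhsr.
  have xc : x != ctr by near: x.
  have dx : amp' x != 0 by rewrite gt_eqF ?amp'_gt0.
  rewrite -amp_amp'//; field; rewrite dx/=.
  by apply: contraNneq (gap1_neq0 x0 xc) => sx; rewrite -amp_amp'// sx mul0r mulr0.
have [? ?] := conj (is_derive_amp u0) (is_derive_gap1 lam p u0).
der => //=; rewrite /defect -!amp_amp'// -amp_sqr//; field.
by rewrite d0 s0.
Unshelve. all: by end_near. Qed.

Let invD_continuous u : 0 < u -> {for u, continuous (fun x => (amp' x)^-1)}.
Proof.
by move=> u0; apply: cvgV; [rewrite gt_eqF ?amp'_gt0|exact: amp'_continuous].
Qed.

(** The derivative formulas divide by [amp] and [gap1], hence fail at [ctr]: intervals are kept on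
    one side of it, and only continuity is asked at [ctr]. *)
Let side (h dh : R -> R) a b : 0 < a -> a <= b -> (b <= ctr) || (ctr <= a) ->
  (forall x, 0 < x -> {for x, continuous h}) ->
  (forall x, 0 < x -> x != ctr -> is_derive x 1 h (dh x)) ->
  (forall x, a < x -> x < b -> 0 <= dh x) -> h a <= h b.
Proof.
move=> a0 ab abc ch dhh dh0; apply: (derive_ge0_le ab (df := dh)).
- move=> x /andP[ax xb]; apply: dhh; first exact: lt_trans ax.
  by case/orP: abc => c; [rewrite lt_eqF// (lt_le_trans xb)|rewrite gt_eqF// (le_lt_trans c)].
- apply/continuous_in_subspaceT => x /[!inE]/=; rewrite in_itv/= => /andP[ax _].
  by apply: ch; exact: lt_le_trans ax.
- by move=> x /andP[]; exact: dh0.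
Qed.

(** On each side of [ctr], [defect] and [amp] have opposite signs, so [1 / amp'] decreases; an
    interval across 0 is cut at [level 0 = ctr]. *)
Lemma level'_le s t : - rad < s -> s <= t -> level' t <= level' s.
Proof.
suff inv u v : 0 < u -> u <= v -> (v <= ctr) || (ctr <= u) -> (amp' v)^-1 <= (amp' u)^-1.
  move=> rs; rewrite le_eqVlt => /predU1P[->//|st]; have /ltW Xst := level_lt rs st.
  have [tc|ct] := leP (level t) ctr; first by rewrite /level' inv ?level_gt0// tc.
  have [cs|sc] := leP ctr (level s); first by rewrite /level' inv ?level_gt0// cs orbT.
  apply: (@le_trans _ _ (amp' ctr)^-1).
    by apply: inv => //; [exact: ltW|rewrite lexx orbT].
  by apply: inv; rewrite ?level_gt0 ?lexx// ltW.
move=> u0 uv uvc; rewrite -lerN2.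
apply: (@side (fun x => - (amp' x)^-1) (fun x => - (defect x /
  (amp x * gap1 x ^+ 2))) u v u0 uv uvc).
- by move=> x x0; apply: cvgN; exact: invD_continuous.
- by move=> x x0 xc; exact/is_derive_oppf/is_derive_invD.
- move=> x ux xv; have x0 := lt_trans u0 ux; rewrite -mulNr.
  case/orP: uvc => c.
    have xc := lt_le_trans xv c; rewrite mulr_le0// ?oppr_le0 ?ltW ?defect_gt0//.
    by rewrite invr_lt0 nmulr_rlt0 ?amp_lt0// exprn_even_gt0//= lt_eqF ?gap1_lt0.
  have cx := le_lt_trans c ux; rewrite divr_ge0// ?oppr_ge0 ?ltW ?defect_lt0//.
  by rewrite mulr_gt0 ?amp_gt0// exprn_gt0 ?gap1_gt0.
Qed.

(** The derivative of [amp / amp'] is [2 * (gap1 ^ 2 - gap * gap2) / gap1 ^ 2], positive by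
    [gap1_sqr_gt]. This complements [level'_le]: on the positive side [level'] decays no faster than
    [1 / s]. *)
Lemma mul_level'_le s t : 0 <= s -> s <= t -> s * level' s <= t * level' t.
Proof.
move=> s0; rewrite le_eqVlt => /predU1P[->//|st].
have Nr0 : - rad < 0 by rewrite oppr_lt0 rad_gt0.
have rs := lt_le_trans Nr0 s0; have rt := lt_trans rs st; have Xst := level_lt rs st.
have cs : ctr <= level s.
  by move: s0; rewrite -level0 le_eqVlt => /predU1P[->//|/(level_lt Nr0)/ltW].
rewrite -{1}(levelK rs) -{1}(levelK rt).
apply: (@side (fun x => amp x / amp' x)
  (fun x => amp' x * (amp' x)^-1 + amp x * (defect x / (amp x * gap1 x ^+ 2))) (level s) (level t)).
- exact: level_gt0.
- exact: ltW.
- by rewrite cs orbT.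
- by move=> x x0; apply: cvgM; [exact: amp_continuous|exact: invD_continuous].
- by move=> x x0 xc; apply: is_derive_mulf; [exact: is_derive_amp|exact: is_derive_invD].
- move=> x sx xt; have cx := le_lt_trans cs sx; have x0 := lt_trans ctr0 cx.
  have f0 := gap1_gt0 lam0 p2 cx.
  have -> : amp' x * (amp' x)^-1 + amp x * (defect x / (amp x * gap1 x ^+ 2)) =
      2 * (gap1 x ^+ 2 - gap x * gap2 x) / gap1 x ^+ 2.
    by rewrite /defect; field; rewrite !gt_eqF ?amp'_gt0 ?amp_gt0.
  rewrite divr_ge0 ?sqr_ge0// mulr_ge0// subr_ge0 ltW//.
  exact: gap1_sqr_gt.
Qed.

(* Subtracting the linear part of [level'] at [0] turns the minimum of [level' + tilt s]
   into a global one; the linear part integrates to zero along a period. *)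
Definition tilt := 2 * cubic_coef / 3.

Let is_derive_tilted_level' u : 0 < u -> u != ctr ->
  is_derive u 1 (fun x => (amp' x)^-1 + tilt * amp x) (cubic_defect u / (amp u * gap1 u ^+ 2)).
Proof.
move=> u0 uc; have [? ?] := conj (is_derive_amp u0) (is_derive_invD u0 uc).
der; rewrite /= /cubic_defect /tilt -amp_amp'//.
have d0 : amp' u != 0 by rewrite gt_eqF ?amp'_gt0.
have s0 : amp u != 0.
  by apply: contraNneq (gap1_neq0 u0 uc) => s0; rewrite -amp_amp'// s0 mul0r mulr0.
by field; rewrite d0 s0.
Qed.

Let tilted_level'_continuous u : 0 < u -> {for u, continuous (fun x => (amp' x)^-1 + tilt * amp x)}.
Proof.
move=> u0; apply: cvgD; first exact: invD_continuous.
by apply: cvgM; [exact: cvg_cst|exact: amp_continuous].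
Qed.

Let tilted_level'_within a b : 0 < a -> {within `[a, b],
  continuous (fun x => (amp' x)^-1 + tilt * amp x)}.
Proof.
move=> a0; apply/continuous_in_subspaceT => x /[!inE]/=; rewrite in_itv/= => /andP[ax _].
by apply: tilted_level'_continuous; exact: lt_le_trans ax.
Qed.

(** In the variable [u = level s] the derivative is [cubic_defect / (amp * gap1 ^+ 2)], with
    [cubic_defect] positive off [ctr]: its sign is that of [amp], here and in the mirror lemma for
    negative amplitudes. *)
Lemma tilted_level'_lt s t : 0 <= s -> s < t -> level' s + tilt * s < level' t + tilt * t.
Proof.
move=> s0 st; have Nr0 : - rad < 0 by rewrite oppr_lt0 rad_gt0.
have rs := lt_le_trans Nr0 s0; have rt := lt_trans rs st; have Xst := level_lt rs st.
have cs : ctr <= level s.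
  by move: s0; rewrite -level0 le_eqVlt => /predU1P[->//|/(level_lt Nr0)/ltW].
rewrite -{2}(levelK rs) -{2}(levelK rt).
apply: (derive_gt0_lt Xst (f := fun x => (amp' x)^-1 + tilt * amp x)
  (df := fun u => cubic_defect u / (amp u * gap1 u ^+ 2))).
- move=> x /andP[sx _]; have cx := le_lt_trans cs sx.
  by apply: is_derive_tilted_level'; [exact: lt_trans cx|rewrite gt_eqF].
- exact/tilted_level'_within/level_gt0.
- move=> x /andP[sx _]; have cx := le_lt_trans cs sx; have x0 := lt_trans ctr0 cx.
  by rewrite divr_gt0 ?cubic_defect_gt0 ?gt_eqF// mulr_gt0 ?amp_gt0// exprn_gt0 ?gap1_gt0.
Qed.

Lemma tilted_level'_gt s t : - rad < s -> s < t -> t <= 0 ->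
  level' t + tilt * t < level' s + tilt * s.
Proof.
move=> rs st t0; have rt := lt_trans rs st; have Xst := level_lt rs st.
have cs : level t <= ctr.
  by move: t0; rewrite -level0 le_eqVlt => /predU1P[->//|/(level_lt rt)/ltW].
rewrite -{2}(levelK rs) -{2}(levelK rt) -ltrN2.
apply: (derive_gt0_lt Xst (f := fun x => - ((amp' x)^-1 + tilt * amp x))
  (df := fun u => - (cubic_defect u / (amp u * gap1 u ^+ 2)))).
- move=> x /andP[sx xt]; have cx := lt_le_trans xt cs; apply: is_derive_oppf.
  by apply: is_derive_tilted_level'; [exact: lt_trans (level_gt0 s) sx|rewrite lt_eqF].
- by move=> x; apply: cvgN; exact/tilted_level'_within/level_gt0.
- move=> x /andP[sx xt]; have cx := lt_le_trans xt cs.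
  have x0 := lt_trans (level_gt0 s) sx.
  rewrite oppr_gt0 pmulr_rlt0 ?cubic_defect_gt0 ?lt_eqF// invr_lt0 nmulr_rlt0 ?amp_lt0//.
  by rewrite exprn_even_gt0//= lt_eqF ?gap1_lt0.
Qed.

End action.

#[global] Opaque level level'.

(** * Antiderivatives on the line, their inverses, their dependence on a parameter *)

Section antiderivative.
Variable R : realType.
Implicit Types (f g P : R -> R) (a b x t : R).

Lemma same_derive_increment f g (d : R -> R) a b : a <= b ->
  (forall x, a <= x <= b -> is_derive x 1 f (d x)) ->
  (forall x, a <= x <= b -> is_derive x 1 g (d x)) -> f b - f a = g b - g a.
Proof.
move=> ab fd gd; apply/eqP; rewrite eq_le; apply/andP; split.
  have := @derive_ge0_le_cc _ (fun x => g x - f x) (fun x => d x - d x) a b ab.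
  have h x : a <= x <= b -> is_derive x 1 (fun y => g y - f y) (d x - d x).
    by move=> xab; exact: is_derive_subf (gd _ xab) (fd _ xab).
  have h0 x : a < x < b -> 0 <= d x - d x by rewrite subrr.
  by move=> /(_ h h0); lra.
have := @derive_ge0_le_cc _ (fun x => f x - g x) (fun x => d x - d x) a b ab.
have h x : a <= x <= b -> is_derive x 1 (fun y => f y - g y) (d x - d x).
  by move=> xab; exact: is_derive_subf (fd _ xab) (gd _ xab).
have h0 x : a < x < b -> 0 <= d x - d x by rewrite subrr.
by move=> /(_ h h0); lra.
Qed.

Definition antiderivative f : R -> R :=
  get [set P : R -> R | P 0 = 0 /\ forall x, is_derive x 1 P (f x)].

(** The fundamental theorem is applied inside compact intervals, to integrals starting at [- N].
    Their increments from 0 do not depend on [N], so [N] may vary with [x], as [|x| + 1], while one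
    fixed [M] serves in a neighbourhood of each point. *)
Lemma antiderivativeP f : continuous f ->
  antiderivative f 0 = 0 /\ forall x, is_derive x 1 (antiderivative f) (f x).
Proof.
move=> cf; suff : exists P, [set P | P 0 = 0 /\ forall x, is_derive x 1 P (f x)] P.
  exact: getPex.
pose I N x : R := \int[lebesgue_measure]_(t in `[- N, x]) f t.
have dI N x : - N < x < N -> is_derive x 1 (I N) (f x).
  move=> /andP[Nx xN].
  have fi : lebesgue_measure.-integrable `[- N, N] (EFin \o f).
    apply: continuous_compact_integrable; first exact: segment_compact.
    exact: continuous_subspaceT.
  have [dF F'] := continuous_FTC1_closed xN fi Nx (cf x).
  have F'E : 'D_1 (I N) x = f x by rewrite -derive1E; exact: F'.
  exact: DeriveDef dF F'E.
have I_eq N M x : `|x| < N -> N <= M -> I N x - I N 0 = I M x - I M 0.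
  rewrite ltr_norml => /andP[Nx xN] NM.
  have [x0|x0] := leP 0 x.
    by apply: (@same_derive_increment _ _ f) => // y /andP[y0 yx];
      apply: dI; apply/andP; split; lra.
  have : I N 0 - I N x = I M 0 - I M x; last by lra.
  by apply: (@same_derive_increment _ _ f); first exact: ltW;
    move=> y /andP[y0 yx]; apply: dI; apply/andP; split; lra.
exists (fun x => I (`|x| + 1) x - I (`|x| + 1) 0); split; first by rewrite subrr.
move=> x; pose M := `|x| + 2.
apply: (@near_eq_is_derive _ _ _ (fun y => I M y - I M 0)).
  near=> y; apply/esym/I_eq; first by rewrite ltrDl.
  have : ball x 1 y by near: y; exact: nbhsx_ballx.
  rewrite /ball/= distrC => yx1.
  by have := ler_normD (y - x) x; rewrite subrK /M; lra.
apply: (@is_derive_val _ _ _ (f x - 0)); last by rewrite subr0.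
suff xM : - M < x < M by exact: is_derive_subf (dI _ _ xM) (is_derive_cstf _ _).
by have := ler_norm x; have := ler_norm (- x); rewrite normrN /M;
  move=> ? ?; apply/andP; split; lra.
Unshelve. all: by end_near. Qed.

Lemma antiderivative_growth f m a b : continuous f -> (forall x, m <= f x) ->
  a <= b -> m * (b - a) <= antiderivative f b - antiderivative f a.
Proof.
move=> cf mf ab; have [_ dP] := antiderivativeP cf.
have := @derive_ge0_le_cc _ (fun x => antiderivative f x - m * x)
  (fun x => f x - (0 * x + m * 1)) a b ab.
have h x : a <= x <= b ->
    is_derive x 1 (fun y => antiderivative f y - m * y) (f x - (0 * x + m * 1)).
  by move=> _; exact: is_derive_subf (dP x) (is_derive_mulf (is_derive_cstf x m) (is_derive_idf x)).
have h0 x : a < x < b -> 0 <= f x - (0 * x + m * 1).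
  by move=> _; rewrite mul0r add0r mulr1 subr_ge0 mf.
by move=> /(_ h h0); lra.
Qed.

Lemma antiderivative_lt f a b : continuous f -> (forall x, 0 < f x) ->
  a < b -> antiderivative f a < antiderivative f b.
Proof.
move=> cf f0 ab; have [_ dP] := antiderivativeP cf.
by apply: (derive_gt0_lt_cc ab (df := f)) => x _.
Qed.

Lemma antiderivative_cmp_lt f g b : continuous f -> continuous g -> 0 < b ->
  (forall x, 0 < x < b -> f x < g x) -> antiderivative f b < antiderivative g b.
Proof.
move=> cf cg b0 fg; have [f0 df] := antiderivativeP cf; have [g0 dg] := antiderivativeP cg.
pose h x := antiderivative g x - antiderivative f x.
have dh x : is_derive x 1 h (g x - f x) by exact: is_derive_subf.
have h0 : h 0 = 0 by rewrite /h f0 g0 subrr.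
rewrite -subr_gt0 -[ltLHS]h0; apply: (derive_gt0_lt_cc b0 (fun x _ => dh x)).
by move=> x xb; rewrite subr_gt0 fg.
Qed.

Lemma antiderivative_cmp_le f g b : continuous f -> continuous g -> 0 <= b ->
  (forall x, 0 < x < b -> f x <= g x) -> antiderivative f b <= antiderivative g b.
Proof.
move=> cf cg b0 fg; have [f0 df] := antiderivativeP cf; have [g0 dg] := antiderivativeP cg.
pose h x := antiderivative g x - antiderivative f x.
have dh x : is_derive x 1 h (g x - f x) by exact: is_derive_subf.
have h0 : h 0 = 0 by rewrite /h f0 g0 subrr.
rewrite -subr_ge0 -[leLHS]h0; apply: (derive_ge0_le_cc b0 (fun x _ => dh x)).
by move=> x xb; rewrite subr_ge0 fg.
Qed.

Definition inverse f : R -> R := fun y => get [set x | f x = y].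

(** The lower bound [m] forces at least linear growth at both ends, hence surjectivity on the whole
    line; positivity of [f] alone would not give it. *)
Lemma inverseP f m : continuous f -> 0 < m -> (forall x, m <= f x) ->
  [/\ cancel (antiderivative f) (inverse (antiderivative f)),
      cancel (inverse (antiderivative f)) (antiderivative f) &
      forall x, is_derive x 1 (inverse (antiderivative f))
                  (f (inverse (antiderivative f) x))^-1].
Proof.
move=> cf m0 mf; have [P0 dP] := antiderivativeP cf; set P := antiderivative f in P0 dP *.
have f0 x : 0 < f x by exact: lt_le_trans (mf x).
have Plt a b : a < b -> P a < P b by exact: antiderivative_lt.
have Pinj a b : P a = P b -> a = b.
  by have [/Plt + e|/Plt + e|//] := ltgtP a b; rewrite e ltxx.
have surj y : exists x, P x = y.
  pose c := `|y| / m.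
  have c0 : 0 <= c by rewrite divr_ge0// ltW.
  have mc : m * c = `|y| by rewrite mulrC divfK// gt_eqF.
  have g1 := antiderivative_growth cf mf c0.
  have Nc0 : - c <= 0 by rewrite oppr_le0.
  have g2 := antiderivative_growth cf mf Nc0.
  rewrite -/P P0 in g1 g2.
  have y1 := ler_norm y; have y2 := ler_norm (- y); rewrite normrN in y2.
  have Ncc : - c <= c by lra.
  have [||x _ <-] := @IVT _ P (- c) c y Ncc; last by exists x.
    by apply: (derive_within (df := f)).
  have Pc : P (- c) <= P c by lra.
  by rewrite (min_idPl Pc) (max_idPr Pc); apply/andP; split; lra.
have BP : cancel (inverse P) P by move=> y; exact: (getPex (surj y)).
have PB : cancel P (inverse P) by move=> x; exact/Pinj/BP.
split=> // x; rewrite -{1}(BP x); apply: (@is_derive_inverse _ P).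
- by near=> y; exact: PB.
- by near=> y; exact: is_derive_continuous (dP y).
- by rewrite gt_eqF.
Unshelve. all: by end_near. Qed.

(** Compactness of [[0, b]] makes the convergence of [h s] to [h s0] uniform there, and the mean
    value theorem bounds the difference of the antiderivatives. The tolerance is [e / (b + 1)] so
    that [b = 0] is allowed. *)
Lemma antiderivative_param_continuous (h : R -> R -> R) (s0 b : R) : 0 <= b ->
  (\forall s \near s0, continuous (h s)) ->
  (forall t, 0 <= t <= b -> h z.1 z.2 @[z --> (s0, t)] --> h s0 t) ->
  {for s0, continuous (fun s => antiderivative (h s) b)}.
Proof.
move=> b0 ch hc; apply/cvgrPdist_le => e e0.
pose d := e / (b + 1).
have b1 : 0 < b + 1 by lra.
have d0 : 0 < d by rewrite divr_gt0.
have dist : \forall s \near s0, `[0, b]%classic `<=`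
    (fun t => `|h s0 t - h s t| <= d).
  have /compact_near_coveringP cov : compact `[0, b]%classic by exact: segment_compact.
  apply: (cov _ (nbhs s0) (fun s t => `|h s0 t - h s t| <= d)) => t /=.
  rewrite in_itv/= => tb.
  have d20 : 0 < d / 2 by rewrite divr_gt0.
  have /cvgrPdist_le/(_ _ d20) := hc t tb.
  move=> [[U V]/= [U0 V0] UV].
  exists (V, U) => //= -[t' s] /= [Vt' Us].
  have h1 := UV (s, t') (conj Us Vt').
  have h2 := UV (s0, t') (conj (nbhs_singleton U0) Vt').
  rewrite /= in h1 h2; rewrite distrC in h2.
  apply: le_trans (ler_distD (h s0 t) _ _) _.
  by rewrite [leRHS](splitr d); apply: lerD.
have ch0 : continuous (h s0) by exact: nbhs_singleton ch.
near=> s.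
have chs : continuous (h s) by near: s.
have [P0 dP] := antiderivativeP ch0; have [Q0 dQ] := antiderivativeP chs.
have Dst t : t \in `[0, b] -> `|h s0 t - h s t| <= d.
  by move=> tb; apply: (near dist s).
have dD t : is_derive t 1 (fun y => antiderivative (h s0) y - antiderivative (h s) y)
    (h s0 t - h s t) by exact: is_derive_subf.
have [|c cb] := @MVT_segment _ _ (fun t => h s0 t - h s t) 0 b b0 (fun t _ => dD t).
  by apply: (derive_within (df := fun t => h s0 t - h s t)).
rewrite P0 Q0 !subr0 => ->; rewrite normrM (ger0_norm b0).
apply: (@le_trans _ _ (d * b)); first by rewrite ler_wpM2r ?Dst.
by rewrite /d mulrAC ler_pdivrMr// ler_pM2l//; lra.
Unshelve. all: by end_near. Qed.

End antiderivative.

#[global] Opaque antiderivative inverse.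

(** * Zeros of the sine *)

Section sin_zeros.
Variable R : realType.

Lemma sin_natpi (k : nat) : sin (k%:R * pi) = 0 :> R.
Proof.
have := alternatingn (@sinDpi R) k 0.
by rewrite add0r sin0 mulr0 mulr_natl.
Qed.

Lemma sin_eq0_natpi (x : R) : 0 < x -> sin x = 0 -> exists2 k : nat, (0 < k)%N & x = k%:R * pi.
Proof.
move=> x0 sx0; have p0 := pi_gt0 R.
have xp0 : 0 <= x / pi by rewrite divr_ge0// ltW.
have /andP[] := truncn_itv xp0; set k := Num.trunc _ => kx xk.
have xk0 : 0 <= x - k%:R * pi by rewrite subr_ge0 -ler_pdivlMr.
have xkp : x - k%:R * pi < pi.
  by move: xk; rewrite ltr_pdivrMr// -natr1 mulrDl mul1r ltrBlDr addrC.
have sxk : sin (x - k%:R * pi) = 0.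
  have := alternatingn (@sinDpi R) k (x - k%:R * pi).
  rewrite -[pi *+ k]mulr_natl subrK sx0 => /esym/eqP; rewrite mulf_eq0 => /orP[|/eqP//].
  by rewrite expf_eq0 oppr_eq0 oner_eq0 andbF.
have [xkgt|xkle] := ltP 0 (x - k%:R * pi).
  by have := @sin_gt0_pi R (x - k%:R * pi); rewrite xkgt xkp sxk ltxx => /(_ isT).
have xk' : x = k%:R * pi by apply/eqP; rewrite -subr_eq0 eq_le xk0 xkle.
exists k => //; rewrite lt0n; apply/eqP => k0.
by move: x0; rewrite xk' k0 mul0r ltxx.
Qed.

Lemma pihalf_le_natpi (k : nat) : (0 < k)%N -> pi / 2 <= k%:R * pi :> R.
Proof.
move=> k0; apply: (@le_trans _ _ pi); last by rewrite ler_peMl ?pi_ge0// ler1n.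
by rewrite ler_pdivrMr// ler_peMr ?pi_ge0// ler1n.
Qed.

End sin_zeros.

(** * Periodic orbits in polar coordinates and their half-periods *)

Section orbit.
Variables (R : realType) (lam p : R).
Hypotheses (lam0 : 0 < lam) (p2 : 2 < p).
Implicit Types b c r s t u x y : R.

Local Notation ctr := (ctr lam p).
Local Notation pot := (pot lam p).
Local Notation depth := (depth lam p).
Local Notation gap := (gap lam p).
Local Notation gap1 := (gap1 lam p).
Local Notation amp := (amp lam p).
Local Notation level := (level lam p).
Local Notation level' := (level' lam p).
Local Notation rad := (rad lam p).
Local Notation tilt := (tilt lam p).
Local Notation q2 := (Num.sqrt (2 : R)).

Let rad0 : 0 < rad. Proof. exact: rad_gt0. Qed.
Let q20 : 0 < q2. Proof. by rewrite sqrtr_gt0. Qed.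
Let q2_neq0 : q2 != 0. Proof. by rewrite gt_eqF. Qed.
Let q2sqr : q2 * q2 = 2. Proof. by rewrite -expr2 sqr_sqrtr. Qed.

(* In polar coordinates [amp u = r cos b], [u' / sqrt 2 = - r sin b] the equation
   [u'' = - gap1 u] reads [db/dx = sqrt 2 / level' (r cos b)]: a density [f] that agrees
   with [level' (r cos b) / sqrt 2] is the derivative of the time [x] with respect to
   the angle [b]. *)
Lemma orbit_ode (f : R -> R) m r x (P := antiderivative f) (b := inverse P x) :
  continuous f -> 0 < m -> (forall b, m <= f b) ->
  - rad < r * cos b -> f b = level' (r * cos b) / q2 ->
  is_derive x 1 (fun x => level (r * cos (inverse P x))) (- (q2 * r * sin b)) /\
  is_derive x 1 (fun x => - (q2 * r * sin (inverse P x))) (- gap1 (level (r * cos b))).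
Proof.
move=> cf m0 mf rb fb; have [_ _ dB] := inverseP cf m0 mf.
have {dB} dB := dB x; rewrite -/P -/b fb in dB.
have y0 : level' (r * cos b) != 0 by rewrite gt_eqF// level'_gt0.
have dcos := @is_derive_compf _ cos (inverse P) x _ _ (is_derive_cos b) dB.
have dsin := @is_derive_compf _ sin (inverse P) x _ _ (is_derive_sin b) dB.
split.
  have dr := is_derive_mulf (is_derive_cstf x r) dcos.
  apply: is_derive_val (@is_derive_compf _ level (fun y => r * cos (inverse P y)) x _ _
    (is_derive_level lam0 p2 rb) dr) _.
  rewrite mul0r add0r; field; exact/andP.
apply: is_derive_val (is_derive_oppf (is_derive_mulf (is_derive_cstf x (q2 * r)) dsin)) _.
have -> : gap1 (level (r * cos b)) = q2 * q2 * (r * cos b) / level' (r * cos b).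
  by rewrite q2sqr (gap1_level' lam0 p2 rb) mulfK.
by field; exact/andP.
Qed.

(* Energy conservation, in the form of a bound on the logarithmic derivative. *)
Lemma orbit_log_bound r b : - rad < r * cos b ->
  2 * r ^+ 2 * sin b ^+ 2 <= 2 * (r ^+ 2 - depth) + lam * level (r * cos b) ^+ 2.
Proof.
move=> rb; have := pot_le lam p2 (level_gt0 p lam0 (r * cos b)).
have := amp_sqr lam0 p2 (level_gt0 p lam0 (r * cos b)).
rewrite levelK// /gap exprMn.
by have := cos2Dsin2 b; set d := depth; set z := level _; set w := pot _; nra.
Qed.

Definition density s b := level' (s * cos b) / q2.
Definition clock s := antiderivative (density s).

Let scos s b : `|s| < rad -> - rad < s * cos b < rad.
Proof.
move=> sr; rewrite -ltr_norml normrM (le_lt_trans _ sr)//.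
by rewrite ler_piMr// cos_max.
Qed.

Let NradN s b : `|s| < rad -> - rad < s * cos b.
Proof. by move=> /(scos b)/andP[]. Qed.

Lemma density_continuous s : `|s| < rad -> continuous (density s).
Proof.
move=> sr b; apply: cvgM; last exact: cvg_cst.
apply: (@continuous_comp _ _ _ (fun b => s * cos b) level').
  by apply: cvgM; [exact: cvg_cst|exact: continuous_cos].
exact: (level'_continuous lam0 p2 (NradN b sr)).
Qed.

(** [level'] decreases and [s * cos b] stays below [rad]. This uniform bound is what [inverseP]
    needs to turn the clock into an angle defined for all times. *)
Lemma density_ge s b : `|s| < rad -> level' rad / q2 <= density s b.
Proof.
move=> sr; rewrite /density ler_pM2r ?invr_gt0//; have /andP[s1 s2] := scos b sr.
exact: (level'_le lam0 p2 s1 (ltW s2)).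
Qed.

Let m0 : 0 < level' rad / q2. Proof. by rewrite divr_gt0 ?level'_gt0. Qed.

Let clockP s : `|s| < rad ->
  clock s 0 = 0 /\ forall b, is_derive b 1 (clock s) (density s b).
Proof. by move=> sr; apply/antiderivativeP/density_continuous. Qed.

Lemma clock_lt s a b : `|s| < rad -> a < b -> clock s a < clock s b.
Proof.
move=> sr ab; apply: antiderivative_lt ab; first exact: density_continuous.
by move=> x; apply: lt_le_trans m0 (density_ge x sr).
Qed.

Definition half_periods (k : nat) s := clock s (k%:R * pi).

Let norm0 : `|0 : R| < rad. Proof. by rewrite normr0. Qed.

Let kpi0 (k : nat) : 0 <= k%:R * pi :> R.
Proof. by rewrite mulr_ge0 ?pi_ge0. Qed.

(** At [s = 0] the density is constant, equal to the inverse of the frequency of the linearization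
    at [ctr]. *)
Lemma half_periods0 (k : nat) : half_periods k 0 = k%:R * ell_star lam p.
Proof.
have [c0 dc] := clockP norm0.
have d1 x : 0 <= x <= k%:R * pi -> is_derive x 1 (clock 0) (density 0 x) by [].
have d2 x : 0 <= x <= k%:R * pi -> is_derive x 1 (fun b => b * (level' 0 / q2)) (density 0 x).
  move=> _.
  apply: is_derive_val (is_derive_mulf (is_derive_idf x) (is_derive_cstf x _)) _.
  by rewrite mul1r mulr0 addr0 /density mul0r.
have := same_derive_increment (kpi0 k) d1 d2.
rewrite c0 mul0r !subr0 /half_periods => ->.
rewrite level'0// /ell_star -invfM -sqrtrM; last first.
  by apply: divr_ge0 => //; apply: mulr_ge0; [exact: ltW|rewrite subr_ge0 ltW].
by rewrite divfK// mulrA.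
Qed.

(** The added multiple of [sin] vanishes at the multiples of [pi], so half-periods may be computed
    with [level' x + tilt * x] in place of [level' x] as integrand. *)
Let dclockZ s b : `|s| < rad ->
  is_derive b 1 (fun b => clock s b + tilt * s * sin b / q2)
    ((level' (s * cos b) + tilt * (s * cos b)) / q2).
Proof.
move=> sr; have [_ dc] := clockP sr; have ? := dc b; have ? := is_derive_sin b.
by der; rewrite /density /=; ring.
Qed.

Let half_periodsE k s : half_periods k s =
  clock s (k%:R * pi) + tilt * s * sin (k%:R * pi) / q2.
Proof. by rewrite sin_natpi mulr0 mul0r addr0. Qed.

Let half_periods_cmp k s t : (0 < k)%N -> `|s| < rad -> `|t| < rad ->
  (forall x, 0 < x <= 1 -> level' (s * x) + tilt * (s * x) < level' (t * x) + tilt * (t * x)) ->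
  (forall x, 0 < x <= 1 ->
    level' (s * - x) + tilt * (s * - x) < level' (t * - x) + tilt * (t * - x)) ->
  half_periods k s < half_periods k t.
Proof.
move=> k0 sr tr Hpos Hneg; rewrite !half_periodsE -subr_gt0.
have [s0 ds] := clockP sr; have [t0 dt] := clockP tr.
pose h b := clock t b + tilt * t * sin b / q2 - (clock s b + tilt * s * sin b / q2).
have h0 : h 0 = 0 by rewrite /h s0 t0 sin0 !mulr0 !mul0r addr0 subrr.
pose dh b := (level' (t * cos b) + tilt * (t * cos b)) / q2
  - (level' (s * cos b) + tilt * (s * cos b)) / q2.
have hd b : is_derive b 1 h (dh b) by apply: is_derive_subf; exact: dclockZ.
rewrite -/(h _) -[ltLHS]h0.
have pih : 0 < pi / 2 :> R by rewrite divr_gt0 ?pi_gt0.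
(* Strictness is gathered on [[0, pi / 2]], inside which [cos] is positive; further on the zeros of
   [cos] leave only a weak inequality. *)
apply: (@lt_le_trans _ _ (h (pi / 2))).
  apply: (derive_gt0_lt_cc pih (df := dh)) => // x /andP[x0 xp].
  have cx : 0 < cos x.
    by apply: cos_gt0_pihalf; rewrite xp andbT (lt_trans _ x0)// oppr_lt0.
  by rewrite subr_gt0 ltr_pM2r ?invr_gt0// Hpos// cx cos_le1.
have pk := pihalf_le_natpi R k0.
apply: (derive_ge0_le_cc pk (df := dh)) => // x _.
rewrite subr_ge0 ler_pM2r ?invr_gt0//.
have [cx|cx|<-] := ltgtP 0 (cos x); last by rewrite !mulr0.
  by apply/ltW/Hpos; rewrite cx cos_le1.
have := Hneg (- cos x); rewrite opprK => /(_ _)/ltW; apply.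
by rewrite oppr_gt0 cx/= lerNl cos_geN1.
Qed.

(** When [cos b] is not 0, [t * cos b] lies on the same side of 0 as [s * cos b] or beyond it,
    farther from 0, and [level' x + tilt * x] grows away from 0 on both sides. *)
Lemma half_periods_incr k s t : (0 < k)%N -> 0 <= s -> s < t -> t < rad ->
  half_periods k s < half_periods k t.
Proof.
move=> k0 s0 st tr; have t0 := le_lt_trans s0 st; have sr := lt_trans st tr.
apply: half_periods_cmp => //; rewrite ?ger0_norm ?(ltW t0)// => x /andP[x0 x1].
- by apply: tilted_level'_lt => //; [rewrite mulr_ge0// ltW|rewrite ltr_pM2r].
- apply: tilted_level'_gt => //; rewrite ?mulrN.
  + by rewrite ltrN2 (le_lt_trans _ tr)// ler_piMr// ltW.
  + by rewrite ltrN2 ltr_pM2r.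
  + by rewrite oppr_le0 mulr_ge0// ltW.
Qed.

Lemma half_periods_decr k s t : (0 < k)%N -> - rad < s -> s < t -> t <= 0 ->
  half_periods k t < half_periods k s.
Proof.
move=> k0 rs st t0; have s0 := lt_le_trans st t0; have rt := lt_trans rs st.
apply: half_periods_cmp => //; rewrite ?ler0_norm ?(ltW s0)// 1?ltrNl// => x /andP[x0 x1].
- apply: tilted_level'_gt => //.
  + by rewrite (lt_le_trans rs)// ler_niMr// ltW.
  + by rewrite ltr_pM2r.
  + by rewrite mulr_le0_ge0// ltW.
- apply: tilted_level'_lt => //; rewrite !mulrN.
  + by rewrite oppr_ge0 mulr_le0_ge0// ltW.
  + by rewrite ltrN2 ltr_pM2r.
Qed.


Lemma half_periods_continuous k s : `|s| < rad -> {for s, continuous (half_periods k)}.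
Proof.
move=> sr; apply: antiderivative_param_continuous; first exact: kpi0.
  have : \forall t \near s, `|t| < rad.
    by apply: (@cvgr_lt _ _ (nbhs s) _ Num.norm `|s|) => //; exact: norm_continuous.
  by apply: filterS => t tr; exact: density_continuous.
move=> t _; apply: cvgM; last exact: cvg_cst.
apply: (@cvg_comp _ _ _ (fun z : R * R => z.1 * cos z.2) level'); last first.
  exact: (level'_continuous lam0 p2 (NradN t sr)).
apply: cvgM; first exact: cvg_fst.
by apply: (@cvg_comp _ _ _ snd cos); [exact: cvg_snd|exact: continuous_cos].
Qed.

(** For [|s| < rad] energy conservation gives [|u'| <= sqrt lam * u], so half a turn lasts at least
    the variation of [ln u] divided by [sqrt lam]. The factor [e], taken as 1 or -1, serves both
    directions of travel. *)
Let log_clock s e : `|s| < rad -> `|e| <= 1 ->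
  e * (ln (level (s * cos 0)) - ln (level (s * cos pi))) <= Num.sqrt lam * clock s pi.
Proof.
move=> sr e1; have [c0 dc] := clockP sr.
have l0 : 0 < Num.sqrt lam by rewrite sqrtr_gt0.
pose h b := Num.sqrt lam * clock s b + e * ln (level (s * cos b)).
pose dh b := level' (s * cos b) / q2 *
  (Num.sqrt lam - e * (q2 * (s * sin b)) / level (s * cos b)).
have hd b : is_derive b 1 h (dh b).
  have xb := level_gt0 p lam0 (s * cos b).
  have d1 := is_derive_mulf (is_derive_cstf b s) (is_derive_cos b).
  have d2 := @is_derive_compf _ level (fun y => s * cos y) b _ _ (is_derive_level lam0 p2
    (NradN b sr)) d1.
  have d3 := @is_derive_compf _ (@ln R) (fun y => level (s * cos y)) b _ _ (is_derive1_ln xb) d2.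
  have d4 := is_derive_mulf (is_derive_cstf b e) d3.
  have d5 := is_derive_mulf (is_derive_cstf b (Num.sqrt lam)) (dc b).
  apply: is_derive_val (is_derive_addf d5 d4) _.
  by rewrite /dh /density; field; rewrite q2_neq0 gt_eqF.
have : h 0 <= h pi.
  apply: (derive_ge0_le_cc (pi_ge0 R) (df := dh)) => // b _.
  have xb := level_gt0 p lam0 (s * cos b).
  rewrite mulr_ge0 ?divr_ge0 ?(ltW (level'_gt0 lam0 p2 _)) ?(ltW q20)//.
  rewrite subr_ge0 ler_pdivrMr//; apply: le_trans (ler_norm _) _.
  rewrite normrM; apply: (@le_trans _ _ (1 * `|q2 * (s * sin b)|)).
    by rewrite ler_wpM2r.
  rewrite mul1r -(@ler_pXn2r _ 2)// ?nnegrE ?mulr_ge0 ?(ltW l0) ?(ltW xb)//.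
  rewrite -normrX ger0_norm ?sqr_ge0// !exprMn !sqr_sqrtr ?(ltW lam0)//.
  have := orbit_log_bound (NradN b sr); rewrite mulrA => h1; apply: le_trans h1 _.
  have : s ^+ 2 <= depth.
    by rewrite -rad_sqr// -[s ^+ 2]real_normK ?num_real// ler_pXn2r ?nnegrE// ltW.
  by move: depth => d; lra.
by rewrite /h c0; set A := ln _; set B := ln _; lra.
Qed.

Lemma half_periods_unbounded k M : (0 < k)%N ->
  exists s, [/\ 0 < s, s < rad, M < half_periods k s & M < half_periods k (- s)].
Proof.
move=> k0; have l0 : 0 < Num.sqrt lam by rewrite sqrtr_gt0.
have c0 := ctr_gt0 p lam0.
(* An orbit with minimum [u] has its maximum above [ctr], so [ln u] varies along it by at least
   [sqrt lam * |M| + 1]. The amplitudes [- amp u] and [amp u] start this same orbit at its maximum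
   and at its minimum. *)
pose u := ctr * expR (- (Num.sqrt lam * `|M| + 1)).
have u0 : 0 < u by rewrite mulr_gt0// expR_gt0.
have N0 : 0 <= Num.sqrt lam * `|M| by rewrite mulr_ge0// ltW.
have uc : u < ctr by rewrite /u gtr_pMr// expR_lt1 oppr_lt0; lra.
have s0 : 0 < - amp u by rewrite oppr_gt0 amp_lt0.
have sr : - amp u < rad by rewrite ltrNl; exact: amp_gtNrad.
have nr : `|- amp u| < rad by rewrite gtr0_norm.
have nr' : `|amp u| < rad by rewrite -normrN.
have lnu : ln u = ln ctr - (Num.sqrt lam * `|M| + 1).
  by rewrite lnM ?posrE ?expR_gt0// expRK.
have lnX : ln ctr <= ln (level (- amp u)).
  rewrite ler_ln ?posrE ?level_gt0// -(level0 lam0 p2); apply/ltW/level_lt => //.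
  by rewrite oppr_lt0.
have ge1 s : `|s| < rad -> clock s pi <= half_periods k s.
  move=> sr'; rewrite /half_periods; have : pi <= k%:R * pi :> R.
    by rewrite ler_peMl ?pi_ge0// ler1n.
  by rewrite le_eqVlt => /predU1P[<-//|/(clock_lt sr')/ltW].
have main s : `|s| < rad -> Num.sqrt lam * `|M| + 1 <= Num.sqrt lam * clock s pi ->
    M < half_periods k s.
  move=> sr' h; apply: lt_le_trans (ge1 s sr'); apply: le_lt_trans (ler_norm M) _.
  by rewrite -(ltr_pM2l l0); lra.
exists (- amp u); split=> //; apply: main => //.
- have := @log_clock (- amp u) 1 nr; rewrite normr1 => /(_ (lexx _)).
  by rewrite cos0 cospi !mulrN !mulr1 mul1r opprK ampK// lnu; lra.
- by rewrite opprK.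
- rewrite opprK; have := @log_clock (amp u) (-1) nr'; rewrite normrN1 => /(_ (lexx _)).
  by rewrite cos0 cospi !mulrN !mulr1 mulN1r ampK// lnu; lra.
Qed.

Lemma half_periods_surj k l : (0 < k)%N -> k%:R * ell_star lam p < l ->
  (exists2 s, 0 < s < rad & half_periods k s = l) /\
  (exists2 s, - rad < s < 0 & half_periods k s = l).
Proof.
move=> k0; rewrite -half_periods0 => kl.
have [s [s0 sr ls lNs]] := half_periods_unbounded l k0.
have Ns0 : - s <= 0 by rewrite oppr_le0 ltW.
have cont a b : - s <= a -> b <= s -> {within `[a, b], continuous (half_periods k)}.
  move=> sa bs; apply/continuous_in_subspaceT => x /[!inE]/=; rewrite in_itv/= => /andP[ax xb].
  apply: half_periods_continuous; apply: le_lt_trans sr.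
  by rewrite ler_norml (le_trans sa ax) (le_trans xb bs).
split.
- have mM : Num.min (half_periods k 0) (half_periods k s) <= l <=
      Num.max (half_periods k 0) (half_periods k s).
    apply/andP; split; first by rewrite ge_min; apply/orP; left; exact: ltW kl.
    by rewrite le_max; apply/orP; right; exact: ltW ls.
  have [t /[!in_itv]/= /andP[t0 ts] tl] := IVT (ltW s0) (cont _ _ Ns0 (lexx _)) mM.
  exists t => //; rewrite (le_lt_trans ts sr) andbT.
  by rewrite lt_neqAle t0 andbT; apply: contraTneq kl => ->; rewrite tl ltxx.
- have mM : Num.min (half_periods k (- s)) (half_periods k 0) <= l <=
      Num.max (half_periods k (- s)) (half_periods k 0).
    apply/andP; split; first by rewrite ge_min; apply/orP; right; exact: ltW kl.
    by rewrite le_max; apply/orP; left; exact: ltW lNs.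
  have [t /[!in_itv]/= /andP[st t0] tl] := IVT Ns0 (cont _ _ (lexx _) (ltW s0)) mM.
  exists t => //; apply/andP; split; first by apply: lt_le_trans st; rewrite ltrN2.
  by rewrite lt_neqAle t0 andbT; apply: contraTneq kl => <-; rewrite tl ltxx.
Qed.

Lemma half_periods_gt k s : (0 < k)%N -> `|s| < rad -> s != 0 ->
  k%:R * ell_star lam p < half_periods k s.
Proof.
move=> k0; rewrite ltr_norml -half_periods0 => /andP[rs sr].
rewrite neq_lt => /orP[s0|s0]; first exact: half_periods_decr.
exact: half_periods_incr.
Qed.

Lemma half_periods_ltn (j k : nat) s : `|s| < rad -> (j < k)%N ->
  half_periods j s < half_periods k s.
Proof. by move=> sr jk; apply: clock_lt => //; rewrite ltr_pM2r ?pi_gt0// ltr_nat. Qed.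

Definition angle s := inverse (clock s).
Definition orbit s x := level (s * cos (angle s x)).
Definition orbit' s x := - (q2 * s * sin (angle s x)).

Let angleP s : `|s| < rad -> cancel (clock s) (angle s) /\ cancel (angle s) (clock s).
Proof.
move=> sr.
by have [ck ak _] := inverseP (density_continuous sr) m0 (fun b => density_ge b sr).
Qed.

Lemma is_derive_orbit s x : `|s| < rad ->
  is_derive x 1 (orbit s) (orbit' s x) /\ is_derive x 1 (orbit' s) (- gap1 (orbit s x)).
Proof.
move=> sr; apply: (@orbit_ode (density s) _ s x (density_continuous sr) m0).
- by move=> b; exact: density_ge.
- exact: NradN.
- by [].
Qed.

Lemma orbit_gt0 s x : 0 < orbit s x.
Proof. exact: level_gt0. Qed.

Let angle0 s : `|s| < rad -> angle s 0 = 0.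
Proof.
by move=> sr; have [c0 _] := clockP sr; have [ck _] := angleP sr; rewrite -{1}c0 ck.
Qed.

Lemma orbit0 s : `|s| < rad -> orbit s 0 = level s.
Proof. by move=> sr; rewrite /orbit angle0// cos0 mulr1. Qed.

Lemma orbit'0 s : `|s| < rad -> orbit' s 0 = 0.
Proof. by move=> sr; rewrite /orbit' angle0// sin0 mulr0 oppr0. Qed.

Lemma orbit'_eq0 s l : `|s| < rad -> 0 < l ->
  orbit' s l = 0 <-> s = 0 \/ exists2 k : nat, (0 < k)%N & half_periods k s = l.
Proof.
move=> sr l0; have [ck ak] := angleP sr; split.
  move=> /eqP; rewrite oppr_eq0 !mulf_eq0 (negbTE q2_neq0) /=.
  move=> /orP[/eqP ->|/eqP sl]; [by left|right].
  have al0 : 0 < angle s l.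
    rewrite ltNge; apply/negP; rewrite -(angle0 sr) le_eqVlt => /predU1P[e|/(clock_lt sr)].
      by move: l0; rewrite -(ak l) e ak ltxx.
    by rewrite !ak => /(lt_trans l0); rewrite ltxx.
  have [k k0 alk] := sin_eq0_natpi al0 sl.
  by exists k => //; rewrite /half_periods -alk ak.
move=> [->|[k k0 <-]]; first by rewrite /orbit' mulr0 mul0r oppr0.
by rewrite /orbit' /half_periods ck sin_natpi mulr0 oppr0.
Qed.

End orbit.

(** * Trigonometric inequalities *)

Section trigonometry.
Variable R : realType.
Implicit Types a b e : R.

Lemma mulr_cos_lt_sin e : 0 < e -> e < pi -> e * cos e < sin e.
Proof.
move=> e0 ep; rewrite -subr_gt0.
pose h x : R := sin x - x * cos x.
have h0 : h 0 = 0 by rewrite /h sin0 mul0r subrr.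
rewrite -/(h e) -[ltLHS]h0; apply: (derive_gt0_lt_cc e0 (df := fun x => x * sin x)).
  move=> x _; have ? := is_derive_sin x; have ? := is_derive_cos x.
  by rewrite /h; der; rewrite /=; ring.
move=> x /andP[x0 xe]; rewrite mulr_gt0// sin_gt0_pi// x0/=.
exact: lt_trans ep.
Qed.

(* With [z = sin^2 (a / 2)] the derivative is bounded below, through
   [a <= 2 tan (a / 2)], by a multiple of [(3 z - 1) ^ 2]. *)
Lemma sqr_mul_cos_incr a b : 0 < a -> a < b -> b <= pi / 2 ->
  a ^+ 2 * (1 + 3 * cos a ^+ 2) < b ^+ 2 * (1 + 3 * cos b ^+ 2).
Proof.
move=> a0 ab bp; have pi0 := pi_gt0 R.
pose m x : R := x ^+ 2 * (1 + 3 * cos x ^+ 2).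
pose dm x : R := 2 * x * (1 + 3 * cos x ^+ 2 - 3 * x * (cos x * sin x)).
apply: (derive_gt0_lt_cc ab (f := m) (df := dm)).
  move=> x _; have ? := is_derive_cos x.
  by rewrite /m; der; rewrite /dm /=; ring.
move=> x /andP[ax xb]; have x0 : 0 < x by exact: lt_trans ax.
rewrite /dm mulr_gt0 ?mulr_gt0//.
pose e := x / 2; have xe : x = e *+ 2 by rewrite /e -mulr_natl; field.
have e0 : 0 < e by rewrite divr_gt0.
have ep : e < pi by rewrite /e; lra.
have ep2 : e < pi / 2 by rewrite /e; lra.
have h1 := mulr_cos_lt_sin e0 ep.
have S0 : 0 < sin e by apply: sin_gt0_pi; rewrite e0.
have cx0 : 0 < cos x by apply: cos_gt0_pihalf; apply/andP; split; lra.
have cE : cos x = 1 - 2 * sin e ^+ 2.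
  by rewrite xe cos_mulr2n cos2sin2 -[_ *+ 2]mulr_natl; ring.
have sE : sin x = 2 * (cos e * sin e) by rewrite xe sin_mulr2n mulr_natl.
rewrite sE cE; rewrite cE in cx0.
have xe2 : x = 2 * e by rewrite /e; field.
have -> : 3 * x * ((1 - 2 * sin e ^+ 2) * (2 * (cos e * sin e))) =
   12 * ((e * cos e) * (sin e * (1 - 2 * sin e ^+ 2))) by rewrite xe2; ring.
have h2 : (e * cos e) * (sin e * (1 - 2 * sin e ^+ 2)) <
    sin e * (sin e * (1 - 2 * sin e ^+ 2)).
  by rewrite ltr_pM2r// mulr_gt0.
have h3 : 1 + 3 * (1 - 2 * sin e ^+ 2) ^+ 2 - 12 * (sin e * (sin e * (1 - 2 * sin e ^+ 2)))
    = 4 * (3 * sin e ^+ 2 - 1) ^+ 2 by ring.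
have := sqr_ge0 (3 * sin e ^+ 2 - 1).
by move: h2 h3; set z1 := _ * (sin e * _); set z2 := sin e * _; lra.
Qed.

End trigonometry.

(** * The rising orbit of type A and its duration *)

Section rising_orbit.
Variables (R : realType) (lam p : R).
Hypotheses (lam0 : 0 < lam) (p2 : 2 < p).
Implicit Types a b c r s t u x y : R.

Local Notation ctr := (ctr lam p).
Local Notation pot := (pot lam p).
Local Notation depth := (depth lam p).
Local Notation gap := (gap lam p).
Local Notation gap1 := (gap1 lam p).
Local Notation amp := (amp lam p).
Local Notation level := (level lam p).
Local Notation level' := (level' lam p).
Local Notation rad := (rad lam p).
Local Notation q2 := (Num.sqrt (2 : R)).

Let rad0 : 0 < rad. Proof. exact: rad_gt0. Qed.
Let q20 : 0 < q2. Proof. by rewrite sqrtr_gt0. Qed.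
Let q2V : 0 < q2^-1. Proof. by rewrite invr_gt0. Qed.
Let radE : rad ^+ 2 = depth. Proof. exact: rad_sqr. Qed.

(* The orbit through [u = level s], [u' = 2 sqrt (2 pot u)]: the Kirchhoff condition
   makes its energy [3 pot (level s)], so that its radius [r] in polar coordinates
   satisfies [r ^ 2 + 3 s ^ 2 = 4 rad ^ 2]. Clamping at [s] only affects angles beyond
   [angA s]; it keeps the argument of [level'] in [(- rad, +oo)]. *)
Definition radA s := Num.sqrt (4 * rad ^+ 2 - 3 * s ^+ 2).
Definition angA s := acos (s / radA s).
Definition densA s b := level' (Num.max (radA s * cos b) s) / q2.
Definition clockA s := antiderivative (densA s).
Definition tau s := clockA s (angA s).

Let sqr_lt s : `|s| < rad -> s ^+ 2 < rad ^+ 2.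
Proof.
by move=> sr; rewrite -[s ^+ 2]real_normK ?num_real// ltr_pXn2r// nnegrE ltW.
Qed.

Let radA_sqr s : `|s| < rad -> radA s ^+ 2 = 4 * rad ^+ 2 - 3 * s ^+ 2.
Proof. by move=> /sqr_lt sr; rewrite sqr_sqrtr//; have := sqr_ge0 rad; lra. Qed.

Lemma radA_gt s : `|s| < rad -> rad < radA s.
Proof.
move=> sr; rewrite -(@ltr_pXn2r _ 2)// ?nnegrE ?sqrtr_ge0 ?ltW// radA_sqr//.
by have := sqr_lt sr; lra.
Qed.

Let radA0 s : `|s| < rad -> 0 < radA s.
Proof. by move=> /radA_gt; exact: lt_trans. Qed.

Let radA_le s : `|s| < rad -> radA s <= 2 * rad.
Proof.
move=> sr; rewrite -(@ler_pXn2r _ 2)// ?nnegrE ?sqrtr_ge0 ?mulr_ge0 ?(ltW rad0)//.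
by rewrite radA_sqr// exprMn; have := sqr_ge0 s; lra.
Qed.

Let radA_lt s t : `|s| < rad -> `|t| < rad -> `|s| < `|t| -> radA t < radA s.
Proof.
move=> sr tr st; rewrite -(@ltr_pXn2r _ 2)// ?nnegrE ?sqrtr_ge0// !radA_sqr//.
have : s ^+ 2 < t ^+ 2.
  by rewrite -[s ^+ 2]real_normK ?num_real// -[t ^+ 2]real_normK ?num_real// ltr_pXn2r ?nnegrE.
lra.
Qed.

Let ratio s : `|s| < rad -> -1 < s / radA s < 1.
Proof.
move=> sr; have r0 := radA0 sr; rewrite -ltr_norml normrM normfV (gtr0_norm r0).
by rewrite ltr_pdivrMr// mul1r (lt_trans sr)// radA_gt.
Qed.

Let ratio_le s : `|s| < rad -> -1 <= s / radA s <= 1.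
Proof. by move=> /ratio/andP[? ?]; rewrite !ltW. Qed.

Lemma radA_cos s : `|s| < rad -> radA s * cos (angA s) = s.
Proof.
move=> sr; have r0 := radA0 sr.
by rewrite acosK ?in_itv/= ?ratio_le// mulrC divfK// gt_eqF.
Qed.

Lemma angA_gt0 s : `|s| < rad -> 0 < angA s.
Proof. by move=> /ratio/andP[a b]; apply: acos_gt0; rewrite b ltW. Qed.

Lemma angA_ltpi s : `|s| < rad -> angA s < pi.
Proof. by move=> /ratio/andP[a b]; apply: acos_ltpi; rewrite a ltW. Qed.

(** Since [depth - s ^ 2 = pot (level s)], the orbit leaves with twice the slope, in modulus, of the
    soliton at the same level, as the Kirchhoff condition demands. *)
Lemma radA_sin s : `|s| < rad -> radA s * sin (angA s) = 2 * Num.sqrt (depth - s ^+ 2).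
Proof.
move=> sr; have r0 := radA0 sr; have d0 := sqr_lt sr.
have a0 : 0 < sin (angA s) by apply: sin_gt0_pi; rewrite angA_gt0// angA_ltpi.
apply/eqP; rewrite -(@eqrXn2 _ 2)// ?mulr_ge0 ?sqrtr_ge0 ?(ltW r0) ?(ltW a0)//.
have e1 : radA s ^+ 2 * cos (angA s) ^+ 2 = s ^+ 2 by rewrite -exprMn radA_cos.
have e2 : Num.sqrt (depth - s ^+ 2) ^+ 2 = rad ^+ 2 - s ^+ 2.
  by rewrite -radE sqr_sqrtr// subr_ge0 ltW.
apply/eqP; rewrite (exprMn 2 (radA s)) (exprMn 2 2) e2 sin2cos2 mulrBr e1 mulr1 radA_sqr//.
by ring.
Qed.

Let cos_ge s b : `|s| < rad -> 0 <= b -> b <= angA s -> s <= radA s * cos b.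
Proof.
move=> sr b0 ba; have r0 := radA0 sr; rewrite -[leLHS]radA_cos// ler_pM2l//.
have ap := angA_ltpi sr; have a0 := angA_gt0 sr.
move: ba; rewrite le_eqVlt => /predU1P[->//|ba]; apply: ltW.
by rewrite ltr_cos// in_itv/=; apply/andP; split; lra.
Qed.

Let densAE s b : `|s| < rad -> 0 <= b -> b <= angA s ->
  densA s b = level' (radA s * cos b) / q2.
Proof. by move=> sr b0 ba; rewrite /densA (max_idPl _)// cos_ge. Qed.

Let clampY_cvg T (FF : set_system T) (fFF : Filter FF) (f g : T -> R) s a :
  - rad < s -> f @ FF --> a -> g @ FF --> s ->
  level' (Num.max (f x) (g x)) @[x --> FF] --> level' (Num.max a s).
Proof.
move=> rs fa gs; have contY : level' @ nbhs (Num.max a s) --> level' (Num.max a s).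
  by apply: (level'_continuous lam0 p2); rewrite lt_max rs orbT.
apply: (@continuous2_cvg _ _ _ _ _ _ f g (fun x y => level' (Num.max x y)) a s) => //.
exact: (@cvg_comp _ _ _ (fun z : R * R => Num.max z.1 z.2) level' _ _ _
  (@max_continuous _ R (a, s)) contY).
Qed.

Lemma densA_continuous s : `|s| < rad -> continuous (densA s).
Proof.
move=> sr b; apply: cvgM; last exact: cvg_cst.
apply: clampY_cvg; last exact: cvg_cst.
  by move: sr; rewrite ltr_norml => /andP[].
by apply: cvgM; [exact: cvg_cst|exact: continuous_cos].
Qed.

Lemma densA_ge s b : `|s| < rad -> level' (2 * rad) / q2 <= densA s b.
Proof.
move=> sr; have r0 := radA0 sr; rewrite (ler_pM2r q2V).
move: (sr); rewrite ltr_norml => /andP[s1 s2]; apply: level'_le => //.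
  by rewrite lt_max s1 orbT.
rewrite ge_max; apply/andP; split; last by have := rad0; lra.
apply: le_trans (radA_le sr); by rewrite ler_piMr ?cos_le1// ltW.
Qed.

Let mA0 : 0 < level' (2 * rad) / q2. Proof. by rewrite divr_gt0 ?level'_gt0. Qed.

Let clockAP s : `|s| < rad ->
  clockA s 0 = 0 /\ forall b, is_derive b 1 (clockA s) (densA s b).
Proof. by move=> sr; apply/antiderivativeP/densA_continuous. Qed.

Lemma clockA_lt s a b : `|s| < rad -> a < b -> clockA s a < clockA s b.
Proof.
move=> sr ab; apply: antiderivative_lt ab; first exact: densA_continuous.
by move=> x; apply: lt_le_trans mA0 (densA_ge x sr).
Qed.

Lemma tau_gt0 s : `|s| < rad -> 0 < tau s.
Proof.
by move=> sr; have [<- _] := clockAP sr; apply: clockA_lt => //; exact: angA_gt0.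
Qed.

(** The angle is rescaled to [[0, 1]], so that the interval of integration no longer depends on
    [s]. *)
Let dens1 s t := angA s * densA s (angA s * t).

Let dens1_continuous s : `|s| < rad -> continuous (dens1 s).
Proof.
move=> sr t; apply: cvgM; first exact: cvg_cst.
apply: (@continuous_comp _ _ _ (fun t => angA s * t) (densA s)).
  by apply: cvgM; [exact: cvg_cst|exact: cvg_id].
exact: densA_continuous.
Qed.

Let tau1 s : `|s| < rad -> tau s = antiderivative (dens1 s) 1.
Proof.
move=> sr; have [c0 dc] := clockAP sr.
have [h0 dh] := antiderivativeP (dens1_continuous sr).
have d1 x : 0 <= x <= 1 -> is_derive x 1 (fun t => clockA s (angA s * t)) (dens1 s x).
  move=> _; have dl := is_derive_mulf (is_derive_cstf x (angA s)) (is_derive_idf x).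
  apply: is_derive_val (@is_derive_compf _ (clockA s) _ x _ _ (dc _) dl) _.
  by rewrite mul0r add0r mulr1 mulrC.
have d2 x : 0 <= x <= 1 -> is_derive x 1 (antiderivative (dens1 s)) (dens1 s x) by [].
have := same_derive_increment (ler01) d1 d2.
by rewrite mulr0 c0 h0 !subr0 mulr1.
Qed.

Let radA_continuous s : {for s, continuous radA}.
Proof.
apply: (@continuous_comp _ _ _ (fun s => 4 * rad ^+ 2 - 3 * s ^+ 2) Num.sqrt).
  apply: cvgB; first exact: cvg_cst.
  apply: cvgM; first exact: cvg_cst.
  exact: exprn_continuous.
exact: sqrt_continuous.
Qed.

Let angA_continuous s : `|s| < rad -> {for s, continuous angA}.
Proof.
move=> sr; apply: (@continuous_comp _ _ _ (fun s => s / radA s) (@acos R)).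
  apply: cvgM; first exact: cvg_id.
  by apply: cvgV; [rewrite gt_eqF ?radA0|exact: radA_continuous].
exact: continuous_acos (ratio sr).
Qed.

Let near_rad s : `|s| < rad -> \forall t \near s, `|t| < rad.
Proof.
by move=> sr; apply: (@cvgr_lt _ _ (nbhs s) _ Num.norm `|s|) => //; exact: norm_continuous.
Qed.

Lemma tau_continuous s : `|s| < rad -> {for s, continuous tau}.
Proof.
move=> sr.
have ct : {for s, continuous (fun s => antiderivative (dens1 s) 1)}.
  apply: antiderivative_param_continuous => //.
    by apply: filterS (near_rad sr) => t; exact: dens1_continuous.
  move=> t _.
  have c1 : (fun z : R * R => angA z.1) @ nbhs (s, t) --> angA s.
    by apply: (@cvg_comp _ _ _ fst angA); [exact: cvg_fst|exact: angA_continuous].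
  apply: cvgM => //; apply: cvgM; last exact: cvg_cst.
  apply: clampY_cvg; last exact: cvg_fst.
    by move: sr; rewrite ltr_norml => /andP[].
  apply: cvgM.
    by apply: (@cvg_comp _ _ _ fst radA); [exact: cvg_fst|exact: radA_continuous].
  apply: (@cvg_comp _ _ _ (fun z : R * R => angA z.1 * z.2) cos); last exact: continuous_cos.
  by apply: cvgM => //; exact: cvg_snd.
rewrite /prop_for /continuous_at tau1//; apply: cvg_trans ct; apply: near_eq_cvg.
by apply: filterS (near_rad sr) => t tr; rewrite tau1.
Qed.


Let ge0_norm s : 0 <= s -> s < rad -> `|s| < rad.
Proof. by move=> s0 sr; rewrite ger0_norm. Qed.

Let le0_norm s : s <= 0 -> - rad < s -> `|s| < rad.
Proof. by move=> s0 sr; rewrite ler0_norm// ltrNl. Qed.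

Let angA_le_pihalf s : 0 <= s -> s < rad -> angA s <= pi / 2.
Proof.
move=> s0 sr; have nr := ge0_norm s0 sr; rewrite leNgt; apply/negP => pa.
have : radA s * cos (angA s) < 0.
  have a0 := angA_gt0 nr; have ap := angA_ltpi nr.
  rewrite pmulr_rlt0 ?radA0// -cos_pihalf ltr_cos// in_itv/=.
    by apply/andP; split; lra.
  by apply/andP; split; lra.
by rewrite radA_cos// ltNge s0.
Qed.

Let angA_ge_pihalf s : s <= 0 -> - rad < s -> pi / 2 <= angA s.
Proof.
move=> s0 sr; have nr := le0_norm s0 sr; rewrite leNgt; apply/negP => pa.
have : 0 < radA s * cos (angA s).
  rewrite pmulr_rgt0 ?radA0// cos_gt0_pihalf// pa andbT.
  by have := angA_gt0 nr; have := pi_gt0 R; lra.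
by rewrite radA_cos// ltNge s0.
Qed.

Let angA_gt s t : `|s| < rad -> `|t| < rad -> s / radA s < t / radA t -> angA t < angA s.
Proof.
move=> sr tr; rewrite -{1}(acosK (x := s / radA s)) ?in_itv/= ?ratio_le//.
rewrite -{1}(acosK (x := t / radA t)) ?in_itv/= ?ratio_le//.
have [a0 b0] := (angA_gt0 sr, angA_gt0 tr); have [ap bp] := (angA_ltpi sr, angA_ltpi tr).
by rewrite ltr_cos// in_itv/= ltW//= ltW.
Qed.

(** As [s >= 0] grows the radius shrinks, which tends to raise the density, while the angle shrinks
    too: the effects compete. What decides is that angle over radius decreases ([key]), which
    [mul_level'_le] converts into a comparison of the rescaled densities. *)
Let tau_decr_ge0 s t : 0 <= s -> s < t -> t < rad -> tau t < tau s.
Proof.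
move=> s0 st tr; have t0 := le_lt_trans s0 st; have sr := lt_trans st tr.
have ns := ge0_norm s0 sr; have nt := ge0_norm (ltW t0) tr.
have rs0 := radA0 ns; have rt0 := radA0 nt.
have rts : radA t < radA s by apply: radA_lt => //; rewrite !ger0_norm// ltW.
have ats : angA t < angA s.
  apply: angA_gt => //; apply: (@le_lt_trans _ _ (s / radA t)).
    by rewrite ler_wpM2l// lef_pV2 ?posrE// ltW.
  by rewrite ltr_pM2r// invr_gt0.
have at0 := angA_gt0 nt; have as0 := angA_gt0 ns.
have asp := angA_le_pihalf s0 sr; have atp := angA_le_pihalf (ltW t0) tr.
(* Because [radA ^ 2 * (1 + 3 * cos angA ^ 2) = 4 * rad ^ 2], the square of [angA / radA] is
   proportional to [angA ^ 2 * (1 + 3 * cos angA ^ 2)], the function of the angle treated by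
   [sqr_mul_cos_incr]. *)
have key : angA t * radA s < angA s * radA t.
  have inc := sqr_mul_cos_incr at0 ats asp.
  have e x : `|x| < rad -> radA x ^+ 2 * (1 + 3 * cos (angA x) ^+ 2) = 4 * rad ^+ 2.
    move=> xr; rewrite mulrDr mulr1 mulrCA -exprMn radA_cos// radA_sqr//; ring.
  have es := e _ ns; have et := e _ nt.
  have ks : 0 < 1 + 3 * cos (angA s) ^+ 2 by have := sqr_ge0 (cos (angA s)); lra.
  have kt : 0 < 1 + 3 * cos (angA t) ^+ 2 by have := sqr_ge0 (cos (angA t)); lra.
  rewrite -(@ltr_pXn2r _ 2)// ?nnegrE ?mulr_ge0 ?ltW// (exprMn 2 (angA t)) (exprMn 2 (angA s)).
  rewrite -(ltr_pM2r (mulr_gt0 ks kt)).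
  set A := angA t ^+ 2 in inc *; set B := angA s ^+ 2 in inc *.
  set K := 1 + 3 * cos (angA s) ^+ 2 in inc es ks *.
  set L := 1 + 3 * cos (angA t) ^+ 2 in inc et kt *.
  have -> : A * radA s ^+ 2 * (K * L) = (radA s ^+ 2 * K) * (A * L) by ring.
  have -> : B * radA t ^+ 2 * (K * L) = (radA t ^+ 2 * L) * (B * K) by ring.
  by rewrite es et ltr_pM2l// mulr_gt0// exprn_gt0.
rewrite (tau1 ns) (tau1 nt).
apply: (antiderivative_cmp_lt (dens1_continuous nt) (dens1_continuous ns) ltr01).
move=> x /andP[x0 x1]; rewrite /dens1.
have asx : 0 < angA s * x < angA s by rewrite mulr_gt0//= gtr_pMr.
have atx : 0 < angA t * x < angA t by rewrite mulr_gt0//= gtr_pMr.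
case/andP: asx => asx0 asx1; case/andP: atx => atx0 atx1.
rewrite !densAE ?(ltW asx0) ?(ltW asx1) ?(ltW atx0) ?(ltW atx1)//.
rewrite !mulrA (ltr_pM2r q2V).
have cs : 0 < cos (angA s * x) by apply: cos_gt0_pihalf; apply/andP; split; lra.
have ct : 0 < cos (angA t * x) by apply: cos_gt0_pihalf; apply/andP; split; lra.
have cst : cos (angA s * x) <= cos (angA t * x).
  apply: ltW; rewrite ltr_cos ?in_itv/=.
  - by rewrite ltr_pM2r.
  - by have := pi_gt0 R; move=> ?; apply/andP; split; lra.
  - by have := pi_gt0 R; move=> ?; apply/andP; split; lra.
set qs := radA s * _; set qt := radA t * _.
have qs0 : 0 < qs by rewrite mulr_gt0.
have qt0 : 0 < qt by rewrite mulr_gt0.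
have Nr0 : - rad < 0 by rewrite oppr_lt0.
(* If the argument of [level'] is no larger for [s], its monotonicity and the larger angle suffice.
   Otherwise the products of [level'] with its argument are compared, and [key] makes up for the
   ratio of the arguments. *)
have [qst|qts] := leP qs qt.
  apply: (@lt_le_trans _ _ (angA s * level' qt)).
    by rewrite ltr_pM2r// level'_gt0.
  rewrite (ler_pM2l as0); exact: (level'_le lam0 p2 (lt_trans Nr0 qs0) qst).
have le := mul_level'_le lam0 p2 (ltW qt0) (ltW qts).
rewrite -(ltr_pM2r qs0) -(ltr_pM2r qt0).
apply: (@le_lt_trans _ _ (angA t * qs * (qs * level' qs))).
  have -> : angA t * level' qt * qs * qt = angA t * qs * (qt * level' qt) by ring.
  by rewrite (ler_pM2l (mulr_gt0 at0 qs0)).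
have -> : angA s * level' qs * qs * qt = angA s * qt * (qs * level' qs) by ring.
rewrite (ltr_pM2r (mulr_gt0 qs0 (level'_gt0 lam0 p2 qs))) /qs /qt !mulrA.
apply: (@lt_le_trans _ _ (angA s * radA t * cos (angA s * x))).
  by rewrite (ltr_pM2r cs).
by rewrite (ler_pM2l (mulr_gt0 as0 rt0)).
Qed.

(** The orbit is cut at the angle [pi / 2], where [u = ctr]. On [[0, pi / 2]] the densities are
    compared at equal angles, the radius being smaller for [s]. Beyond, [cos] is negative and this
    comparison turns round, so the amplitude replaces the angle as variable. *)
Let tau_decr_le0 s t : - rad < s -> s < t -> t <= 0 -> tau t < tau s.
Proof.
move=> rs st t0; have s0 := lt_le_trans st t0; have rt := lt_trans rs st.
have ns := le0_norm (ltW s0) rs; have nt := le0_norm t0 rt.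
have rs0 := radA0 ns; have rt0 := radA0 nt.
have rst : radA s < radA t.
  by apply: radA_lt => //; rewrite ler0_norm// ltr0_norm// ltrN2.
have pih : 0 <= pi / 2 :> R by rewrite divr_ge0 ?pi_ge0.
have first : clockA t (pi / 2) <= clockA s (pi / 2).
  apply: (antiderivative_cmp_le (densA_continuous nt) (densA_continuous ns) pih).
  move=> x /andP[x0 x1].
  have xs := le_trans (ltW x1) (angA_ge_pihalf (ltW s0) rs).
  have xt := le_trans (ltW x1) (angA_ge_pihalf t0 rt).
  rewrite (densAE ns (ltW x0) xs) (densAE nt (ltW x0) xt).
  rewrite (ler_pM2r q2V).
  have cx : 0 < cos x.
    by apply: cos_gt0_pihalf; rewrite x1 andbT (lt_trans _ x0)// oppr_lt0 divr_gt0// pi_gt0.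
  apply: (level'_le lam0 p2); last by rewrite (ler_pM2r cx) ltW.
  by apply: lt_trans (mulr_gt0 rs0 cx); rewrite oppr_lt0.
pose k s := - s / radA s.
have kE x : x / radA x = - k x by rewrite /k mulNr opprK.
have k1 x : `|x| < rad -> k x < 1.
  by move=> /ratio; rewrite kE ltrN2 => /andP[].
have kt0 : 0 <= k t by rewrite divr_ge0 ?oppr_ge0// ltW.
have kts : k t < k s.
  apply: (@le_lt_trans _ _ (- t / radA s)).
    by rewrite ler_wpM2l ?oppr_ge0// lef_pV2 ?posrE// ltW.
  by rewrite ltr_pM2r ?ltrN2// invr_gt0.
have ks0 : 0 < k s by exact: le_lt_trans kts.
(* The clock at the angle of cosine [- k s * x], where the amplitude is [s * x]: from [pi / 2] at
   [x = 0] to [angA s] at [x = 1]. Both factors of [dg] are then ordered in the same sense. *)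
pose g s x := clockA s (acos (- (k s * x))).
pose dg s x := (level' (s * x) / q2) * (k s / Num.sqrt (1 - (k s * x) ^+ 2)).
have gP u : `|u| < rad -> u <= 0 -> 0 <= k u -> forall x, 0 <= x <= 1 ->
    [/\ is_derive x 1 (g u) (dg u x) & 0 < 1 - (k u * x) ^+ 2].
  move=> ur u0 ku0 x /andP[x0 x1].
  have kx0 : 0 <= k u * x by rewrite mulr_ge0.
  have kx1 : k u * x < 1 by apply: le_lt_trans (k1 u ur); rewrite ler_piMr.
  have pos : 0 < 1 - (k u * x) ^+ 2 by rewrite subr_gt0 exprn_ilt1.
  split=> //.
  have in1 : -1 < - (k u * x) < 1 by rewrite ltrN2 kx1/= (le_lt_trans _ ltr01)// oppr_le0.
  have in2 : - 1 <= - (k u * x) <= 1 by case/andP: in1 => /ltW -> /ltW.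
  have d1 := is_derive_oppf (is_derive_mulf (is_derive_cstf x (k u)) (is_derive_idf x)).
  have d2 := @is_derive_compf _ (@acos R) (fun y => - (k u * y)) x _ _ (is_derive1_acos in1) d1.
  have [_ dc] := clockAP ur.
  have d3 := @is_derive_compf _ (clockA u) (fun y => acos (- (k u * y))) x _ _ (dc _) d2.
  apply: is_derive_val d3 _.
  have ru0 := radA0 ur.
  have rk : radA u * k u = - u by rewrite /k mulrC divfK// gt_eqF.
  have re : radA u * - (k u * x) = u * x by rewrite mulrN mulrA rk mulNr opprK.
  have in2' : - (k u * x) \in `[-1, 1] by rewrite in_itv.
  rewrite /dg /densA (acosK in2') re.
  rewrite (max_idPl _); last by rewrite -[leLHS]mulr1 ler_wnM2l.
  rewrite sqrrN; set sq := Num.sqrt _.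
  by rewrite mul0r add0r mulr1 mulrNN; congr (_ * _); rewrite mulrC.
have tauE u : `|u| < rad -> tau u = g u 1.
  by move=> ur; rewrite /tau /angA kE /g mulr1.
have g0 u : g u 0 = clockA u (pi / 2) by rewrite /g mulr0 oppr0 acos0.
rewrite !tauE//.
have gs x : 0 <= x <= 1 -> is_derive x 1 (fun x => g s x - g t x) (dg s x - dg t x).
  move=> x01; have [ds _] := gP s ns (ltW s0) (ltW ks0) x x01.
  by have [dt _] := gP t nt t0 kt0 x x01; exact: is_derive_subf ds dt.
have : g s 0 - g t 0 < g s 1 - g t 1.
  apply: (derive_gt0_lt_cc ltr01 gs) => x /andP[x0 x1].
  have x01 : 0 <= x <= 1 by rewrite !ltW.
  have [_ ps] := gP s ns (ltW s0) (ltW ks0) x x01.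
  have [_ pt] := gP t nt t0 kt0 x x01.
  rewrite subr_gt0 /dg.
  apply: (@le_lt_trans _ _ (level' (s * x) / q2 * (k t / Num.sqrt (1 - (k t * x) ^+ 2)))).
    have w0 : 0 <= k t / Num.sqrt (1 - (k t * x) ^+ 2) by rewrite divr_ge0 ?sqrtr_ge0.
    apply: (ler_wpM2r w0); rewrite (ler_pM2r q2V); apply: (level'_le lam0 p2).
      by apply: lt_le_trans rs _; rewrite -[leLHS]mulr1 (ler_wnM2l (ltW s0) (ltW x1)).
    by rewrite (ler_pM2r x0) (ltW st).
  rewrite (ltr_pM2l (divr_gt0 (level'_gt0 lam0 p2 _) q20)).
  apply: (@lt_le_trans _ _ (k s / Num.sqrt (1 - (k t * x) ^+ 2))).
    by rewrite ltr_pM2r// invr_gt0 sqrtr_gt0.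
  rewrite (ler_pM2l ks0) lef_pV2 ?posrE ?sqrtr_gt0//; apply: ler_wsqrtr; apply: lerB => //.
  have kx u : 0 <= k u -> 0 <= k u * x by move=> ku; rewrite mulr_ge0// ltW.
  rewrite (@ler_pXn2r _ 2)// ?nnegrE ?kx//; last exact: ltW.
  by rewrite (ler_pM2r x0) ltW.
rewrite (g0 s) (g0 t) => h; rewrite -subr_gt0; apply: le_lt_trans h.
by rewrite subr_ge0.
Qed.

Lemma tau_decr s t : - rad < s -> s < t -> t < rad -> tau t < tau s.
Proof.
move=> rs st tr; have [s0|s0] := leP 0 s; first exact: tau_decr_ge0.
have [t0|t0] := leP t 0; first exact: tau_decr_le0.
apply: (@lt_trans _ _ (tau 0)); first exact: tau_decr_ge0.
exact: tau_decr_le0.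
Qed.

Lemma tau_inj s t : `|s| < rad -> `|t| < rad -> tau s = tau t -> s = t.
Proof.
rewrite !ltr_norml => /andP[s1 s2] /andP[t1 t2] e.
have [lt|gt|//] := ltgtP s t.
  by have := tau_decr s1 lt t2; rewrite e ltxx.
by have := tau_decr t1 gt s2; rewrite e ltxx.
Qed.


(** A small final angle [a] is prescribed and [s] solved from [radA * cos a = s] and
    [radA ^ 2 + 3 * s ^ 2 = 4 * rad ^ 2]. For [s >= 0] the density up to [a] is at most
    [k = level' 0 / sqrt 2], so [a <= l / k] suffices. *)
Let tau_small l : 0 < l -> exists2 s, 0 <= s < rad & tau s <= l.
Proof.
move=> l0; have pi0 := pi_gt0 R.
pose k := level' 0 / q2; have k0 : 0 < k by rewrite divr_gt0 ?level'_gt0.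
have [a [a0 ap al]] : exists a, [/\ 0 < a, a <= pi / 4 & a <= l / k].
  exists (Num.min (pi / 4) (l / k)); split; rewrite ?ge_min ?lexx ?orbT//.
  by rewrite lt_min; apply/andP; split; apply: divr_gt0.
have ca0 : 0 < cos a by apply: cos_gt0_pihalf; apply/andP; split; lra.
have sa0 : 0 < sin a by apply: sin_gt0_pi; apply/andP; split; lra.
have ca1 : cos a ^+ 2 < 1 by rewrite cos2sin2 gtrBl exprn_gt0.
pose w := Num.sqrt (1 + 3 * cos a ^+ 2).
have K0 : 0 < 1 + 3 * cos a ^+ 2 by have := sqr_ge0 (cos a); lra.
have w0 : 0 < w by rewrite sqrtr_gt0.
have w2 : w ^+ 2 = 1 + 3 * cos a ^+ 2 by rewrite sqr_sqrtr// ltW.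
pose s := 2 * rad * cos a / w.
have s0 : 0 < s by rewrite divr_gt0// !mulr_gt0.
have sr : s < rad.
  have nn : 0 <= 2 * rad * cos a by rewrite !mulr_ge0// ltW.
  rewrite /s ltr_pdivrMr// -(@ltr_pXn2r _ 2)// ?nnegrE ?(mulr_ge0 (ltW rad0) (ltW w0))//.
  have -> : (2 * rad * cos a) ^+ 2 = rad ^+ 2 * (4 * cos a ^+ 2) by ring.
  rewrite exprMn w2 ltr_pM2l ?exprn_gt0//; move: (cos a ^+ 2) ca1 => z; lra.
have nr := ge0_norm (ltW s0) sr.
have rE : radA s = 2 * rad / w.
  have nn : 0 <= 2 * rad / w by apply: divr_ge0; [rewrite mulr_ge0// ltW|exact: ltW].
  apply/eqP; rewrite -(@eqrXn2 _ 2)// ?sqrtr_ge0// (radA_sqr nr); apply/eqP.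
  have -> : 4 * rad ^+ 2 - 3 * s ^+ 2 = rad ^+ 2 * (4 * w ^+ 2 - 12 * cos a ^+ 2) / w ^+ 2.
    by rewrite /s; field; rewrite gt_eqF.
  have -> : (2 * rad / w) ^+ 2 = rad ^+ 2 * 4 / w ^+ 2 by field; rewrite gt_eqF.
  by congr (_ / _); rewrite w2; ring.
have aE : angA s = a.
  rewrite /angA rE /s.
  have -> : 2 * rad * cos a / w / (2 * rad / w) = cos a.
    by field; rewrite !gt_eqF.
  by rewrite cosK// in_itv/=; apply/andP; split; lra.
exists s; first by rewrite ltW.
have [c0 dc] := clockAP nr.
have := @derive_ge0_le_cc _ (fun x => k * x - clockA s x)
  (fun x => (0 * x + k * 1) - densA s x) 0 a (ltW a0).
have h x : 0 <= x <= a -> is_derive x 1 (fun x => k * x - clockA s x)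
    ((0 * x + k * 1) - densA s x).
  by move=> _; exact: is_derive_subf (is_derive_mulf (is_derive_cstf x k) (is_derive_idf x)) (dc x).
have h0 x : 0 < x < a -> 0 <= (0 * x + k * 1) - densA s x.
  move=> /andP[x0 xa]; have xA : x <= angA s by rewrite aE ltW.
  rewrite mul0r add0r mulr1 subr_ge0 (densAE nr (ltW x0) xA).
  rewrite (ler_pM2r q2V) level'_le// ?oppr_lt0// mulr_ge0 ?sqrtr_ge0// ltW//.
  by apply: cos_gt0_pihalf; apply/andP; split; lra.
move=> /(_ h h0); rewrite c0 mulr0 subr0 subr_ge0 /tau aE => /le_trans; apply.
by rewrite mulrC -ler_pdivlMr.
Qed.

(** With [a = level s] the starting value, [u' ^ 2 = 2 * pot u + 6 * pot a <= 4 * lam * u ^ 2], as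
    [u >= a]. Thus [ln u] grows at rate at most [2 * sqrt lam], and a tiny [a] delays the arrival at
    the maximum, which lies above [ctr]. *)
Let tau_large l : exists2 s, - rad < s < 0 & l <= tau s.
Proof.
have l0 : 0 < Num.sqrt lam by rewrite sqrtr_gt0.
have c0 := ctr_gt0 p lam0.
have N0 : 0 <= 2 * Num.sqrt lam * `|l| by rewrite !mulr_ge0// ltW.
pose u := ctr * expR (- (2 * Num.sqrt lam * `|l| + 1)).
have u0 : 0 < u by rewrite mulr_gt0// expR_gt0.
have uc : u < ctr by rewrite /u gtr_pMr// expR_lt1 oppr_lt0; lra.
have lnu : ln u = ln ctr - (2 * Num.sqrt lam * `|l| + 1).
  by rewrite lnM ?posrE ?expR_gt0// expRK.
pose s := amp u; have s0 : s < 0 by exact: amp_lt0.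
have rs : - rad < s by exact: amp_gtNrad.
have nr := le0_norm (ltW s0) rs.
exists s; first by rewrite rs.
have rs0 := radA0 nr; have [k0 dc] := clockAP nr.
have rgt b : 0 <= b -> b <= angA s -> - rad < radA s * cos b.
  by move=> b0 ba; apply: lt_le_trans rs _; exact: cos_ge.
pose h b := 2 * Num.sqrt lam * clockA s b + ln (level (radA s * cos b)).
pose dh b := level' (radA s * cos b) / q2 *
  (2 * Num.sqrt lam - q2 * (radA s * sin b) / level (radA s * cos b)).
have hd b : 0 <= b <= angA s -> is_derive b 1 h (dh b).
  move=> /andP[b0 ba]; have xb := level_gt0 p lam0 (radA s * cos b).
  have d1 := is_derive_mulf (is_derive_cstf b (radA s)) (is_derive_cos b).
  have d2 := @is_derive_compf _ level (fun y => radA s * cos y) b _ _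
    (is_derive_level lam0 p2 (rgt b b0 ba)) d1.
  have d3 := @is_derive_compf _ (@ln R) (fun y => level (radA s * cos y)) b _ _
    (is_derive1_ln xb) d2.
  have d5 := is_derive_mulf (is_derive_cstf b (2 * Num.sqrt lam)) (dc b).
  apply: is_derive_val (is_derive_addf d5 d3) _.
  by rewrite densAE// /dh; field; rewrite !gt_eqF.
have : h 0 <= h (angA s).
  apply: (derive_ge0_le_cc (ltW (angA_gt0 nr)) (df := dh)) => // b /andP[b0 ba].
  have xb := level_gt0 p lam0 (radA s * cos b).
  rewrite mulr_ge0 ?divr_ge0 ?(ltW (level'_gt0 lam0 p2 _)) ?(ltW q20)//.
  rewrite subr_ge0 ler_pdivrMr//.
  have sb : 0 < sin b.
    by apply: sin_gt0_pi; rewrite b0/=; apply: lt_trans ba (angA_ltpi nr).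
  rewrite -(@ler_pXn2r _ 2)// ?nnegrE ?mulr_ge0 ?(ltW l0) ?(ltW xb) ?(ltW q20) ?(ltW rs0) ?(ltW sb)//
    .
  have rb := rgt b (ltW b0) (ltW ba).
  have := orbit_log_bound lam0 p2 rb.
  have e1 : q2 ^+ 2 = 2 by rewrite sqr_sqrtr.
  have e2 : Num.sqrt lam ^+ 2 = lam by rewrite sqr_sqrtr// ltW.
  have -> : (q2 * (radA s * sin b)) ^+ 2 = q2 ^+ 2 * radA s ^+ 2 * sin b ^+ 2 by ring.
  rewrite (exprMn 2 (2 * _)) (exprMn 2 2) e1 e2 (radA_sqr nr) => h1; apply: le_trans h1 _.
  have h2 : rad ^+ 2 - s ^+ 2 <= lam * level (radA s * cos b) ^+ 2 / 2.
    rewrite radE amp_sqr// /gap opprB addrC subrK; apply: le_trans (pot_le lam p2 u0) _.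
    rewrite ler_pM2r ?invr_gt0// ler_pM2l// ler_pXn2r ?nnegrE ?(ltW u0) ?(ltW xb)//.
    have := cos_ge nr (ltW b0) (ltW ba);
      rewrite le_eqVlt => /predU1P[<-|/(level_lt lam0 p2 rs)/ltW].
      by rewrite ampK.
    by rewrite ampK.
  by rewrite -radE; lra.
rewrite /h k0 mulr0 add0r cos0 mulr1 radA_cos// /s ampK// lnu.
have lnX : ln ctr <= ln (level (radA s)).
  by rewrite ler_ln ?posrE ?level_gt0// -(level0 lam0 p2); apply/ltW/level_lt; rewrite // oppr_lt0.
rewrite -/s -/(tau s) => h1.
have h2 : 2 * Num.sqrt lam * `|l| <= 2 * Num.sqrt lam * tau s by lra.
by apply: le_trans (ler_norm l) _; move: h2; rewrite ler_pM2l// mulr_gt0.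
Qed.

Lemma tau_surj l : 0 < l -> exists2 s, `|s| < rad & tau s = l.
Proof.
move=> l0; have [s /andP[s0 sr] sl] := tau_small l0.
have [t /andP[rt t0] lt] := tau_large l.
have ts : t <= s by rewrite (le_trans _ s0)// ltW.
have cont : {within `[t, s], continuous tau}.
  apply/continuous_in_subspaceT => x /[!inE]/=; rewrite in_itv/= => /andP[tx xs].
  apply: tau_continuous; rewrite ltr_norml (lt_le_trans rt tx)/=.
  exact: le_lt_trans sr.
have mM : Num.min (tau t) (tau s) <= l <= Num.max (tau t) (tau s).
  by rewrite ge_min sl orbT/= le_max lt.
have [x /[!in_itv]/= /andP[tx xs] xl] := IVT ts cont mM.
exists x => //; rewrite ltr_norml (lt_le_trans rt tx)/=.
exact: le_lt_trans sr.
Qed.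

(* Time runs from [0] at [u = level s] to [tau s] at the maximum, which is the
   origin of angles and of the clock. *)
Definition rise s x := level (radA s * cos (inverse (clockA s) (tau s - x))).
Definition rise' s x := q2 * radA s * sin (inverse (clockA s) (tau s - x)).

Let angleAP s : `|s| < rad ->
  cancel (clockA s) (inverse (clockA s)) /\ cancel (inverse (clockA s)) (clockA s).
Proof.
move=> sr.
by have [ck ak _] := inverseP (densA_continuous sr) mA0 (fun b => densA_ge b sr).
Qed.

Let angleA_itv s x : `|s| < rad -> 0 <= x -> x <= tau s ->
  0 <= inverse (clockA s) x <= angA s.
Proof.
move=> sr x0 xt; have [ck ak] := angleAP sr; have [c0 _] := clockAP sr.
apply/andP; split; rewrite leNgt; apply/negP => /(clockA_lt sr).
  by rewrite ak c0 ltNge x0.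
by rewrite ak ltNge xt.
Qed.

Lemma is_derive_rise s x : `|s| < rad -> 0 <= x <= tau s ->
  is_derive x 1 (rise s) (rise' s x) /\ is_derive x 1 (rise' s) (- gap1 (rise s x)).
Proof.
move=> sr /andP[x0 xt]; have y0 : 0 <= tau s - x by rewrite subr_ge0.
have yt : tau s - x <= tau s by rewrite gerBl.
have /andP[b0 ba] := angleA_itv sr y0 yt.
have rb : - rad < radA s * cos (inverse (clockA s) (tau s - x)).
  apply: lt_le_trans (cos_ge sr b0 ba).
  by move: sr; rewrite ltr_norml => /andP[].
have [d1 d2] := @orbit_ode _ _ _ lam0 p2 (densA s) _ (radA s) (tau s - x) (densA_continuous sr)
  mA0 (fun b => densA_ge b sr) rb (densAE sr b0 ba).
have ds := is_derive_subf (is_derive_cstf x (tau s)) (is_derive_idf x).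
split.
  apply: is_derive_val (@is_derive_compf _ _ (fun y => tau s - y) x _ _ d1 ds) _.
  by rewrite sub0r mulrNN mulr1.
have := is_derive_oppf (@is_derive_compf _ _ (fun y => tau s - y) x _ _ d2 ds).
rewrite /rise'; under eq_fun do rewrite opprK; move=> d; apply: is_derive_val d _.
by rewrite sub0r mulrNN mulr1.
Qed.

Lemma rise_gt0 s x : 0 < rise s x.
Proof. exact: level_gt0. Qed.

Lemma rise0 s : `|s| < rad -> rise s 0 = level s.
Proof.
by move=> sr; have [ck _] := angleAP sr; rewrite /rise subr0 /tau ck radA_cos.
Qed.

Lemma rise'0 s : `|s| < rad -> rise' s 0 = 2 * Num.sqrt (2 * pot (level s)).
Proof.
move=> sr; have [ck _] := angleAP sr; rewrite /rise' subr0 /tau ck -mulrA radA_sin//.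
rewrite mulrCA -sqrtrM//; congr (2 * Num.sqrt (2 * _)).
have rs : - rad < s by move: sr; rewrite ltr_norml => /andP[].
have := amp_sqr lam0 p2 (level_gt0 p lam0 s); rewrite levelK// => ->.
by rewrite /gap opprB addrC subrK.
Qed.

Lemma rise'_tau s : `|s| < rad -> rise' s (tau s) = 0.
Proof.
move=> sr; have [ck _] := angleAP sr; have [c0 _] := clockAP sr.
by rewrite /rise' subrr -{1}c0 ck sin0 mulr0.
Qed.

Lemma rise'_gt0 s x : `|s| < rad -> 0 <= x -> x < tau s -> 0 < rise' s x.
Proof.
move=> sr x0 xt; have y0 : 0 < tau s - x by rewrite subr_gt0.
have yt : tau s - x <= tau s by rewrite gerBl.
have /andP[b0 ba] := angleA_itv sr (ltW y0) yt.
have [ck ak] := angleAP sr; have [c0 _] := clockAP sr.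
rewrite !mulr_gt0 ?radA0// sin_gt0_pi// (le_lt_trans ba) ?angA_ltpi// andbT.
rewrite lt_neqAle b0 andbT; apply/eqP => e.
by move: y0; rewrite -(ak (tau s - x)) -e c0 ltxx.
Qed.

End rising_orbit.

(** * One-sided derivatives *)

Section one_sided_derivatives.
Variable R : realType.
Implicit Types (I : set R) (f g : R -> R) (x y l : R).

Lemma is_derive_diff_quot f x l :
  is_derive x 1 f l <-> diff_quot f x y @[y --> x^'] --> l.
Proof.
pose h z := if z == x then l else diff_quot f x z.
have hx : h x = l by rewrite /h eqxx.
have hE : {near x^', h =1 diff_quot f x}.
  by near=> z; rewrite /h ifN//; near: z; exact: nbhs_dnbhs_neq.
split.
  move=> /is_derive1_caratheodory[g [fg cg gx]].
  have /continuous_withinNx : {for x, continuous g} := cg.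
  rewrite gx; apply: cvg_trans; apply: near_eq_cvg.
  near=> z; rewrite /diff_quot fg mulfK// subr_eq0.
  by near: z; exact: nbhs_dnbhs_neq.
move=> dq; apply/is_derive1_caratheodory; exists h; split=> //.
  move=> z; rewrite /h /diff_quot; case: eqVneq => [->|zx]; first by rewrite !subrr mulr0.
  by rewrite divfK// subr_eq0.
apply/continuous_withinNx; rewrite hx; apply: cvg_trans dq; apply: near_eq_cvg.
by near=> z; apply/esym; near: z; exact: hE.
Unshelve. all: by end_near. Qed.

Lemma derivable_in_is_derive I f x : nbhs x I -> derivable_in I f x ->
  is_derive x 1 f (derive_in I f x).
Proof.
move=> xI df; apply/is_derive_diff_quot.
apply: cvg_trans df => P /= PI.
have xI' : x^' I by exact: nbhs_dnbhs.
rewrite /nbhs/= in PI *; move: PI; rewrite /fmap/= /within/= => PI.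
by apply: filterS2 xI' PI => y Iy; exact.
Qed.

Lemma derivable_in_continuous I f x : derivable_in I f x ->
  f @ within I (nbhs x) --> f x.
Proof.
move=> df.
have dI : (fun y => y - x) @ within I x^' --> x - x.
  apply: cvgB; last exact: cvg_cst.
  move=> P Px; have Px' : x^' P by exact: nbhs_dnbhs.
  by rewrite /nbhs/= /fmap/= /within/=; apply: filterS Px' => y.
have prod : (fun y => diff_quot f x y * (y - x)) @ within I x^' --> (0 : R).
  by rewrite -(mulr0 (derive_in I f x)) -(subrr x); exact: cvgM.
apply/cvgrPdist_lt => e e0.
have /cvgrPdist_lt/(_ e e0) H := prod; rewrite near_withinE.
have {}H : \forall y \near x, y != x -> I y -> `|0 - diff_quot f x y * (y - x)| < e by [].
apply: filterS H => y H Iy.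
have [->|yx] := eqVneq y x; first by rewrite subrr normr0.
have := H yx Iy; rewrite sub0r normrN /diff_quot divfK ?subr_eq0//.
by rewrite distrC.
Qed.

(* Every point of [I] is a limit point of [I], so that one-sided limits at it
   are unique. *)
Definition no_isolated_point I := forall x, I x -> ProperFilter (within I x^').

Lemma derive_in_eq I f g l x : no_isolated_point I -> I x ->
  (forall y, I y -> f y = g y) -> is_derive x 1 g l ->
  derivable_in I f x /\ derive_in I f x = l.
Proof.
move=> nI Ix fg /is_derive_diff_quot gl.
have fl : diff_quot f x y @[y --> within I x^'] --> l.
  have : diff_quot g x y @[y --> within I x^'] --> l.
    apply: cvg_trans gl => P /= PI.
    by move: PI; rewrite /nbhs/= /fmap/= /within/= => PI; apply: filterS PI => y.
  apply: cvg_trans; apply: near_eq_cvg; rewrite near_withinE.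
  by apply: nearW => y Iy; rewrite /diff_quot !fg.
split; first by apply/cvg_ex; exists l.
by have := nI x Ix; move=> ?; exact: cvg_lim.
Qed.

Lemma no_isolated_pointP I :
  (forall x e, I x -> 0 < e -> exists2 y, I y & 0 < `|y - x| < e) -> no_isolated_point I.
Proof.
move=> H x Ix; apply: Build_ProperFilter => -[e /= e0 eP].
have [y Iy /andP[yx0 yxe]] := H x e Ix e0.
apply: (eP y) => //; first by rewrite /ball_ /= distrC.
by move: yx0; rewrite normr_gt0 subr_eq0.
Qed.

End one_sided_derivatives.

(** * Solutions on a segment and Cauchy uniqueness *)

Section ode.
Variables (R : realType) (lam p : R).
Hypotheses (lam0 : 0 < lam) (p2 : 2 < p).
Implicit Types (f g u v : R -> R) (a b c x y z : R).

Local Notation ctr := (ctr lam p).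
Local Notation pot := (pot lam p).
Local Notation gap1 := (gap1 lam p).
Local Notation gap2 := (gap2 lam p).
Local Notation gap3 := (gap3 p).

(** The equation is asked inside only, with [g] as derivative and continuity up to the ends:
    one-sided derivatives at the vertices are absorbed in this continuity. *)
Definition sol a b f g :=
  [/\ {within `[a, b], continuous f}, {within `[a, b], continuous g},
      forall x, a < x < b -> is_derive x 1 f (g x) /\ is_derive x 1 g (- gap1 (f x)) &
      forall x, a <= x <= b -> 0 < f x].

Lemma sol_sub a b c d f g : a <= c -> d <= b -> sol a b f g -> sol c d f g.
Proof.
move=> ac db [cf cg fg f0].
have sub : `[c, d] `<=` `[a, b].
  move=> x /=; rewrite !in_itv/= => /andP[cx xd].
  by rewrite (le_trans ac cx) (le_trans xd db).
split; [exact: continuous_subspaceW cf|exact: continuous_subspaceW cg| |].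
- by move=> x /andP[cx xd]; apply: fg; rewrite (le_lt_trans ac cx) (lt_le_trans xd db).
- by move=> x /andP[cx xd]; apply: f0; rewrite (le_trans ac cx) (le_trans xd db).
Qed.

Lemma is_derive_sol a b f g :
  (forall x, a <= x <= b -> is_derive x 1 f (g x) /\ is_derive x 1 g (- gap1 (f x))) ->
  (forall x, a <= x <= b -> 0 < f x) -> sol a b f g.
Proof.
move=> fg f0; split=> //.
- by apply: (derive_within (df := g)) => x /fg[].
- by apply: (derive_within (df := fun x => - gap1 (f x))) => x /fg[].
- by move=> x /andP[/ltW ax /ltW xb]; apply: fg; rewrite ax.
Qed.

Lemma solves_sol I f a b : (forall x, I x -> 0 < f x) -> solves lam p I f ->
  (forall x, a <= x <= b -> I x) -> sol a b f (derive_in I f).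
Proof.
move=> f0 If abI; split.
- apply/subspace_continuousP => x /=; rewrite in_itv/= => /abI Ix.
  have [df _] := If x Ix.
  have := derivable_in_continuous df; apply: cvg_trans; apply: cvg_app.
  by apply: within_subset => y /=; rewrite in_itv/=; exact: abI.
- apply/subspace_continuousP => x /=; rewrite in_itv/= => /abI Ix.
  have [_ [df _]] := If x Ix.
  have := derivable_in_continuous df; apply: cvg_trans; apply: cvg_app.
  by apply: within_subset => y /=; rewrite in_itv/=; exact: abI.
- move=> x xab; have /andP[ax xb] := xab.
  have Ix : I x by apply: abI; rewrite !ltW.
  have nI : nbhs x I.
    have : nbhs x `]a, b[%classic by apply: near_in_itvoo; rewrite in_itv/= ax.
    by apply: filterS => y /=; rewrite in_itv/= => /andP[? ?]; apply: abI; rewrite !ltW.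
  have [df [ddf eq]] := If x Ix; split; first exact: derivable_in_is_derive.
  apply: is_derive_val (derivable_in_is_derive nI ddf) _.
  move: eq; rewrite (gtr0_norm (f0 _ Ix)) /gap1 /pw.
  by set d := derive_in I _ x; set w := _ `^ _; set h := f x => e; lra.
- by move=> x /abI/f0.
Qed.

Lemma sol_solves I f u v : no_isolated_point I ->
  (forall x, I x -> is_derive x 1 u (v x) /\ is_derive x 1 v (- gap1 (u x))) ->
  (forall x, I x -> f x = u x) -> (forall x, I x -> 0 < u x) ->
  solves lam p I f /\ (forall x, I x -> derive_in I f x = v x).
Proof.
move=> nI uv fu u0.
have df x : I x -> derivable_in I f x /\ derive_in I f x = v x.
  by move=> Ix; apply: (derive_in_eq nI Ix fu); have [] := uv x Ix.
split; last by move=> x /df[].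
move=> x Ix; have [dfx fx] := df x Ix.
have [ddf ->] := derive_in_eq nI Ix (fun y Iy => (df y Iy).2) (uv x Ix).2.
split=> //; split=> //; rewrite fu// gtr0_norm ?u0//.
by rewrite /gap1 /pw; ring.
Qed.

(* Gronwall's inequality for the sum of the squares of the differences. *)
Lemma sol_unique a b f g u v : a <= b -> sol a b f g -> sol a b u v ->
  f a = u a -> g a = v a -> forall x, a <= x <= b -> f x = u x /\ g x = v x.
Proof.
move=> ab [cf cg fg f0] [cu cv uv u0] fua gva.
have [m1 _ f_m1] := EVT_max ab cf; have [m2 _ u_m2] := EVT_max ab cu.
pose M := Num.max (f m1) (u m2).
have f_le x : a <= x <= b -> f x <= M.
  by move=> xab; rewrite /M le_max f_m1// in_itv.
have u_le x : a <= x <= b -> u x <= M.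
  by move=> xab; rewrite /M le_max u_m2 ?orbT// in_itv.
have M0 : 0 < M by apply: lt_le_trans (f_le a _); rewrite ?f0 ?lexx.
pose K := (p - 1) * pw p M + lam.
have p10 : 0 < p - 1 by have := p2; lra.
have K0 : 0 < K by rewrite /K addr_gt0// mulr_gt0// pw_gt0.
have gap2K y : 0 < y -> y <= M -> `|gap2 y| <= K.
  move=> y0 yM; rewrite /gap2; apply: le_trans (ler_normB _ _) _.
  rewrite (gtr0_norm lam0) lerD2r gtr0_norm ?mulr_gt0 ?pw_gt0// ler_pM2l//.
  by move: yM; rewrite le_eqVlt => /predU1P[->//|/(pw_lt p2 y0)/ltW].
have lip y z : 0 < y <= M -> 0 < z <= M -> `|gap1 y - gap1 z| <= K * `|y - z|.
  wlog yz : y z / y <= z.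
    move=> H yM zM; have [/H|/ltW/H] := leP y z; first exact.
    by rewrite distrC (distrC y); exact.
  move=> /andP[y0 yM] /andP[z0 zM].
  have dF x : x \in `]y, z[ -> is_derive x 1 gap1 (gap2 x).
    by rewrite in_itv/= => /andP[yx _]; apply: is_derive_gap1; exact: lt_trans yx.
  have cF : {within `[y, z], continuous gap1}.
    apply: (derive_within (df := gap2)) => x /andP[yx _].
    by apply: is_derive_gap1; exact: lt_le_trans yx.
  have [c] := MVT_segment yz dF cF; rewrite in_itv/= => /andP[yc cz] e.
  rewrite distrC e normrM (distrC y); apply: ler_wpM2r => //.
  by apply: gap2K; [exact: lt_le_trans yc|exact: le_trans zM].
pose N x := (f x - u x) ^+ 2 + (g x - v x) ^+ 2.
(* [K] is a Lipschitz constant of [gap1] on []0, M]], so the derivative of [N] is at most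
   [(1 + K) * N], whence the exponent. The sign makes [H] nondecreasing. *)
pose H x := - (N x * expR (- (1 + K) * x)).
pose dH x := expR (- (1 + K) * x) *
  ((1 + K) * N x - (2 * (f x - u x) * (g x - v x) - 2 * (g x - v x) * (gap1 (f x) - gap1 (u x)))).
have dHx x : a < x < b -> is_derive x 1 H (dH x).
  move=> xab; have [d1 d2] := fg x xab; have [d3 d4] := uv x xab.
  have de := is_derive_mulf (is_derive_cstf x (- (1 + K))) (is_derive_idf x).
  have dexp := @is_derive_compf _ (@expR R) (fun x => - (1 + K) * x) x _ _ (is_derive_expR _) de.
  have dN := is_derive_addf (is_derive_expf 2 (is_derive_subf d1 d3))
    (is_derive_expf 2 (is_derive_subf d2 d4)).
  apply: is_derive_val (is_derive_oppf (is_derive_mulf dN dexp)) _.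
  by rewrite /dH /N /=; ring.
have cN : {within `[a, b], continuous H}.
  apply/subspace_continuousP => x xab; apply: cvgN; apply: cvgM.
    apply: cvgD.
      apply: (@continuous2_cvg _ _ _ _ _ _ f u (fun s t : R => (s - t) ^+ 2) (f x) (u x)).
      - apply: (@cvg_comp _ _ _ (fun z : R * R => z.1 - z.2) (fun t : R => t ^+ 2));
        last exact: exprn_continuous.
        by apply: cvgB; [exact: cvg_fst|exact: cvg_snd].
      - by move/subspace_continuousP : cf; exact.
      - by move/subspace_continuousP : cu; exact.
    apply: (@continuous2_cvg _ _ _ _ _ _ g v (fun s t : R => (s - t) ^+ 2) (g x) (v x)).
    - apply: (@cvg_comp _ _ _ (fun z : R * R => z.1 - z.2) (fun t : R => t ^+ 2));
      last exact: exprn_continuous.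
      by apply: cvgB; [exact: cvg_fst|exact: cvg_snd].
    - by move/subspace_continuousP : cg; exact.
    - by move/subspace_continuousP : cv; exact.
  apply: cvg_within_filter; apply: (@cvg_comp _ _ _ (fun x => - (1 + K) * x) (@expR R));
    last exact: continuous_expR.
  by apply: cvgM; [exact: cvg_cst|exact: cvg_id].
have dH0 x : a < x < b -> 0 <= dH x.
  move=> /andP[ax xb]; rewrite mulr_ge0 ?expR_ge0// subr_ge0 /N.
  have xab : a <= x <= b by rewrite !ltW.
  have := lip (f x) (u x); rewrite f0// f_le// u0// u_le// => /(_ isT isT).
  set s := f x - u x; set t := g x - v x; set w := gap1 _ - gap1 _.
  move=> wK.
  have h1 : 2 * s * t <= s ^+ 2 + t ^+ 2 by have := sqr_ge0 (s - t); lra.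
  have h2 : - (2 * t * w) <= K * (s ^+ 2 + t ^+ 2).
    apply: le_trans (ler_norm _) _;
      rewrite normrN !normrM normr_nat -!(real_normK (num_real s)) -!(real_normK (num_real t)).
    have ns := normr_ge0 s; have nt := normr_ge0 t.
    apply: (@le_trans _ _ (2 * `|t| * (K * `|s|))); first by rewrite ler_wpM2l// mulr_ge0.
    have -> : 2 * `|t| * (K * `|s|) = K * (2 * `|t| * `|s|) by ring.
    by rewrite ler_pM2l//; have := sqr_ge0 (`|s| - `|t|); lra.
  by lra.
have N0 x : a <= x <= b -> N x = 0.
  move=> /andP[ax xb]; have sub : `[a, x] `<=` `[a, b].
    by move=> y /=; rewrite !in_itv/= => /andP[-> /le_trans]; exact.
  have := @derive_ge0_le _ H dH a x ax.
  have h1 y : a < y < x -> is_derive y 1 H (dH y).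
    by move=> /andP[ay yx]; apply: dHx; rewrite ay (lt_le_trans yx).
  have h2 y : a < y < x -> 0 <= dH y.
    by move=> /andP[ay yx]; apply: dH0; rewrite ay (lt_le_trans yx).
  move=> /(_ h1 (continuous_subspaceW sub cN) h2).
  rewrite /H /N fua gva !subrr expr0n/= addr0 mul0r oppr0 oppr_ge0 pmulr_lle0 ?expR_gt0// => le0.
  by apply/eqP; rewrite eq_le le0 addr_ge0 ?sqr_ge0.
move=> x /N0; rewrite /N => /eqP; rewrite paddr_eq0 ?sqr_ge0// !sqrf_eq0 !subr_eq0.
by move=> /andP[/eqP -> /eqP ->].
Qed.

End ode.

(** * Energy and monotonicity in the phase plane *)

Section phase_plane.
Variables (R : realType) (lam p : R).
Hypotheses (lam0 : 0 < lam) (p2 : 2 < p).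
Implicit Types (f g u v : R -> R) (a b c x y z : R).

Local Notation ctr := (ctr lam p).
Local Notation pot := (pot lam p).
Local Notation gap1 := (gap1 lam p).
Local Notation sol := (sol lam p).

Lemma sol_energy a b f g x : sol a b f g -> a <= x <= b ->
  g x ^+ 2 - 2 * pot (f x) = g a ^+ 2 - 2 * pot (f a).
Proof.
move=> fgab /andP[ax xb]; have [cf cg fg f0] := sol_sub (lexx a) xb fgab.
pose N x := g x ^+ 2 - 2 * pot (f x).
have dN y : y \in `]a, x[ -> is_derive y 1 N 0.
  rewrite in_itv/= => ayx; have [d1 d2] := fg y ayx.
  have f0y : 0 < f y by apply: f0; case/andP: ayx => ? ?; rewrite !ltW.
  have d3 := @is_derive_compf _ pot f y _ _ (is_derive_pot lam p2 f0y) d1.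
  apply: is_derive_val (is_derive_subf (is_derive_expf 2 d2)
    (is_derive_mulf (is_derive_cstf y 2) d3)) _.
  by rewrite /=; ring.
have cN : {within `[a, x], continuous N}.
  apply/subspace_continuousP => y xab; apply: cvgB.
    apply: (@cvg_comp _ _ _ g (fun t : R => t ^+ 2)); last exact: exprn_continuous.
    by move/subspace_continuousP : cg; exact.
  apply: cvgM; first exact: cvg_cst.
  apply: (@cvg_comp _ _ _ f pot _ (nbhs (f y))).
    by move/subspace_continuousP : cf; exact.
  have f0y : 0 < f y by apply: f0; move: xab; rewrite /= in_itv.
  have cp : {for f y, continuous pot} := is_derive_continuous (is_derive_pot lam p2 f0y).
  exact: cp.
have [c _] := MVT_segment ax dN cN.
by rewrite mul0r => /eqP; rewrite subr_eq0 => /eqP.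
Qed.

Lemma sol_rev a b f g : sol a b f g ->
  sol (- b) (- a) (fun x => f (- x)) (fun x => - g (- x)).
Proof.
move=> [cf cg fg f0].
have oppE x : - b <= x <= - a -> a <= - x <= b.
  by move=> /andP[bx xa]; rewrite lerNr xa lerNl.
have oppE' x : - b < x < - a -> a < - x < b.
  by move=> /andP[bx xa]; rewrite ltrNr xa ltrNl.
have opp x : -%R @ within `[- b, - a] (nbhs x) --> within `[a, b] (nbhs (- x)).
  move=> P Px; have oc : {for x, continuous (-%R : R -> R)}.
    exact: is_derive_continuous (is_derive_oppf (is_derive_idf x)).
  have Q : nbhs x (fun y => `[a, b]%classic (- y) -> P (- y)) := oc _ Px.
  change (nbhs x (fun y => `[- b, - a]%classic y -> P (- y))).
  apply: filterS Q => y Py yab; apply: Py.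
  by move: yab; rewrite /= !in_itv/=; exact: oppE.
split.
- apply/subspace_continuousP => x /=; rewrite in_itv/= => /oppE xab.
  by apply: (cvg_comp _ f (opp x)); move/subspace_continuousP : cf; apply; rewrite /= in_itv.
- apply/subspace_continuousP => x /=; rewrite in_itv/= => /oppE xab; apply: cvgN.
  by apply: (cvg_comp _ g (opp x)); move/subspace_continuousP : cg; apply; rewrite /= in_itv.
- move=> x /oppE' /fg[d1 d2].
  have dopp := is_derive_oppf (is_derive_idf x).
  split.
    by apply: is_derive_val (@is_derive_compf _ f -%R x _ _ d1 dopp) _; ring.
  apply: is_derive_val (is_derive_oppf (@is_derive_compf _ g -%R x _ _ d2 dopp)) _; ring.
- by move=> x /oppE/f0.
Qed.

(** If [g] vanished at some [y], let [m] minimize [f] on [[a, y]]. Then [f m <= f a], so [g m] is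
    not 0 and [m] is neither interior nor [y]; nor is it [a], just after which [f] decreases. *)
Lemma sol_descent a b f g : sol a b f g -> g a < 0 ->
  (forall x, a <= x <= b -> f x <= f a -> g x != 0) ->
  forall x, a <= x <= b -> g x < 0 /\ f x <= f a.
Proof.
move=> fgab ga0 gne.
suff neg z : a <= z <= b -> g z < 0.
  move=> x xab; split; first exact: neg.
  have /andP[ax xb] := xab; have [cf cg fg f0] := sol_sub (lexx a) xb fgab.
  rewrite -lerN2; apply: (derive_ge0_le ax (f := fun x => - f x) (df := fun x => - g x)).
  - by move=> y /fg[d1 _]; exact: is_derive_oppf.
  - by move=> y; apply: cvgN; exact: cf.
  - move=> y /andP[ay yx]; rewrite oppr_ge0 ltW// neg// (ltW ay)/=.
    by rewrite ltW// (lt_le_trans yx).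
move=> zab; rewrite ltNge; apply/negP => gz0; have /andP[az zb] := zab.
have {}az : a < z by rewrite lt_neqAle az andbT; apply/eqP => e; move: gz0; rewrite -e leNgt ga0.
have [cf cg fg f0] := sol_sub (lexx a) zb fgab.
have mM : Num.min (g a) (g z) <= 0 <= Num.max (g a) (g z).
  by rewrite ge_min (ltW ga0)/= le_max gz0 orbT.
have [y /[!in_itv]/= /andP[ay yz] gy0] := IVT (ltW az) cg mM.
have {}ay : a < y by rewrite lt_neqAle ay andbT; apply/eqP => e; move: ga0; rewrite e gy0 ltxx.
have {cf cg fg f0}[cf cg fg f0] := sol_sub (lexx a) (le_trans yz zb) fgab.
have [m /[!in_itv]/= mam mmin] := EVT_min (ltW ay) cf.
have fma : f m <= f a by apply: mmin; rewrite in_itv/= lexx ltW.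
have mab : a <= m <= b.
  by case/andP: mam => -> my; rewrite (le_trans my)// (le_trans yz zb).
have gm := gne m mab fma.
have /andP[am my] := mam.
have {}my : m < y by rewrite lt_neqAle my andbT; apply: contraNneq gm => ->; apply/eqP.
have [ma|{}am] := leP m a; last first.
  have am' : m \in `]a, y[ by rewrite in_itv/= am.
  have dgm : is_derive m 1 f 0.
    apply: (@derive1_at_min R f a y m (ltW ay)) => //.
    - by move=> t /[!in_itv]/= /fg[[]].
    - by move=> t /[!in_itv]/= /andP[ta ty]; apply: mmin; rewrite in_itv/= !ltW.
  have [[_ e1] _] := fg m (introT andP (conj am my)).
  by case: dgm => _ e2; move: gm; rewrite -e1 e2 eqxx.
have {am my}ma : m = a by apply/eqP; rewrite eq_le ma am.
have near_a : \forall x \near a, a <= x <= y -> g x < 0.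
  have /subspace_continuousP/(_ a) := cg; rewrite /= in_itv/= lexx (ltW ay) => /(_ isT).
  move/cvgr_lt => /(_ _ ga0); rewrite near_withinE.
  by apply: filterS => x; rewrite /= in_itv.
have [e /= e0 eP] := near_a.
pose d := a + Num.min (e / 2) (y - a).
have ad : a < d by rewrite ltrDl lt_min divr_gt0//= subr_gt0.
have dy : d <= y by rewrite -lerBrDl ge_min lexx orbT.
have de : d - a < e.
  by rewrite addrC addKr gt_min ltr_pdivrMr// ltr_pMr// ltr1n.
have [cf' cg' fg' f0'] := sol_sub (lexx a) (le_trans dy (le_trans yz zb)) fgab.
have : - f a < - f d.
  apply: (derive_gt0_lt ad (f := fun x => - f x) (df := fun x => - g x)).
  - by move=> t /fg'[d1 _]; exact: is_derive_oppf.
  - by move=> t; apply: cvgN; exact: cf'.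
  - move=> t /andP[at0 td]; rewrite oppr_gt0; apply: eP;
    last by rewrite (ltW at0) ltW// (lt_le_trans td).
    by rewrite /ball_/= distrC gtr0_norm ?subr_gt0//; lra.
rewrite ltrN2 ltNge -ma mmin//; by rewrite in_itv/= (ltW ad).
Qed.

(** The quotient [pot u / u ^ 2 = lam / 2 - pw u / p] decreases. *)
Lemma pot_gt0_below (u0 v0 : R) : 0 < v0 -> v0 < u0 -> 0 <= pot u0 -> 0 < pot v0.
Proof.
move=> v00 vu pu; have u00 := lt_trans v00 vu.
have potE w : pot w = w ^+ 2 * (lam / 2 - pw p w / p) by rewrite /pot; ring.
have p0 : 0 < p by have := p2; lra.
move: pu; rewrite !potE pmulr_rge0 ?exprn_gt0// => pu; rewrite mulr_gt0 ?exprn_gt0//.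
apply: le_lt_trans pu _; rewrite ltrD2l ltrN2 ltr_pM2r ?invr_gt0//.
exact: pw_lt.
Qed.

Lemma pot_decr (u0 v0 : R) : ctr <= u0 -> u0 < v0 -> pot v0 < pot u0.
Proof.
move=> cu uv; have c0 := ctr_gt0 p lam0.
apply: (derive_lt0_gt_cc uv (df := fun x => - gap1 x)) => x /andP[ux xv].
  by apply: is_derive_pot => //; apply: lt_le_trans ux; exact: lt_le_trans cu.
by rewrite oppr_lt0 gap1_gt0//; exact: le_lt_trans ux.
Qed.

(* On a half-line only the zero energy is compatible with positivity and with
   square integrability, which enters through [small]. *)
Lemma half_line_energy f g : (forall b, 0 < b -> sol 0 b f g) ->
  (forall c x, 0 < c -> 0 <= x -> exists2 y, x <= y & f y < c) ->
  forall x, 0 <= x -> g x ^+ 2 = 2 * pot (f x).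
Proof.
move=> fg small.
pose e := g 0 ^+ 2 - 2 * pot (f 0).
have energy x : 0 <= x -> g x ^+ 2 = 2 * pot (f x) + e.
  move=> x0; have x1 : 0 < x + 1 by lra.
  have x01 : 0 <= x <= x + 1 by rewrite x0/= lerDl ler01.
  by have := sol_energy (fg _ x1) x01; rewrite -/e => <-; ring.
have fpos x : 0 <= x -> 0 < f x.
  move=> x0; have x1 : 0 < x + 1 by lra.
  by have [_ _ _] := fg _ x1; apply; rewrite x0/= lerDl ler01.
suff e0 : e = 0 by move=> x x0; rewrite energy// e0 addr0.
have c0 := ctr_gt0 p lam0.
(* Negative energy: [g ^ 2 <= lam * f ^ 2 + e] fails as soon as [f < sqrt (- e / lam)]. *)
have [e0|e0|//] := ltgtP e 0.
  have l0 : 0 < - e / lam by rewrite divr_gt0// oppr_gt0.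
  have [|x x0] := small (Num.sqrt (- e / lam)) 0 _ (lexx 0); first by rewrite sqrtr_gt0.
  rewrite -(@ltr_pXn2r _ 2)// ?nnegrE ?sqrtr_ge0 ?(ltW (fpos x x0))//.
  rewrite sqr_sqrtr ?(ltW l0)// ltr_pdivlMr// => fx.
  have := pot_le lam p2 (fpos x x0); have := energy x x0; have := sqr_ge0 (g x).
  by move: (pot (f x)) (g x ^+ 2) (f x ^+ 2) fx => ? ? ? ?; lra.
have gne x : 0 <= x -> f x <= ctr -> e < g x ^+ 2.
  move=> x0 fx; rewrite energy// ltrDr mulr_gt0//.
  exact: pot_gt0 (fpos x x0) fx.
have gn0 x : 0 <= x -> f x <= ctr -> g x != 0.
  by move=> x0 /(gne x x0) /(lt_trans e0); rewrite lt_def sqrf_eq0 => /andP[].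
(* Positive energy: below [ctr] the slope exceeds [sqrt e] in modulus, so a descending solution
   would reach 0 by the time [b], at distance [f x / sqrt e]. *)
have down x : 0 <= x -> f x <= ctr -> ~ g x < 0.
  move=> x0 fx gx.
  have se0 : 0 < Num.sqrt e by rewrite sqrtr_gt0.
  pose b := x + f x / Num.sqrt e.
  have xb : x < b by rewrite ltrDl divr_gt0// fpos.
  have solxb : sol x b f g by apply: sol_sub (fg b (le_lt_trans x0 xb)).
  have desc y : x <= y <= b -> g y < 0 /\ f y <= f x.
    apply: (sol_descent solxb gx) => z /andP[xz _] fz.
    by apply: gn0; [exact: le_trans xz|exact: le_trans fx].
  have [cf cg dfg fp] := solxb.
  have : (- f x) + Num.sqrt e * (b - x) <= - f b.
    have := @derive_ge0_le _ (fun y => - f y - Num.sqrt e * y)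
      (fun y => - g y - (0 * y + Num.sqrt e * 1)) x b (ltW xb).
    have d1 y : x < y < b -> is_derive y 1 (fun y => - f y - Num.sqrt e * y)
       (- g y - (0 * y + Num.sqrt e * 1)).
      move=> /dfg[dfy _]; apply: is_derive_subf (is_derive_oppf dfy) _.
      exact: is_derive_mulf (is_derive_cstf y _) (is_derive_idf y).
    have d2 : {within `[x, b], continuous (fun y => - f y - Num.sqrt e * y)}.
      move=> y; apply: cvgB; first by apply: cvgN; exact: cf.
      apply: continuous_subspaceT => {}y.
      by apply: cvgM; [exact: cvg_cst|exact: cvg_id].
    have d3 y : x < y < b -> 0 <= - g y - (0 * y + Num.sqrt e * 1).
      move=> /andP[xy yb]; have y0 : 0 <= y by rewrite ltW// (le_lt_trans x0).
      have xyb : x <= y <= b by rewrite !ltW.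
      have [gy fy] := desc y xyb.
      have ge := gne y y0 (le_trans fy fx).
      rewrite mul0r add0r mulr1 subr_ge0 -(@ler_pXn2r _ 2)// ?nnegrE ?(ltW se0) ?oppr_ge0 ?(ltW gy)//
        .
      by rewrite sqrrN sqr_sqrtr ?ltW.
    by move=> /(_ d1 d2 d3); lra.
  have -> : Num.sqrt e * (b - x) = f x.
    by rewrite /b addrAC subrr add0r mulrC divfK// gt_eqF.
  by rewrite addNr oppr_ge0 leNgt fp// (ltW xb) lexx.
(* Below [ctr] the solution can thus only rise. Yet [x2] comes after [x1] with a lower value; run
   backwards from [x2], the solution descends as far as [x1], which gives [f x1 <= f x2]. *)
have [x1 x10 f1] := small ctr 0 c0 (lexx 0).
have [x2 x12 f2] := small (f x1) x1 (fpos x1 x10) x10.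
have x20 := le_trans x10 x12; have f2c := lt_trans f2 f1.
have x12' : x1 < x2 by rewrite lt_neqAle x12 andbT; apply: contraTneq f2 => ->; rewrite ltxx.
have g2 : 0 < g x2.
  rewrite lt_def (gn0 _ x20 (ltW f2c))/= leNgt; apply/negP; exact: down x20 (ltW f2c).
have rsol := sol_rev (sol_sub x10 (lexx x2) (fg x2 (le_lt_trans x10 x12'))).
have ng2 : - g (- - x2) < 0 by rewrite opprK oppr_lt0.
have [y /andP[y1 y2]||_] := sol_descent rsol ng2 _ (x := - x1).
- rewrite opprK => fy; rewrite oppr_eq0; apply: gn0; first by rewrite lerNr (le_trans y2)// lerN2.
  by rewrite (le_trans fy)// ltW.
- by rewrite lerN2 x12 lexx.
by rewrite !opprK leNgt f2.
Qed.

End phase_plane.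

(** * Square integrability and weak derivatives *)

Section sobolev.
Variable R : realType.
Implicit Types (I : set R) (f g u v : R -> R) (a b c x y : R).
Local Notation mu := (@lebesgue_measure R).

Lemma L2_intro I f : measurable I -> measurable_fun I f ->
  (\int[mu]_(x in I) (f x ^+ 2)%:E < +oo)%E -> L2 I f.
Proof.
move=> mI mf fI; have mfI : measurable_fun setT (f \_ I).
  by apply/(measurable_restrict f mI measurableT); rewrite setTI.
rewrite /L2 inE/=; apply/andP; split; first by rewrite inE.
rewrite inE/= /finite_norm unlock /Lnorm/=; apply: poweR_lty.
suff -> : (\int[mu]_x `|(f \_ I x)%:E| `^ 2 = \int[mu]_(x in I) (f x ^+ 2)%:E)%E by [].
rewrite [RHS]integral_mkcond; apply: eq_integral => x _.
rewrite /patch; case: ifPn => _ /=.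
  by rewrite powR_mulrn// real_normK// num_real.
by rewrite normr0 powR0// pnatr_eq0.
Qed.

(** Otherwise [f ^ 2 >= c ^ 2] on [[x, x + N]], which contributes [c ^ 2 * N = A + c ^ 2] to an
    integral of value [A]. *)
Lemma L2_small I f c x : L2 I f -> (forall y, x <= y -> I y) -> 0 < c ->
  exists2 y, x <= y & f y < c.
Proof.
move=> fL2 xI c0; apply: contrapT => H.
have fc y : x <= y -> c <= f y.
  by move=> xy; rewrite leNgt; apply/negP => fy; apply: H; exists y.
pose h y := (f \_ I) y ^+ 2.
have /integrableP[mf fin] : mu.-integrable setT (EFin \o h) := Lfun2_integrable_sqr fL2.
set A := integral _ _ _ in fin.
have A0 : (0 <= A)%E by apply: integral_ge0.
have Afin : A \is a fin_num by rewrite ge0_fin_numE.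
pose N := fine A / c ^+ 2 + 1.
have c2 : 0 < c ^+ 2 by rewrite exprn_gt0.
have N0 : 0 < N by rewrite ltr_wpDl// divr_ge0 ?fine_ge0// ltW.
have : ((c ^+ 2)%:E * mu `[x, (x + N)%R] <= A)%E.
  rewrite -integral_cst//; apply: (@le_trans _ _
    (\int[mu]_(y in `[x, (x + N)%R]) `|(EFin \o h) y|))%E.
    apply: ge0_le_integral => //.
    - by move=> y _; rewrite lee_fin ltW.
    - by apply: measurableT_comp => //; exact: measurable_funTS.
    - move=> y /=; rewrite in_itv/= => /andP[xy _].
      have y0 : y \in I by rewrite inE; exact: xI.
      by rewrite /h /patch y0 lee_fin ger0_norm ?sqr_ge0// ler_pXn2r ?nnegrE ?(ltW c0)// ?fc//
        (le_trans (ltW c0))// fc.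
  apply: ge0_subset_integral => //.
  by apply: measurableT_comp.
rewrite lebesgue_measure_itv/= lte_fin ltrDl N0 -EFinB -EFinM -(fineK Afin) lee_fin.
rewrite addrAC subrr add0r /N mulrDr mulr1 mulrC divfK ?gt_eqF//.
by rewrite gerDl leNgt c2.
Qed.

Lemma test_function_vanish I phi : test_function I phi ->
  (forall x, derivable phi x 1) /\ continuous (derive1 phi) /\
  exists M, 0 < M /\ (forall x, ~ interior I x -> phi x = 0) /\
    (forall x, M <= `|x| -> phi x = 0 /\ derive1 phi x = 0).
Proof.
move=> [smooth [K [cK [KI phiK]]]].
have d0 x : derivable phi x 1 by exact: (smooth 0%N x).
split; first exact: d0.
split.
  move=> x; apply/differentiable_continuous; rewrite -derivable1_diffP.
  exact: (smooth 1%N x).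
have [M [Mreal MP]] := compact_bounded cK.
pose B := `|M| + 1.
have KB x : K x -> `|x| <= B.
  by move=> Kx; apply: (MP B _ x Kx); rewrite /B (le_lt_trans (ler_norm M))// ltrDl.
have B0 : 0 < B by rewrite ltr_wpDl.
(* The margin 1 leaves a whole neighbourhood on which [phi] vanishes, so that its derivative
   vanishes as well. *)
exists (B + 1); split; first by rewrite addr_gt0.
split; first by move=> x nI; apply: phiK => /KI.
have out x : B < `|x| -> phi x = 0.
  by move=> Bx; apply: phiK => /KB; rewrite leNgt Bx.
move=> x Bx; have Bx' : B < `|x| by rewrite (lt_le_trans _ Bx)// ltrDl.
split; first exact: out.
rewrite derive1E -(derive_cst (0 : R) x 1); apply: near_eq_derive.
have : \forall y \near x, B < `|y|.
  by apply: (@cvgr_gt _ _ (nbhs x) _ Num.norm `|x|) => //; exact: norm_continuous.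
by apply: filterS => y /out.
Qed.

Lemma derivable_oo u v a b : a < b -> (forall x, a <= x <= b -> is_derive x 1 u (v x)) ->
  derivable_oo_LRcontinuous u a b /\ {in `]a, b[, derive1 u =1 v}.
Proof.
move=> ab uv; have cu : {within `[a, b], continuous u} by exact: derive_within uv.
have uv' x : x \in `]a, b[ -> is_derive x 1 u (v x).
  by rewrite in_itv/= => /andP[ax xb]; apply: uv; rewrite !ltW.
have [_ ca cb] := (continuous_within_itvP u ab).1 cu.
split; first by split=> // x /uv'[].
by move=> x /uv'[d e]; rewrite derive1E.
Qed.

Lemma by_parts u v phi a b : a < b ->
  (forall x, a <= x <= b -> is_derive x 1 u (v x)) -> {within `[a, b], continuous v} ->
  (forall x, derivable phi x 1) -> continuous (derive1 phi) -> phi a = 0 -> phi b = 0 ->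
  \int[mu]_(x in `[a, b]) (u x * derive1 phi x) =
  - \int[mu]_(x in `[a, b]) (v x * phi x).
Proof.
move=> ab uv cv dphi cphi phia phib.
have [du dv] := derivable_oo ab uv.
have dphi' x : a <= x <= b -> is_derive x 1 phi (derive1 phi x).
  by move=> _; rewrite derive1E; exact/derivableP.
have [dp dp'] := derivable_oo ab dphi'.
rewrite (Rintegration_by_parts ab cv du dv (continuous_subspaceT cphi) dp dp').
by rewrite phia phib !mulr0 subrr sub0r.
Qed.

(** A classical derivative is a weak one: both integrals reduce to a segment at whose ends the test
    function vanishes, and integration by parts leaves no boundary term. *)
Lemma H1_intro I f u v : (forall x, I x -> f x = u x) ->
  (forall x, I x -> is_derive x 1 u (v x)) ->
  (forall x, I x -> {for x, continuous v}) ->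
  (forall phi, test_function I phi -> exists a b, [/\ a < b,
     `[a, b]%classic `<=` I, phi a = 0, phi b = 0 &
     forall x, I x -> ~ `[a, b]%classic x -> phi x = 0 /\ derive1 phi x = 0]) ->
  L2 I u -> L2 I v -> H1 I f.
Proof.
move=> fu uv cv phiI uL2 vL2; split; last split.
- apply/subspace_continuousP => x Ix.
  have cu : {for x, continuous u} := is_derive_continuous (uv x Ix).
  suff : f @ within I (nbhs x) --> u x by rewrite -(fu x Ix).
  apply: (@cvg_trans _ (u @ within I (nbhs x))); last exact: cvg_within_filter.
  apply: near_eq_cvg; rewrite near_withinE.
  by apply: nearW => y Iy; exact/esym/fu.
- rewrite /L2; suff -> : f \_ I = u \_ I by [].
  by apply/funext => x; rewrite /patch; case: ifPn => // /set_mem/fu.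
- exists v; split=> // phi tphi.
  have [dphi [cphi _]] := test_function_vanish tphi.
  have [a [b [ab abI phia phib out]]] := phiI phi tphi.
  have restrict (h1 h2 : R -> R) (g1 : R -> R) : (forall x, I x -> h1 x = h2 x) ->
      (forall x, I x -> ~ `[a, b]%classic x -> g1 x = 0) ->
      \int[mu]_(x in I) (h1 x * g1 x) = \int[mu]_(x in `[a, b]) (h2 x * g1 x).
    move=> h12 g0; rewrite Rintegral_mkcond [RHS]Rintegral_mkcond.
    congr (Rintegral _ _ _); apply/funext => x; rewrite /patch.
    case: ifPn => [/set_mem Ix|xI].
      case: ifPn => [_|/negP xab]; first by rewrite h12.
      by rewrite g0 ?mulr0// => /mem_set.
    case: ifPn => // /set_mem/abI/mem_set Ix; by rewrite Ix in xI.
  rewrite (@restrict f u) //; last by move=> x Ix /(out x Ix)[].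
  rewrite (@restrict v v) //; last by move=> x Ix /(out x Ix)[].
  apply: by_parts => //.
    by move=> x xab; apply: uv; apply: abI; rewrite /= in_itv.
  apply: continuous_in_subspaceT => x /set_mem/abI; exact: cv.
Qed.

Lemma test_segment l phi : 0 < l -> test_function [set x | 0 <= x <= l] phi ->
  exists a b, [/\ a < b, `[a, b]%classic `<=` [set x | 0 <= x <= l], phi a = 0, phi b = 0 &
     forall x, [set x | 0 <= x <= l] x -> ~ `[a, b]%classic x -> phi x = 0 /\ derive1 phi x = 0].
Proof.
move=> l0 /test_function_vanish[_ [_ [M [_ [nI _]]]]].
exists 0, l; split=> //.
- apply: nI => /nbhs_ballP[e /= e0 eP].
  have /eP : ball (0 : R) e (- (e / 2)).
    by rewrite /ball/= sub0r opprK gtr0_norm ?divr_gt0// ltr_pdivrMr// ltr_pMr// ltr1n.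
  by rewrite /= leNgt oppr_lt0 divr_gt0.
- apply: nI => /nbhs_ballP[e /= e0 eP].
  have /eP : ball l e (l + e / 2).
    rewrite /ball/= opprD addrA subrr sub0r normrN gtr0_norm ?divr_gt0//.
    by rewrite ltr_pdivrMr// ltr_pMr// ltr1n.
  by rewrite /= => /andP[_]; rewrite leNgt ltrDl divr_gt0.
Qed.

Lemma test_half_line phi : test_function [set x : R | 0 <= x] phi ->
  exists a b, [/\ a < b, `[a, b]%classic `<=` [set x : R | 0 <= x], phi a = 0, phi b = 0 &
     forall x, [set x | 0 <= x] x -> ~ `[a, b]%classic x -> phi x = 0 /\ derive1 phi x = 0].
Proof.
move=> /test_function_vanish[_ [_ [M [M0 [nI out]]]]].
exists 0, M; split=> //.
- by move=> x /=; rewrite in_itv/= => /andP[].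
- apply: nI => /nbhs_ballP[e /= e0 eP].
  have /eP : ball (0 : R) e (- (e / 2)).
    by rewrite /ball/= sub0r opprK gtr0_norm ?divr_gt0// ltr_pdivrMr// ltr_pMr// ltr1n.
  by rewrite /= leNgt oppr_lt0 divr_gt0.
- by apply: (out M _).1; rewrite ger0_norm// ltW.
- move=> x /= x0; rewrite in_itv/= x0/= => /negP; rewrite -ltNge => Mx.
  by apply: out; rewrite ger0_norm// ltW.
Qed.

Lemma test_line phi : test_function [set: R] phi ->
  exists a b, [/\ a < b, `[a, b]%classic `<=` [set: R], phi a = 0, phi b = 0 &
     forall x, [set: R] x -> ~ `[a, b]%classic x -> phi x = 0 /\ derive1 phi x = 0].
Proof.
move=> /test_function_vanish[_ [_ [M [M0 [nI out]]]]].
exists (- M), M; split=> //.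
- by rewrite -subr_gt0 opprK addr_gt0.
- by apply: (out (- M) _).1; rewrite normrN ger0_norm// ltW.
- by apply: (out M _).1; rewrite ger0_norm// ltW.
- move=> x _ /= xM; apply: out; rewrite leNgt; apply/negP => xM'.
  by apply: xM; move: xM'; rewrite ltr_norml in_itv/= => /andP[? ?]; rewrite !ltW.
Qed.

Lemma L2_segment l u : {within `[0, l], continuous u} -> L2 [set x | 0 <= x <= l] u.
Proof.
move=> cu; have -> : [set x | 0 <= x <= l] = `[0, l]%classic.
  by apply/seteqP; split => x /=; rewrite in_itv.
apply: L2_intro => //; first exact: subspace_continuous_measurable_fun.
have : mu.-integrable `[0, l] (EFin \o (fun x => u x ^+ 2)).
  apply: continuous_compact_integrable; first exact: segment_compact.
  apply/subspace_continuousP => x xl.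
  apply: (@cvg_comp _ _ _ u (fun t : R => t ^+ 2)); last exact: exprn_continuous.
  by move/subspace_continuousP : cu; exact.
move=> /integrableP[_]; apply: le_lt_trans; rewrite le_eqVlt; apply/orP; left.
apply/eqP; apply: eq_integral => x _ /=.
by rewrite ger0_norm// sqr_ge0.
Qed.

(** The square is dominated by [c / k] times the density of the exponential law, which has integral
    1. *)
Lemma L2_half_line u c k : 0 < k -> continuous u ->
  (forall x, 0 <= x -> u x ^+ 2 <= c * expR (- k * x)) -> L2 [set x | 0 <= x] u.
Proof.
move=> k0 cu uc; have IE : [set x : R | 0 <= x] = `[0, +oo[%classic.
  by apply/seteqP; split => x /=; rewrite in_itv/= andbT.
have c0 : 0 <= c.
  by have := uc 0 (lexx _); rewrite mulr0 expR0 mulr1; apply: le_trans; exact: sqr_ge0.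
have mu2 : measurable_fun setT (fun x => u x ^+ 2).
  by apply: measurable_funX; exact: continuous_measurable_fun.
have mp : measurable_fun setT (exponential_pdf k) by exact: measurable_exponential_pdf.
rewrite IE; apply: L2_intro => //; first by apply: measurable_funTS;
  exact: continuous_measurable_fun.
apply: (@le_lt_trans _ _ (\int[mu]_(x in `[0%R, +oo[) ((c / k)%:E * (exponential_pdf k x)%:E))%E).
  apply: ge0_le_integral => //.
  - by move=> x _; rewrite lee_fin sqr_ge0.
  - by apply/measurable_EFinP; exact: measurable_funTS.
  - apply: measurable_funeM; apply/measurable_EFinP; exact: measurable_funTS.
  - move=> x /=; rewrite in_itv/= andbT => x0.
    rewrite -EFinM lee_fin exponential_pdfE// mulrA divfK ?gt_eqF//; exact: uc.
rewrite ge0_integralZl_EFin//; last 3 first.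
- by move=> x _; rewrite lee_fin exponential_pdf_ge0// ltW.
- by apply/measurable_EFinP; exact: measurable_funTS.
- by rewrite divr_ge0// ltW.
apply: lte_mul_pinfty => //; first by rewrite lee_fin divr_ge0// ltW.
apply: (@le_lt_trans _ _ (\int[mu]_x (exponential_pdf k x)%:E)%E).
  apply: ge0_subset_integral => //; first exact/measurable_EFinP.
  by move=> x _; rewrite lee_fin exponential_pdf_ge0// ltW.
by rewrite integral_exponential_pdf// ltry.
Qed.

Lemma L2_line u c k : 0 < k -> continuous u -> (forall x, u (- x) ^+ 2 = u x ^+ 2) ->
  (forall x, 0 <= x -> u x ^+ 2 <= c * expR (- k * x)) -> L2 setT u.
Proof.
move=> k0 cu sym uc; have uL2 := L2_half_line k0 cu uc.
apply: L2_intro => //; first exact: continuous_measurable_fun.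
rewrite ge0_symfun_integralT; last 3 first.
- by move=> x; rewrite sqr_ge0.
- move=> x; apply: (@cvg_comp _ _ _ u (fun t : R => t ^+ 2)); [exact: cu|exact: exprn_continuous].
- by move=> x /=; rewrite sym.
apply: lte_mul_pinfty => //.
have /integrableP[_] := Lfun2_integrable_sqr uL2; apply: le_lt_trans.
rewrite [leLHS]integral_mkcond le_eqVlt; apply/orP; left; apply/eqP.
apply: eq_integral => x _ /=; rewrite /patch; case: ifPn => _ /=.
  by rewrite ger0_norm// sqr_ge0.
by rewrite expr0n normr0.
Qed.

End sobolev.

(** * The soliton and the solutions on a half-line *)

Section explicit_soliton.
Variables (R : realType) (lam p : R).
Hypotheses (lam0 : 0 < lam) (p2 : 2 < p).
Implicit Types x y : R.

Local Notation pot := (pot lam p).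
Local Notation gap1 := (gap1 lam p).
Local Notation q := (Num.sqrt lam).

(* The soliton is [a cosh (rate x) ^ (- 2 / (p - 2))] with
   [a ^ (p - 2) = lam p / 2]; here [den = 2 cosh (rate x)]. *)
Definition rate : R := q * (p - 2) / 2.
Definition den x := expR (rate * x) + expR (- (rate * x)).
Definition num x := expR (rate * x) - expR (- (rate * x)).
Definition bump x := (2 * lam * p) `^ (p - 2)^-1 * expR (- (2 / (p - 2)) * ln (den x)).
Definition bump' x := - (q * (num x / den x) * bump x).

Let p20 : 0 < p - 2. Proof. by rewrite subr_gt0. Qed.
Let p0 : 0 < p. Proof. by apply: lt_trans p2. Qed.
Let q0 : 0 < q. Proof. by rewrite sqrtr_gt0. Qed.
Let qq : q * q = lam. Proof. by rewrite -expr2 sqr_sqrtr// ltW. Qed.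
Let rate0 : 0 < rate. Proof. by rewrite /rate divr_gt0// mulr_gt0. Qed.
Let den0 x : 0 < den x. Proof. by rewrite /den addr_gt0 ?expR_gt0. Qed.
Let amp0 : 0 < (2 * lam * p) `^ (p - 2)^-1.
Proof. by rewrite powR_gt0// !mulr_gt0. Qed.

Lemma bump_gt0 x : 0 < bump x.
Proof. by rewrite /bump mulr_gt0// expR_gt0. Qed.

Let is_derive_den x : is_derive x 1 den (rate * num x).
Proof.
have d1 := is_derive_mulf (is_derive_cstf x rate) (is_derive_idf x).
have e1 := @is_derive_compf _ (@expR R) (fun x => rate * x) x _ _ (is_derive_expR _) d1.
have e2 := @is_derive_compf _ (@expR R) (fun x => - (rate * x)) x _ _ (is_derive_expR _)
  (is_derive_oppf d1).
by apply: is_derive_val (is_derive_addf e1 e2) _; rewrite /num; ring.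
Qed.

Let is_derive_num x : is_derive x 1 num (rate * den x).
Proof.
have d1 := is_derive_mulf (is_derive_cstf x rate) (is_derive_idf x).
have e1 := @is_derive_compf _ (@expR R) (fun x => rate * x) x _ _ (is_derive_expR _) d1.
have e2 := @is_derive_compf _ (@expR R) (fun x => - (rate * x)) x _ _ (is_derive_expR _)
  (is_derive_oppf d1).
by apply: is_derive_val (is_derive_subf e1 e2) _; rewrite /den; ring.
Qed.

Lemma is_derive_bump x : is_derive x 1 bump (bump' x).
Proof.
set k := - (2 / (p - 2)).
have d1 := @is_derive_compf _ (@ln R) den x _ _ (is_derive1_ln (den0 x)) (is_derive_den x).
have d2 := is_derive_mulf (is_derive_cstf x k) d1.
have d3 := @is_derive_compf _ (@expR R) (fun x => k * ln (den x)) x _ _ (is_derive_expR _) d2.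
apply: is_derive_val (is_derive_mulf (is_derive_cstf x _) d3) _.
rewrite /bump' /bump -/k mul0r add0r mul0r add0r.
have -> : k * ((den x)^-1 * (rate * num x)) = - (q * (num x / den x)).
  by rewrite /k /rate; field; rewrite !gt_eqF.
by ring.
Qed.

Let pw_bump x : pw p (bump x) = 2 * lam * p / den x ^+ 2.
Proof.
rewrite /pw /bump powRM ?ltW ?expR_gt0// -powRrM mulVf ?gt_eqF// powRr1; last first.
  by rewrite !mulr_ge0 ?ltW.
congr (_ * _); rewrite -expRM.
have -> : - (2 / (p - 2)) * ln (den x) * (p - 2) = - (ln (den x) *+ 2).
  by rewrite -[_ *+ 2]mulr_natl; field; rewrite gt_eqF.
by rewrite expRN -lnXn// lnK// posrE exprn_gt0.
Qed.

Lemma is_derive_bump' x : is_derive x 1 bump' (- gap1 (bump x)).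
Proof.
have dn0 := den0 x.
have d1 := is_derive_mulf (is_derive_num x) (is_derive_invf (lt0r_neq0 dn0) (is_derive_den x)).
have d2 := is_derive_mulf (is_derive_mulf (is_derive_cstf x q) d1) (is_derive_bump x).
apply: is_derive_val (is_derive_oppf d2) _.
rewrite /gap1 pw_bump /bump'.
have nd : num x ^+ 2 = den x ^+ 2 - 4.
  have e : expR (rate * x) * expR (- (rate * x)) = 1 by exact: expRxMexpNx_1.
  rewrite /num /den; move: e; set a := expR _; set b := expR _ => e.
  have -> : (a - b) ^+ 2 = (a + b) ^+ 2 - 4 * (a * b) by ring.
  by rewrite e mulr1.
have -> : - ((0 * (num x / den x) + q * (rate * den x / den x +
  num x * (- (rate * num x) / den x ^+ 2))) * bump x +
    q * (num x / den x) * - (q * (num x / den x) * bump x)) =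
   bump x * (q * q * num x ^+ 2 / den x ^+ 2 - q * rate * (den x ^+ 2 - num x ^+ 2) / den x ^+ 2).
  by field; rewrite gt_eqF.
rewrite nd /rate.
have -> : q * (q * (p - 2) / 2) = q * q * (p - 2) / 2 by field.
by rewrite qq; field; rewrite gt_eqF.
Qed.

Let denN x : den (- x) = den x.
Proof. by rewrite /den mulrN opprK addrC. Qed.

Lemma bumpN x : bump (- x) = bump x.
Proof. by rewrite /bump denN. Qed.

Let bump'N x : bump' (- x) = - bump' x.
Proof.
have numN : num (- x) = - num x by rewrite /num mulrN opprK opprB.
by rewrite /bump' bumpN denN numN; ring.
Qed.

Let num_gt0 x : 0 < x -> 0 < num x.
Proof.
move=> x0; rewrite /num subr_gt0 ltr_expR.
by apply: (@lt_trans _ _ 0); rewrite ?oppr_lt0 mulr_gt0.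
Qed.

Lemma bump_decr x y : 0 <= x -> x < y -> bump y < bump x.
Proof.
move=> x0 xy; apply: (derive_lt0_gt_cc xy (fun z _ => is_derive_bump z)) => z /andP[xz _].
rewrite oppr_lt0 mulr_gt0 ?bump_gt0// mulr_gt0// divr_gt0// num_gt0//.
exact: le_lt_trans xz.
Qed.

Let bump_le x : bump x ^+ 2 <= ((2 * lam * p) `^ (p - 2)^-1) ^+ 2 * expR (- (2 * q) * x).
Proof.
have -> : expR (- (2 * q) * x) = expR (- q * x) ^+ 2.
  by rewrite -expRM_natl; congr expR; ring.
have b0 := ltW (bump_gt0 x).
suff h : bump x <= (2 * lam * p) `^ (p - 2)^-1 * expR (- q * x).
  by rewrite -(exprMn 2) !expr2; exact: (ler_pM b0 b0 h h).
rewrite /bump (ler_pM2l amp0) ler_expR.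
have -> : - q * x = - (2 / (p - 2)) * (rate * x) by rewrite /rate; field; rewrite gt_eqF.
have k0 : - (2 / (p - 2)) <= 0 by rewrite oppr_le0 divr_ge0// ltW.
apply: (ler_wnM2l k0).
by rewrite -[leLHS]expRK ler_ln ?posrE ?expR_gt0// /den lerDl expR_ge0.
Qed.

Let bump'_le x : bump' x ^+ 2 <= lam * bump x ^+ 2.
Proof.
rewrite /bump' sqrrN (exprMn 2 (q * _)) (exprMn 2 q).
have -> : q ^+ 2 = lam by rewrite expr2.
rewrite ler_wpM2r ?sqr_ge0// ger_pMr//.
rewrite expr_div_n ler_pdivrMr ?exprn_gt0// mul1r -subr_ge0.
have -> : den x ^+ 2 - num x ^+ 2 = 4 * (expR (rate * x) * expR (- (rate * x))).
  by rewrite /den /num; ring.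
by rewrite mulr_ge0// mulr_ge0 ?expR_ge0.
Qed.

Let bump_cont : continuous bump.
Proof. by move=> x; exact: is_derive_continuous (is_derive_bump x). Qed.

Let bump'_cont : continuous bump'.
Proof. by move=> x; exact: is_derive_continuous (is_derive_bump' x). Qed.

Lemma line_no_isolated : no_isolated_point [set: R].
Proof.
apply: no_isolated_pointP => x e _ e0; exists (x + e / 2) => //.
rewrite addrAC subrr add0r gtr0_norm ?divr_gt0//=.
by rewrite ltr_pdivrMr// ltr_pMr// ltr1n.
Qed.

Lemma bump_soliton : is_soliton lam p bump.
Proof.
have c0 x : bump' x ^+ 2 <= lam * ((2 * lam * p) `^ (p - 2)^-1) ^+ 2 * expR (- (2 * q) * x).
  by apply: le_trans (bump'_le x) _; rewrite -mulrA ler_pM2l.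
have q20 : 0 < 2 * q by rewrite mulr_gt0.
have L2b : L2 setT bump.
  apply: (L2_line q20 bump_cont) => [x|x _]; first by rewrite bumpN.
  exact: bump_le.
have L2b' : L2 setT bump'.
  apply: (L2_line q20 bump'_cont) => [x|x _]; first by rewrite bump'N sqrrN.
  exact: c0.
have H1b : H1 setT bump := H1_intro (fun _ _ => erefl) (fun x _ => is_derive_bump x)
  (fun x _ => @bump'_cont x) (@test_line R) L2b L2b'.
have [sb _] := sol_solves line_no_isolated
  (fun x _ => conj (is_derive_bump x) (is_derive_bump' x)) (fun _ _ => erefl)
    (fun x _ => bump_gt0 x).
exact: (conj H1b (conj sb (conj bump_gt0 (conj bumpN bump_decr)))).
Qed.

Lemma bump'_sqr x : bump' x ^+ 2 = 2 * pot (bump x).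
Proof.
have dn0 := den0 x; have pn : p != 0 by rewrite gt_eqF.
have nd : num x ^+ 2 = den x ^+ 2 - 4.
  have e : expR (rate * x) * expR (- (rate * x)) = 1 by exact: expRxMexpNx_1.
  rewrite /num /den; move: e; set a := expR _; set b := expR _ => e.
  have -> : (a - b) ^+ 2 = (a + b) ^+ 2 - 4 * (a * b) by ring.
  by rewrite e mulr1.
have -> : bump' x ^+ 2 = q * q * num x ^+ 2 / den x ^+ 2 * bump x ^+ 2.
  by rewrite /bump'; field; rewrite gt_eqF.
by rewrite nd qq /pot pw_bump; field; rewrite pn gt_eqF.
Qed.

Lemma bump'0 : bump' 0 = 0.
Proof. by rewrite /bump' /num mulr0 oppr0 subrr mul0r mulr0 mul0r oppr0. Qed.

Lemma bump'_lt0 x : 0 < x -> bump' x < 0.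
Proof.
move=> x0; rewrite oppr_lt0 mulr_gt0 ?bump_gt0// mulr_gt0// divr_gt0// num_gt0//.
Qed.

Lemma bump'_sym x : bump' (- x) = - bump' x.
Proof. exact: bump'N. Qed.

Lemma pot_bump0 : pot (bump 0) = 0.
Proof.
have := bump'_sqr 0; rewrite bump'0 expr0n/= => /esym/eqP.
by rewrite mulf_eq0 pnatr_eq0/= => /eqP.
Qed.

Lemma pot_eq0_bump0 (a : R) : 0 < a -> pot a = 0 -> a = bump 0.
Proof.
move=> a0 pa; have b0 := bump_gt0 0; have pb := pot_bump0.
have [lt|gt|//] := ltgtP a (bump 0).
  have pb0 : 0 <= pot (bump 0) by rewrite pb.
  by have := pot_gt0_below p2 a0 lt pb0; rewrite pa ltxx.
have pa0 : 0 <= pot a by rewrite pa.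
by have := pot_gt0_below p2 b0 gt pa0; rewrite pb ltxx.
Qed.

Lemma is_derive_bump_shift x y :
  is_derive x 1 (fun x => bump (x + y)) (bump' (x + y)) /\
  is_derive x 1 (fun x => bump' (x + y)) (- gap1 (bump (x + y))).
Proof.
have dx := is_derive_addf (is_derive_idf x) (is_derive_cstf x y).
split.
  apply: is_derive_val (@is_derive_compf _ bump (fun x => x + y) x _ _ (is_derive_bump _) dx) _.
  by rewrite addr0 mulr1.
apply: is_derive_val (@is_derive_compf _ bump' (fun x => x + y) x _ _ (is_derive_bump' _) dx) _.
by rewrite addr0 mulr1.
Qed.

Lemma L2_bump_shift y : L2 [set x | 0 <= x] (fun x => bump (x + y)) /\
  L2 [set x | 0 <= x] (fun x => bump' (x + y)).
Proof.
have q20 : 0 < 2 * q by rewrite mulr_gt0.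
have eE x : expR (- (2 * q) * (x + y)) = expR (- (2 * q) * y) * expR (- (2 * q) * x).
  by rewrite -expRD; congr expR; ring.
set A := ((2 * lam * p) `^ (p - 2)^-1) ^+ 2.
split.
- apply: (@L2_half_line _ _ (A * expR (- (2 * q) * y)) _ q20).
    by move=> x; exact: is_derive_continuous (is_derive_bump_shift x y).1.
  by move=> x _; rewrite -mulrA -eE; exact: bump_le.
- apply: (@L2_half_line _ _ (lam * A * expR (- (2 * q) * y)) _ q20).
    by move=> x; exact: is_derive_continuous (is_derive_bump_shift x y).2.
  move=> x _; rewrite -mulrA -eE; apply: le_trans (bump'_le _) _.
  by rewrite -mulrA (ler_pM2l lam0); exact: bump_le.
Qed.

Lemma bump_small c x : 0 < c -> exists2 y, x <= y & bump y < c.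
Proof.
move=> c0; have [L2b _] := L2_bump_shift 0.
have [|y xy] := @L2_small _ _ _ c (Num.max x 0) L2b _ c0.
  by move=> y; rewrite ge_max => /andP[].
by rewrite addr0; exists y => //; rewrite (le_trans _ xy)// le_max lexx.
Qed.

Lemma bump_surj (a : R) : 0 < a -> a <= bump 0 -> exists2 x, 0 <= x & bump x = a.
Proof.
move=> a0 ab; have [y y0 ya] := bump_small 0 a0.
have cb : {within `[0, y], continuous bump} by exact: continuous_subspaceT.
have mM : Num.min (bump 0) (bump y) <= a <= Num.max (bump 0) (bump y).
  apply/andP; split; first by rewrite ge_min; apply/orP; right; exact: ltW ya.
  by rewrite le_max; apply/orP; left.
have [x /[!in_itv]/= /andP[x0 _] xa] := IVT y0 cb mM.
by exists x.
Qed.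

Lemma bump_inj_ge0 x y : 0 <= x -> 0 <= y -> bump x = bump y -> x = y.
Proof.
move=> x0 y0 e; have [lt|gt|//] := ltgtP x y.
  by have := bump_decr x0 lt; rewrite e ltxx.
by have := bump_decr y0 gt; rewrite e ltxx.
Qed.

Lemma bump_sol a b : sol lam p a b bump bump'.
Proof.
apply: is_derive_sol => x _; last exact: bump_gt0.
by split; [exact: is_derive_bump|exact: is_derive_bump'].
Qed.

Lemma is_derive_unique (f : R -> R) x (a b : R) :
  is_derive x 1 f a -> is_derive x 1 f b -> a = b.
Proof. by move=> [_ <-] [_ <-]. Qed.

(** Evenness makes the slope at 0 vanish; zero energy then gives [pot (f 0) = 0], whose only
    positive root is [bump 0]. Cauchy uniqueness does the rest on [x >= 0]. *)
Lemma is_soliton_bump f : is_soliton lam p f -> f = bump.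
Proof.
move=> [[_ [fL2 _]] [sf [f0 [fN _]]]].
pose g := derive_in setT f.
have solf b : 0 < b -> sol lam p 0 b f g by move=> _; exact: solves_sol.
have small c x : 0 < c -> 0 <= x -> exists2 y, x <= y & f y < c.
  by move=> c0 _; exact: (L2_small fL2).
have energy := half_line_energy lam0 p2 solf small.
have g0 : g 0 = 0.
  have [_ _ /(_ 0) + _] := @solves_sol _ lam p setT f (-1) 1 (fun x _ => f0 x) sf (fun _ _ => I).
  rewrite ltrN10 ltr01 => /(_ isT)[d0 _].
  have d0' : is_derive (- 0 : R) 1 f (g 0) by rewrite oppr0.
  have := @is_derive_compf _ f -%R 0 _ _ d0' (is_derive_oppf (is_derive_idf 0)).
  have -> : (fun y => f (- y)) = f by apply/funext.
  by move=> /(is_derive_unique d0); rewrite -/(g 0) mulrN1 => e; lra.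
have pf0 : pot (f 0) = 0.
  have := energy 0 (lexx 0); rewrite g0 expr0n/= => /esym/eqP.
  by rewrite mulf_eq0 pnatr_eq0/= => /eqP.
have fb0 : f 0 = bump 0 by exact: pot_eq0_bump0.
have pos x : 0 <= x -> f x = bump x.
  move=> x0; have x1 : 0 < x + 1 by rewrite ltr_wpDl.
  have [] := sol_unique lam0 p2 (ltW x1) (solf _ x1) (bump_sol 0 (x + 1)) fb0 _ (x := x).
  - by rewrite g0 bump'0.
  - by rewrite x0/= lerDl ler01.
  by [].
apply/funext => x; have [/pos//|/ltW x0] := leP 0 x.
by rewrite -fN -bumpN pos// oppr_ge0.
Qed.

Lemma solitonE : soliton lam p = bump.
Proof.
apply: is_soliton_bump; rewrite /soliton.
by apply: (@getI _ [set f | is_soliton lam p f] bump); exact: bump_soliton.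
Qed.

(** Zero energy bounds [f 0] by [bump 0] and fixes the slope up to sign; the sign of [g 0] selects
    the translation [y >= 0]. *)
Lemma half_line_bump f g : (forall b, 0 < b -> sol lam p 0 b f g) ->
  (forall c x, 0 < c -> 0 <= x -> exists2 y, x <= y & f y < c) -> g 0 <= 0 ->
  exists2 y, 0 <= y & forall x, 0 <= x -> f x = bump (x + y) /\ g x = bump' (x + y).
Proof.
move=> fg small g0.
have energy := half_line_energy lam0 p2 fg small.
have f0 : 0 < f 0 by have [_ _ _ ] := fg 1 ltr01; apply; rewrite lexx ler01.
have fb0 : f 0 <= bump 0.
  rewrite leNgt; apply/negP => lt.
  have := energy 0 (lexx 0); have := sqr_ge0 (g 0) => /[swap] -> .
  rewrite pmulr_rge0// => /(pot_gt0_below p2 (bump_gt0 0) lt).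
  by rewrite pot_bump0 ltxx.
have [y y0 fy] := bump_surj f0 fb0.
have gy : g 0 = bump' y.
  have b'0 : bump' y <= 0.
    by move: y0; rewrite le_eqVlt => /predU1P[<-|/bump'_lt0/ltW//]; rewrite bump'0.
  apply/eqP; rewrite -eqr_opp -(@eqrXn2 _ 2)// ?oppr_ge0//.
  by rewrite (sqrrN (g 0)) (sqrrN (bump' y)) energy// bump'_sqr fy.
exists y => // x x0.
have x1 : 0 < x + 1 by rewrite ltr_wpDl.
have ssh : sol lam p 0 (x + 1) (fun x => bump (x + y)) (fun x => bump' (x + y)).
  apply: is_derive_sol => z _; last exact: bump_gt0.
  exact: is_derive_bump_shift.
have e1 : f 0 = bump (0 + y) by rewrite add0r fy.
have e2 : g 0 = bump' (0 + y) by rewrite add0r gy.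
apply: (sol_unique lam0 p2 (ltW x1) (fg _ x1) ssh e1 e2).
by rewrite x0/= lerDl ler01.
Qed.

End explicit_soliton.

Opaque bump bump' tau rise rise' orbit orbit' half_periods.

(** * Solutions on the graph *)

Section t_graph.
Variables (R : realType) (lam p l : R).
Hypotheses (lam0 : 0 < lam) (p2 : 2 < p) (l0 : 0 < l).
Implicit Types (u : triple R) (a s x y : R) (f g h : R -> R).

Local Notation ctr := (ctr lam p).
Local Notation pot := (pot lam p).
Local Notation gap1 := (gap1 lam p).
Local Notation level := (level lam p).
Local Notation amp := (amp lam p).
Local Notation rad := (rad lam p).
Local Notation bump := (bump lam p).
Local Notation bump' := (bump' lam p).
Local Notation tau := (tau lam p).
Local Notation rise := (rise lam p).
Local Notation rise' := (rise' lam p).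
Local Notation orbit := (orbit lam p).
Local Notation orbit' := (orbit' lam p).
Local Notation half_periods := (half_periods lam p).

Lemma ell_star_gt0 : 0 < ell_star lam p.
Proof. by rewrite divr_gt0 ?pi_gt0// sqrtr_gt0 mulr_gt0// subr_gt0. Qed.

Definition slope u e := derive_in (edge_set l e) (u e).

Lemma edge_no_isolated e : no_isolated_point (edge_set l e).
Proof.
have half : no_isolated_point [set x : R | 0 <= x].
  apply: no_isolated_pointP => x e' /= x0 e0; exists (x + e' / 2) => /=.
    by rewrite addr_ge0// divr_ge0// ltW.
  rewrite addrAC subrr add0r gtr0_norm ?divr_gt0//=.
  by rewrite ltr_pdivrMr// ltr_pMr// ltr1n.
case: e => //=; apply: no_isolated_pointP => x e' /= /andP[x0 xl] e0.
have d0 : 0 < Num.min e' l / 2 by rewrite divr_gt0// lt_min e0.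
have de : Num.min e' l / 2 < e'.
  rewrite ltr_pdivrMr// (@le_lt_trans _ _ e')//; first by rewrite ge_min lexx.
  by rewrite ltr_pMr// ltr1n.
have dl : Num.min e' l / 2 <= l / 2 by rewrite ler_pM2r// ge_min lexx orbT.
have [xl2|xl2] := leP x (l / 2).
  exists (x + Num.min e' l / 2) => /=.
    by apply/andP; split; [rewrite addr_ge0// ltW|lra].
  by rewrite addrAC subrr add0r gtr0_norm ?d0.
exists (x - Num.min e' l / 2) => /=.
  by apply/andP; split; lra.
by rewrite addrAC subrr add0r normrN gtr0_norm ?d0.
Qed.

Lemma half_line_sol u e : positive_solution lam p l u ->
  edge_set l e = [set x | 0 <= x] ->
  (forall b, 0 < b -> sol lam p 0 b (u e) (slope u e)) /\
  (forall c x, 0 < c -> 0 <= x -> exists2 y, x <= y & u e y < c).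
Proof.
move=> [[_ [uH _]] [u0 [us _]]] eE; split.
  move=> b b0; apply: solves_sol; [exact: u0|exact: us|].
  by move=> x /andP[x0 _]; rewrite eE.
move=> c x c0 x0; apply: (@L2_small _ (edge_set l e)) => //.
  by have [_ []] := uH e.
by move=> y /(le_trans x0); rewrite eE.
Qed.

Lemma segment_sol u : positive_solution lam p l u ->
  sol lam p 0 l (u e3) (slope u e3).
Proof. by move=> [_ [u0 [us _]]]; exact: (solves_sol (u0 e3) (us e3)). Qed.

Lemma pot_bump_gt0 y : y != 0 -> 0 < pot (bump y).
Proof.
move=> y0; have lt : bump y < bump 0.
  have [y1|y1] := ltP 0 y; first exact: (bump_decr lam0 p2 (lexx 0)).
  rewrite -bumpN; apply: (bump_decr lam0 p2 (lexx 0)).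
  by rewrite oppr_gt0 lt_neqAle y0.
apply: (pot_gt0_below p2 (bump_gt0 lam0 p2 y) lt).
by rewrite pot_bump0.
Qed.

Lemma amp_lt_rad a : 0 < a -> 0 < pot a -> `|amp a| < rad.
Proof.
move=> a0 pa; rewrite ltr_norml amp_gtNrad//=.
have r0 := rad_gt0 lam0 p2.
have [//|rS] := ltP (amp a) rad.
have : rad ^+ 2 <= amp a ^+ 2 by rewrite ler_pXn2r// nnegrE (le_trans (ltW r0)).
rewrite rad_sqr// amp_sqr// lerBrDl; move: pa => /[swap] h; lra.
Qed.

Lemma pot_level_gt0 s : `|s| < rad -> 0 < pot (level s).
Proof.
move=> sr; have rs : - rad < s by move: sr; rewrite ltr_norml => /andP[].
have s2 : s ^+ 2 < rad ^+ 2.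
  by rewrite -[s ^+ 2]real_normK ?num_real// ltr_pXn2r// nnegrE ltW// rad_gt0.
have := amp_sqr lam0 p2 (level_gt0 p lam0 s); rewrite levelK// => e.
by move: s2; rewrite e rad_sqr// gtrBl.
Qed.

Lemma bump_level s : `|s| < rad -> exists2 y, 0 < y & bump y = level s.
Proof.
move=> sr; have ps := pot_level_gt0 sr; have a0 := level_gt0 p lam0 s.
have Xb : level s <= bump 0.
  rewrite leNgt; apply/negP => lt.
  by have := pot_gt0_below p2 (bump_gt0 lam0 p2 0) lt (ltW ps); rewrite pot_bump0// ltxx.
have [y y0 yX] := bump_surj lam0 p2 a0 Xb.
exists y => //; rewrite lt_neqAle y0 andbT; apply/eqP => y00.
by move: ps; rewrite -yX -y00 pot_bump0// ltxx.
Qed.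

(** Excludes a soliton peak at the vertex in types A and C: the terminal edge would then follow the
    soliton itself, whose slope does not vanish again. *)
Lemma edge_from_peak f g : sol lam p 0 l f g -> f 0 = bump 0 -> g 0 = 0 -> g l < 0.
Proof.
move=> fg f0 g0.
have [||_ ->] := sol_unique lam0 p2 (ltW l0) fg (bump_sol lam0 p2 0 l) f0 _ (x := l).
- by rewrite g0 bump'0.
- by rewrite lexx ltW.
exact: bump'_lt0.
Qed.

(** Up to [tau s] the solution is [rise s], with positive slope before. Past [tau s] energy alone is
    used: a critical value has the negative potential of [M], hence equals [M]. As the slope
    vanishes at both ends, the minimum on [[tau s, l]] is such a value, so the solution stays at
    [M], which is no equilibrium since [gap1 M > 0]. *)
Lemma edge_from_slope s f g : `|s| < rad -> sol lam p 0 l f g -> f 0 = level s ->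
  g 0 = 2 * Num.sqrt (2 * pot (level s)) -> g l = 0 -> l = tau s.
Proof.
move=> sr fg f0 g0 gl; have t0 := tau_gt0 lam0 p2 sr.
have rise_sol b : b <= tau s -> sol lam p 0 b (rise s) (rise' s).
  move=> bt; apply: is_derive_sol => x; last by move=> _; exact: rise_gt0.
  by move=> /andP[x0 xb]; apply: is_derive_rise => //; rewrite x0 (le_trans xb).
have agree b : 0 <= b -> b <= l -> b <= tau s -> f b = rise s b /\ g b = rise' s b.
  move=> b0 bl bt; apply: (sol_unique lam0 p2 b0 (sol_sub (lexx 0) bl fg) (rise_sol b bt)).
  - by rewrite rise0.
  - by rewrite rise'0.
  - by rewrite b0 lexx.
have [lt|gt|//] := ltgtP l (tau s).
  have [_ glr] := agree l (ltW l0) (lexx l) (ltW lt).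
  by have := rise'_gt0 lam0 p2 sr (ltW l0) lt; rewrite -glr gl ltxx.
have [_ gt0] := agree (tau s) (ltW t0) (ltW gt) (lexx _).
rewrite rise'_tau// in gt0.
have energy x : 0 <= x <= l -> g x ^+ 2 - 2 * pot (f x) = 6 * pot (level s).
  move=> xl; rewrite (sol_energy p2 fg xl) g0 f0 exprMn sqr_sqrtr; first by ring.
  by rewrite mulr_ge0// ltW// pot_level_gt0.
have pX := pot_level_gt0 sr.
have tl : 0 <= tau s <= l by rewrite !ltW.
have energy_t := energy _ tl; rewrite gt0 expr0n/= sub0r in energy_t.
pose M := f (tau s).
have pM : pot M = - 3 * pot (level s) by rewrite -/M in energy_t; lra.
have above v : 0 < v -> pot v < 0 -> ctr < v.
  move=> v0 pv; rewrite ltNge; apply/negP => vc.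
  by have := pot_gt0 lam0 p2 v0 vc; rewrite ltNge (ltW pv).
have [cf cg fg' fpos] := sol_sub (ltW t0) (lexx l) fg.
have M0 : 0 < M by apply: fpos; rewrite lexx ltW.
have cM : ctr < M by apply: above => //; rewrite pM; lra.
have potM v : 0 < v -> pot v = pot M -> v = M.
  move=> v0 pv; have cv : ctr < v by apply: above => //; rewrite pv pM; lra.
  have [lt|lt|//] := ltgtP v M.
    by have := pot_decr lam0 p2 (ltW cv) lt; rewrite pv ltxx.
  by have := pot_decr lam0 p2 (ltW cM) lt; rewrite pv ltxx.
have crit x : tau s <= x <= l -> g x = 0 -> f x = M.
  move=> /[dup] xtl /andP[tx xl] gx; apply: potM; first exact: fpos.
  have x0l : 0 <= x <= l by rewrite xl (le_trans (ltW t0)).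
  by have := energy x x0l; rewrite gx expr0n/=; lra.
have leM x : tau s <= x <= l -> f x <= M.
  move=> /andP[tx xl]; rewrite leNgt; apply/negP => /(pot_decr lam0 p2 (ltW cM)).
  have x0l : 0 <= x <= l by rewrite xl (le_trans (ltW t0)).
  by have := energy x x0l; have := sqr_ge0 (g x); rewrite pM; lra.
have [m /[!in_itv]/= /andP[tm ml] mmin] := EVT_min (ltW gt) cf.
have fm : f m = M.
  have [mt|{}tm'] := leP m (tau s).
    by rewrite /M; congr f; apply/eqP; rewrite eq_le mt.
  have [lm|{}ml'] := leP l m.
    by apply: crit; [rewrite tm|have -> : m = l by apply/eqP; rewrite eq_le lm ml].
  apply: crit; first by rewrite tm ml.
  have dgm : is_derive m 1 f 0.
    apply: (@derive1_at_min R f (tau s) l m (ltW gt)).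
    - by move=> t /[!in_itv]/= /fg'[[]].
    - by rewrite in_itv/= tm'.
    - by move=> t /[!in_itv]/= /andP[ta ty]; apply: mmin; rewrite in_itv/= !ltW.
  have [d _] := fg' m (introT andP (conj tm' ml')).
  exact: is_derive_unique d dgm.
have fM x : tau s <= x <= l -> f x = M.
  move=> xtl; apply/eqP; rewrite eq_le leM// -fm mmin//.
have [||c] := @Rolle R g (tau s) l gt _ cg.
- by move=> x /[!in_itv]/= /fg'[_ []].
- by rewrite gt0 gl.
rewrite in_itv/= => /[dup] /andP[tc cl] /fg'[_ d] d0.
have := is_derive_unique d d0; rewrite (fM c); last by rewrite !ltW.
by move=> /eqP; rewrite oppr_eq0 gt_eqF// gap1_gt0.
Qed.

Lemma edge_even s f g : `|s| < rad -> sol lam p 0 l f g -> f 0 = level s -> g 0 = 0 ->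
  forall x, 0 <= x <= l -> f x = orbit s x /\ g x = orbit' s x.
Proof.
move=> sr fg f0 g0; apply: (sol_unique lam0 p2 (ltW l0) fg).
- by apply: is_derive_sol => x _; [exact: is_derive_orbit|exact: orbit_gt0].
- by rewrite orbit0.
- by rewrite orbit'0.
Qed.

Lemma no_type_B u : positive_solution lam p l u -> ~ type_B lam p u.
Proof.
move=> pu [u12 [nm _]].
have [[_ [_ [_ u20]]] [_ [_ [NK NKl]]]] := pu.
have [sol1 small1] := half_line_sol pu (erefl : edge_set l e1 = _).
have fg := segment_sol pu.
have s12 : slope u e2 = slope u e1 by rewrite /slope u12.
(* A nonpositive slope at the vertex would make [u e1] a decreasing portion of the soliton, hence
   monotone. *)
have s1 : 0 < slope u e1 0.
  rewrite ltNge; apply/negP => s1; apply: nm; right => x y x0.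
  have [z z0 uz] := half_line_bump lam0 p2 sol1 small1 s1.
  rewrite le_eqVlt => /predU1P[->//|xy].
  have y0 := le_trans x0 (ltW xy); rewrite (uz x x0).1 (uz y y0).1.
  by apply/ltW/(bump_decr lam0 p2); rewrite ?addr_ge0// ltrD2r.
have en1 := half_line_energy lam0 p2 sol1 small1 (lexx 0).
have pa : 0 < pot (u e1 0) by rewrite -(pmulr_rgt0 _ (ltr0n R 2)) -en1 exprn_gt0.
have s3 : slope u e3 0 = - 2 * slope u e1 0.
  by move: NK; rewrite -/(slope u e1 0) -/(slope u e2 0) -/(slope u e3 0) s12; lra.
have u30 : u e3 0 = u e1 0 by rewrite -u20 -u12.
have sneg : slope u e3 0 < 0 by rewrite s3; lra.
(* By the Kirchhoff condition [u' ^ 2 - 2 * pot u] equals [6 * pot (u e1 0)] on [e3], while [pot]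
   stays positive below the initial value: [u' ^ 2] cannot vanish there. *)
have ne x : 0 <= x <= l -> u e3 x <= u e3 0 -> slope u e3 x != 0.
  move=> xl; rewrite u30 => le; have [_ _ _ pos] := fg.
  have px : 0 < pot (u e3 x).
    move: le; rewrite le_eqVlt => /predU1P[->//|lt].
    exact: pot_gt0_below (pos x xl) lt (ltW pa).
  have := sol_energy p2 fg xl; rewrite s3 u30 exprMn en1 => e.
  by apply/eqP => sx; move: e; rewrite sx expr0n/=; lra.
have [|+ _] := sol_descent fg sneg ne (x := l); first by rewrite lexx ltW.
by rewrite /slope NKl ltxx.
Qed.

Definition glue y z h : triple R := fun e =>
  (match e with e1 => fun x => bump (x + y) | e2 => fun x => bump (x + z) | e3 => h end)
    \_ (edge_set l e).

Lemma glueE u y z h : graph_function l u ->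
  (forall x, 0 <= x -> u e1 x = bump (x + y)) ->
  (forall x, 0 <= x -> u e2 x = bump (x + z)) ->
  (forall x, 0 <= x <= l -> u e3 x = h x) -> u = glue y z h.
Proof.
move=> gu u1 u2 u3; apply/funext => e; apply/funext => x; rewrite /glue patchE.
case: ifPn => [|/negP]; rewrite inE => ex; last exact: gu.
by case: e ex => /=; [exact: u1|exact: u2|exact: u3].
Qed.

Lemma glue_in y z h : [/\ forall x, 0 <= x -> glue y z h e1 x = bump (x + y),
  forall x, 0 <= x -> glue y z h e2 x = bump (x + z) &
  forall x, 0 <= x <= l -> glue y z h e3 x = h x].
Proof. by split=> x xI; rewrite /glue patchE ifT// inE. Qed.

Lemma edge_bump u e y : edge_set l e = [set x | 0 <= x] ->
  (forall x, 0 <= x -> u e x = bump (x + y)) ->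
  [/\ H1 (edge_set l e) (u e), forall x, edge_set l e x -> 0 < u e x,
    solves lam p (edge_set l e) (u e) & slope u e 0 = bump' y].
Proof.
move=> eE ue; have nI := edge_no_isolated (e := e); rewrite /slope eE in nI *.
have d x (_ : [set x | 0 <= x] x) := is_derive_bump_shift lam0 p2 x y.
have [us sl] := sol_solves nI d ue (fun x _ => bump_gt0 lam0 p2 (x + y)).
have [L2b L2b'] := L2_bump_shift lam0 p2 y.
split=> //.
- apply: (H1_intro ue (fun x xI => (d x xI).1)) L2b L2b' => [x xI|]; last exact: test_half_line.
  exact: is_derive_continuous (d x xI).2.
- by move=> x x0; rewrite ue// bump_gt0.
- by rewrite sl ?add0r//=.
Qed.

Lemma edge_segment u h h' :
  (forall x, 0 <= x <= l -> is_derive x 1 h (h' x) /\ is_derive x 1 h' (- gap1 (h x))) ->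
  (forall x, 0 <= x <= l -> 0 < h x) -> (forall x, 0 <= x <= l -> u e3 x = h x) ->
  [/\ H1 (edge_set l e3) (u e3), forall x, edge_set l e3 x -> 0 < u e3 x,
    solves lam p (edge_set l e3) (u e3) &
    forall x, 0 <= x <= l -> slope u e3 x = h' x].
Proof.
move=> d h0 uh.
have [us sl] := sol_solves (edge_no_isolated (e := e3)) d uh h0.
have [ch ch' _ _] := is_derive_sol d h0.
split=> //.
- apply: (H1_intro uh (fun x xI => (d x xI).1)) (L2_segment ch) (L2_segment ch') => [x xI|phi].
    exact: is_derive_continuous (d x xI).2.
  exact: test_segment.
- by move=> x xI; rewrite uh// h0.
Qed.

Lemma glue_solution y z h h' :
  (forall x, 0 <= x <= l -> is_derive x 1 h (h' x) /\ is_derive x 1 h' (- gap1 (h x))) ->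
  (forall x, 0 <= x <= l -> 0 < h x) ->
  bump y = h 0 -> bump z = h 0 -> bump' y + bump' z + h' 0 = 0 -> h' l = 0 ->
  positive_solution lam p l (glue y z h).
Proof.
move=> d h0 yh zh kir kirl; have [g1 g2 g3] := glue_in y z h.
have [H11 p1 so1 sl1] := edge_bump (erefl : edge_set l e1 = _) g1.
have [H12 p2' so2 sl2] := edge_bump (erefl : edge_set l e2 = _) g2.
have [H13 p3 so3 sl3] := edge_segment d h0 g3.
have I0 : (0 : R) <= 0 <= l by rewrite lexx ltW.
have Il : 0 <= l <= l by rewrite lexx ltW.
split; [split; [|split; [|split]]|split; [|split; [|split]]].
- by move=> e x ex; rewrite /glue patchE ifN//; apply/negP; rewrite inE.
- by case.
- by rewrite (g1 0 (lexx 0)) (g2 0 (lexx 0)) !add0r yh zh.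
- by rewrite (g2 0 (lexx 0)) (g3 0 I0) add0r.
- by case.
- by case.
- by rewrite /slope in sl1 sl2 sl3; rewrite sl1 sl2 (sl3 0 I0).
- exact: etrans (sl3 l Il) kirl.
Qed.

Lemma type_A_edges u : positive_solution lam p l u -> type_A u ->
  exists s y, [/\ `|s| < rad, tau s = l, 0 < y, bump y = level s & u = glue y y (rise s)].
Proof.
move=> pu [u12 dec].
have [[gu [_ [_ u20]]] [_ [_ [NK NKl]]]] := pu.
have [sol1 small1] := half_line_sol pu (erefl : edge_set l e1 = _).
have fg := segment_sol pu.
have s12 : slope u e2 = slope u e1 by rewrite /slope u12.
have s1 : slope u e1 0 <= 0.
  have [_ [_ [/(_ e1 0 (lexx 0))[cv _] _]]] := pu.
  have nI : ProperFilter (within (edge_set l e1) 0^') by apply: edge_no_isolated => /=.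
  apply: limr_le => //; exists 1 => //= x _ x0 Ix.
  have {x0 Ix}x0 : 0 < x by rewrite lt_neqAle eq_sym x0.
  by rewrite /diff_quot subr0 ler_pdivrMr// mul0r subr_le0 ltW// dec.
have [y y0 uy] := half_line_bump lam0 p2 sol1 small1 s1.
have uy0 := (uy 0 (lexx 0)).1; have sy0 := (uy 0 (lexx 0)).2.
rewrite add0r in uy0; rewrite add0r in sy0.
have u30 : u e3 0 = bump y by rewrite -u20 -u12.
have s3 : slope u e3 0 = - 2 * bump' y.
  by move: NK; rewrite -/(slope u e1 0) -/(slope u e2 0) -/(slope u e3 0) s12 sy0; lra.
have {}y0 : 0 < y.
  rewrite lt_neqAle y0 andbT; apply/eqP => y00; rewrite -y00 in u30 s3.
  have s30 : slope u e3 0 = 0 by rewrite s3 bump'0 mulr0.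
  by have := edge_from_peak fg u30 s30; rewrite /slope NKl ltxx.
have pb : 0 < pot (bump y) by rewrite pot_bump_gt0// gt_eqF.
have b0 := bump_gt0 lam0 p2 y.
have sr := amp_lt_rad b0 pb; set s := amp (bump y) in sr.
have Xs : level s = bump y by rewrite /s ampK.
have g0 : slope u e3 0 = 2 * Num.sqrt (2 * pot (level s)).
  rewrite s3 Xs -(bump'_sqr lam0 p2) sqrtr_sqr ltr0_norm ?bump'_lt0//.
  ring.
have ls : l = tau s.
  by apply: (edge_from_slope sr fg _ g0 NKl); rewrite Xs.
exists s, y; split; [exact: sr|exact: esym ls|exact: y0|exact: esym Xs|apply: (glueE gu)].
- by move=> x /uy[].
- by move=> x x0; rewrite -u12; have [] := uy x x0.
have rs : sol lam p 0 l (rise s) (rise' s).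
  apply: is_derive_sol => x xl; last exact: rise_gt0.
  by apply: is_derive_rise => //; rewrite -ls.
move=> x xl.
apply: (sol_unique lam0 p2 (ltW l0) fg rs _ _ xl).1; last by rewrite g0 rise'0.
by rewrite u30 rise0.
Qed.

Lemma type_A_exists_unique : exists! u, positive_solution lam p l u /\ type_A u.
Proof.
have [s sr sl] := tau_surj lam0 p2 l0; have [y y0 yX] := bump_level sr.
have [g1 g2 g3] := glue_in y y (rise s).
exists (glue y y (rise s)); split.
  split.
    apply: (@glue_solution y y (rise s) (rise' s)).
    - by move=> x xl; apply: is_derive_rise => //; rewrite sl.
    - by move=> x _; exact: rise_gt0.
    - by rewrite rise0.
    - by rewrite rise0.
    - rewrite rise'0// -yX -(bump'_sqr lam0 p2) sqrtr_sqr ltr0_norm ?bump'_lt0//; ring.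
    - by rewrite -sl rise'_tau.
  split=> [//|x z x0 xz]; rewrite !g1 ?(le_trans x0 (ltW xz))//.
  by apply: (bump_decr lam0 p2); [rewrite addr_ge0// ltW|rewrite ltrD2r].
move=> u [pu /(type_A_edges pu)[t [z [tr tl z0 zX ->]]]].
have st : s = t by apply: (tau_inj lam0 p2 sr tr); rewrite tl.
have -> : z = y by apply: (bump_inj_ge0 lam0 p2 (ltW z0) (ltW y0)); rewrite yX st.
by rewrite st.
Qed.

(** [bump'] is odd, so the slopes of the translates by [y] and [- y] cancel at the vertex and the
    Kirchhoff condition leaves slope 0 on [e3]. *)
Lemma type_C_edges u : positive_solution lam p l u -> type_C lam p u ->
  exists s y, [/\ `|s| < rad, orbit' s l = 0, y != 0, bump y = level s &
    u = glue y (- y) (orbit s)].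
Proof.
move=> pu [y]; rewrite solitonE// => uy.
have u1 x : 0 <= x -> u e1 x = bump (x + y) by move=> x0; have [-> _] := uy x x0.
have u2 x : 0 <= x -> u e2 x = bump (x - y) by move=> x0; have [_ ->] := uy x x0.
have [[gu [_ [_ u20]]] [_ [_ [NK NKl]]]] := pu.
have fg := segment_sol pu.
have [_ _ _ s1] := edge_bump (erefl : edge_set l e1 = _) u1.
have [_ _ _ s2] := edge_bump (erefl : edge_set l e2 = _) u2.
have s3 : slope u e3 0 = 0.
  rewrite /slope in s1 s2; move: NK; rewrite -/(slope u e3 0) s1 s2 bump'_sym.
  by rewrite subrr add0r.
have u30 : u e3 0 = bump y by rewrite -u20 (u2 0 (lexx 0)) sub0r bumpN.
have y0 : y != 0.
  apply/eqP => y0; rewrite y0 in u30.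
  by have := edge_from_peak fg u30 s3; rewrite /slope NKl ltxx.
have sr := amp_lt_rad (bump_gt0 lam0 p2 y) (pot_bump_gt0 y0).
have Xs : level (amp (bump y)) = bump y by rewrite ampK// bump_gt0.
have f0 : u e3 0 = level (amp (bump y)) by rewrite Xs.
have oE := edge_even sr fg f0 s3.
exists (amp (bump y)), y; split; [exact: sr| |exact: y0|exact: esym Xs|].
  by have [|_ <-] := oE l; [rewrite lexx ltW|exact: NKl].
by apply: (glueE gu u1 u2) => x /oE[].
Qed.

Lemma type_C_glue s y : `|s| < rad -> orbit' s l = 0 -> bump y = level s ->
  positive_solution lam p l (glue y (- y) (orbit s)) /\
  type_C lam p (glue y (- y) (orbit s)).
Proof.
move=> sr sl yX; have [g1 g2 _] := glue_in y (- y) (orbit s); split.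
  apply: (@glue_solution y (- y) (orbit s) (orbit' s)).
  - by move=> x _; exact: is_derive_orbit.
  - by move=> x _; exact: orbit_gt0.
  - by rewrite (orbit0 lam0 p2 sr).
  - by rewrite bumpN (orbit0 lam0 p2 sr).
  - by rewrite (orbit'0 lam0 p2 sr) bump'_sym subrr addr0.
  - exact: sl.
by exists y; rewrite solitonE// => x x0; rewrite (g1 x x0) (g2 x x0).
Qed.

(** The value at the vertex determines [s], but [y] only up to sign. A negative translation is
    recognized on [e1] by the abscissa at which the soliton attains its maximum. *)
Lemma glue_inj s t y z : `|s| < rad -> `|t| < rad -> y != 0 ->
  bump y = level s -> bump z = level t ->
  glue y (- y) (orbit s) = glue z (- z) (orbit t) -> s = t /\ y = z.
Proof.
move=> sr tr y0 yX zX gyz.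
have [g1 _ _] := glue_in y (- y) (orbit s); have [h1 _ _] := glue_in z (- z) (orbit t).
have e x : 0 <= x -> bump (x + y) = bump (x + z).
  by move=> x0; rewrite -(g1 x x0) gyz (h1 x x0).
have st : s = t.
  have := e 0 (lexx 0); rewrite !add0r yX zX => /(congr1 amp).
  by move: sr tr; rewrite !ltr_norml => /andP[rs _] /andP[rt _]; rewrite !levelK.
split; first exact: st.
have b0 x : bump x = bump 0 -> x = 0.
  by move=> bx; apply/eqP/negPn/negP => /pot_bump_gt0; rewrite bx (pot_bump0 lam0 p2) ltxx.
have [y1|y1] := leP 0 y; last first.
  have Ny : 0 <= - y by rewrite oppr_ge0 ltW.
  have := e _ Ny; rewrite addNr => /esym/b0/eqP.
  by rewrite addrC subr_eq0 => /eqP ->.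
have [z1|z1] := leP 0 z.
  apply: (bump_inj_ge0 lam0 p2 y1 z1).
  by have := e 0 (lexx 0); rewrite !add0r.
have Nz : 0 <= - z by rewrite oppr_ge0 ltW.
have := e _ Nz; rewrite addNr => /b0/eqP.
by rewrite addrC subr_eq0 => /eqP.
Qed.

(* Besides [root 0 = 0], the roots number [2 k - 1] and [2 k] are the positive and the
   negative amplitude whose [k] half-periods last [l]. *)
Definition branch (j : nat) s :=
  [/\ `|s| < rad, (if odd j then 0 < s else s < 0) & half_periods (uphalf j) s = l].

Definition root (j : nat) : R := if j is 0%N then 0 else get (branch j).

Lemma branch_unique j s t : (0 < j)%N -> branch j s -> branch j t -> s = t.
Proof.
move=> j0 [sr s0 sl] [tr t0 tl].
have k0 : (0 < uphalf j)%N by case: j j0 {s0 t0 sl tl}.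
wlog lt : s t sr tr s0 t0 sl tl / s < t.
  by move=> H; have [/H->//|/H->//|] := ltgtP s t.
move: sr tr; rewrite !ltr_norml => /andP[s1 s2] /andP[t1 t2].
move: s0 t0; case: ifP => _ s0 t0.
  by have := half_periods_incr lam0 p2 k0 (ltW s0) lt t2; rewrite sl tl ltxx.
by have := half_periods_decr lam0 p2 k0 s1 lt (ltW t0); rewrite sl tl ltxx.
Qed.

(** The sign of [s] gives the parity of the index; the number of half-periods is determined because
    the clock is strictly increasing. *)
Lemma branch_index j k s : branch j s -> branch k s -> j = k.
Proof.
move=> [sr js jl] [_ ks kl].
have ojk : odd j = odd k.
  move: js ks; case: (odd j); case: (odd k) => // a b.
    by have := lt_trans a b; rewrite ltxx.
  by have := lt_trans a b; rewrite ltxx.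
have ujk : uphalf j = uphalf k.
  have [lt|lt|//] := ltngtP (uphalf j) (uphalf k).
    by have := half_periods_ltn lam0 p2 sr lt; rewrite jl kl ltxx.
  by have := half_periods_ltn lam0 p2 sr lt; rewrite jl kl ltxx.
have hjk : j./2 = k./2 by apply/eqP; rewrite -(eqn_add2l (odd j)) -uphalf_half ojk -uphalf_half ujk.
by rewrite -(odd_double_half j) -(odd_double_half k) ojk hjk.
Qed.

(** * Counting the solutions of type C *)

Section count.
Variable n : nat.
Hypotheses (nl : n%:R * ell_star lam p < l) (ln : l <= n.+1%:R * ell_star lam p).

Let ell0 : 0 < ell_star lam p := ell_star_gt0.

Let branch_root j : (0 < j < 2 * n + 1)%N -> branch j (root j).
Proof.
move=> /andP[j0 jn]; case: j j0 jn => // j _ jn; rewrite /root.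
have k0 : (0 < uphalf j.+1)%N by [].
have kn : (uphalf j.+1 <= n)%N.
  by move: jn; rewrite addn1 ltnS mul2n uphalfE leq_half_double ltnS.
have kl : (uphalf j.+1)%:R * ell_star lam p < l.
  by apply: le_lt_trans nl; rewrite ler_pM2r// ler_nat.
have [[s /andP[s0 sr] sl] [t /andP[tr t0] tl]] := half_periods_surj lam0 p2 k0 kl.
have r0 := rad_gt0 lam0 p2.
case: (boolP (odd j.+1)) => oj.
  apply: (getI (x := s)); split; last exact: sl.
    by rewrite ltr_norml sr andbT (lt_trans _ s0)// oppr_lt0.
  by rewrite oj.
apply: (getI (x := t)); split; last exact: tl.
  by rewrite ltr_norml tr (lt_trans t0).
by rewrite (negbTE oj).
Qed.

Lemma root_even j : (j < 2 * n + 1)%N -> `|root j| < rad /\ orbit' (root j) l = 0.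
Proof.
move=> jn; have [->|j0] := posnP j.
  rewrite normr0 rad_gt0//; split=> //.
  by apply/(orbit'_eq0 lam0 p2) => //; [rewrite normr0 rad_gt0|left].
have [sr _ sl] := branch_root (introT andP (conj j0 jn)).
split=> //; apply/(orbit'_eq0 lam0 p2) => //; right; exists (uphalf j) => //.
by case: j j0 {jn sr sl}.
Qed.

Lemma root_inj j k : (j < 2 * n + 1)%N -> (k < 2 * n + 1)%N -> root j = root k -> j = k.
Proof.
have nz i : (0 < i < 2 * n + 1)%N -> root i != 0.
  by move=> /branch_root[_ + _]; case: ifP => _ => [/gt_eqF|/lt_eqF] ->.
move=> jn kn e; have [j0|j0] := posnP j; have [k0|k0] := posnP k.
- by rewrite j0 k0.
- by have := nz k; rewrite k0 kn -e j0 eqxx => /(_ isT).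
- by have := nz j; rewrite j0 jn e k0 eqxx => /(_ isT).
- apply: (@branch_index _ _ (root j)); last rewrite e; apply: branch_root.
    by rewrite j0.
  by rewrite k0.
Qed.

Lemma root_surj s : `|s| < rad -> orbit' s l = 0 -> exists2 j, (j < 2 * n + 1)%N & root j = s.
Proof.
move=> sr /(orbit'_eq0 lam0 p2 sr l0) H.
have [s0|s0] := eqVneq s 0; first by exists 0%N; rewrite ?addn1// s0.
case: H => [s00|[k k0 kl]]; first by move: s0; rewrite s00 eqxx.
(* For a nonzero amplitude [k * ell_star < l] is strict, so [k = n + 1] is excluded even when
   [l = (n + 1) * ell_star]. *)
have kn : (k <= n)%N.
  have := half_periods_gt lam0 p2 k0 sr s0; rewrite kl => /lt_le_trans/(_ ln).
  by rewrite ltr_pM2r// ltr_nat ltnS.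
pose j := if 0 < s then k.*2.-1 else k.*2.
have k2 : (0 < k.*2.-1)%N by case: k k0 {kl kn j}.
have jn : (0 < j < 2 * n + 1)%N.
  rewrite addn1 ltnS mul2n /j; case: ifP => _; last by rewrite double_gt0 k0 leq_double.
  by rewrite k2 (leq_trans (leq_pred _))// leq_double.
have jP : branch j s.
  have kE : k.*2 = k.*2.-1.+1 by rewrite prednK// double_gt0.
  split=> //; rewrite /j; case: ltP => s1.
  - have -> // : odd k.*2.-1; apply: negbNE.
    by rewrite -oddS -kE odd_double.
  - by rewrite odd_double lt_neqAle s0.
  - by rewrite uphalfE -kE doubleK.
  - by rewrite uphalf_double.
have /andP[j0 j1] := jn.
by exists j => //; exact: branch_unique j0 (branch_root jn) jP.
Qed.

Let shift s := get [set y | 0 < y /\ bump y = level s].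

Let shiftP s : `|s| < rad -> 0 < shift s /\ bump (shift s) = level s.
Proof.
move=> /bump_level[y y0 yX].
by apply: (@getI _ [set y | 0 < y /\ bump y = level s] y); split.
Qed.

(** Encodes the [2 * (2 n + 1)] solutions by one index: [i./2] selects the root, and the parity of
    [i] the sign of the translation. *)
Let signed_shift (i : nat) := (-1) ^+ odd i * shift (root i./2).

Let signed_shiftP i : (i < 4 * n + 2)%N -> [/\ (i./2 < 2 * n + 1)%N,
  signed_shift i != 0, bump (signed_shift i) = level (root i./2) & odd i = (signed_shift i < 0)].
Proof.
move=> iN; have i2 : (i./2 < 2 * n + 1)%N.
  by rewrite ltn_half_double -mul2n mulnDr mulnA.
have [sr _] := root_even i2; have [s0 sX] := shiftP sr.
rewrite /signed_shift; split=> //.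
- by rewrite mulf_neq0 ?signr_eq0// gt_eqF.
- by case: odd; rewrite ?expr1 ?expr0 ?mulN1r ?mul1r ?bumpN.
- by case: odd; rewrite ?expr1 ?expr0 ?mulN1r ?mul1r ?oppr_lt0 ?s0// ltNge ltW.
Qed.

Lemma card_type_C :
  ([set u : triple R | positive_solution lam p l u /\ type_C lam p u] #= `I_(4 * n + 2))%card.
Proof.
pose nth_sol i := glue (signed_shift i) (- signed_shift i) (orbit (root i./2)).
suff -> : [set u : triple R | positive_solution lam p l u /\ type_C lam p u] =
  nth_sol @` `I_(4 * n + 2).
  apply: inj_card_eq => i j; rewrite !inE => iN jN e.
  have [i2 yi yX oi] := signed_shiftP iN; have [j2 _ zX oj] := signed_shiftP jN.
  have [sr _] := root_even i2; have [tr _] := root_even j2.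
  have [st yz] := glue_inj sr tr yi yX zX e.
  have ij := root_inj i2 j2 st.
  by rewrite -(odd_double_half i) -(odd_double_half j) ij oi oj yz.
apply/seteqP; split=> [u [pu /(type_C_edges pu)[s [y [sr sl y0 yX ->]]]]|_ [i iN <-]]; last first.
  have [i2 yi yX _] := signed_shiftP iN; have [sr sl] := root_even i2.
  exact: type_C_glue.
have [j jn js] := root_surj sr sl.
pose i := ((y < 0)%R + j.*2)%N.
have iN : (i < 4 * n + 2)%N.
  have : (i < (2 * n + 1).*2)%N by rewrite -ltn_half_double half_bit_double.
  by rewrite -mul2n mulnDr mulnA.
exists i; first exact: iN.
have [i2 yi zX oi] := signed_shiftP iN.
have ij : i./2 = j by exact: half_bit_double.
have oy : odd i = (y < 0) by rewrite /i oddD odd_double addbF; case: (y < 0).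
rewrite ij js in zX.
suff yE : signed_shift i = y by rewrite /nth_sol yE ij js.
have [y1|y1] := ltP y 0.
  apply: oppr_inj; apply: (bump_inj_ge0 lam0 p2).
  - by rewrite oppr_ge0 ltW// -oi oy.
  - by rewrite oppr_ge0 ltW.
  - by rewrite !bumpN zX yX.
apply: (bump_inj_ge0 lam0 p2); [|exact: y1|by rewrite zX yX].
by rewrite leNgt -oi oy -leNgt.
Qed.

End count.

End t_graph.

Theorem theorem1p2 (R : realType) (lam p : R) (hlam : 0 < lam) (hp : 2 < p) :
  (forall l : R, 0 < l ->
    exists! u : triple R, positive_solution lam p l u /\ type_A u) /\
  (forall l : R, 0 < l ->
    ~ exists u : triple R, positive_solution lam p l u /\ type_B lam p u) /\
  (0 < ell_star lam p /\
   forall (l : R) (n : nat),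
     n%:R * ell_star lam p < l -> l <= n.+1%:R * ell_star lam p ->
     ([set u : triple R | positive_solution lam p l u /\ type_C lam p u]
        #= `I_(4 * n + 2)%N)%card).
Proof.
have ell0 := ell_star_gt0 hlam hp.
split; first by move=> l l0; exact: (type_A_exists_unique hlam hp l0).
split; first by move=> l l0 [u [pu]]; exact: (no_type_B hlam hp l0 pu).
split; [exact: ell0|move=> l n nl ln]; apply: (card_type_C hlam hp _ nl ln).
by apply: le_lt_trans nl; rewrite mulr_ge0// ltW.
Qed.
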